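(* Let $\mathcal{M}=hK_\theta$ be a nearly $S^*$-invariant subspace of $H^2$, where $h$ is its extremal function and $\theta$ is the associated inner function, with $\theta(0)=0$. Let $A_z^{\mathcal{M}}$ be the compressed shift on $\mathcal{M}$. Then the essential spectrum is $\sigma_e(A_z^{\mathcal{M}})=\sigma(\theta)\cap\mathbb{T}$.
   Context: $H^2=H^2(\mathbb{D})$ is the Hardy space of the unit disc, viewed also as a subspace of $L^2=L^2(\mathbb{T})$; $S$ is the shift $(Sf)(z)=zf(z)$ and $S^*$ is its adjoint. For an inner function $\theta$, $K_\theta=H^2\ominus\theta H^2$. A closed subspace $\mathcal{M}\subseteq H^2$ is nearly $S^*$-invariant if $f\in\mathcal{M}$ and $f(0)=0$ imply $S^*f\in\mathcal{M}$. Saying that $\mathcal{M}=hK_\theta$ is nearly $S^*$-invariant with extremal function $h$ and associated inner function $\theta$, $\theta(0)=0$, means (Hitt's theorem): $h\in\mathcal{M}$, $\|h\|=1$, $h(0)>0$, $h$ is orthogonal to every element of $\mathcal{M}$ vanishing at $0$, and multiplication by $h$ is an isometry of $K_\theta$ onto $\mathcal{M}$. The compressed shift on $\mathcal{M}$ is $A_z^{\mathcal{M}}f=P_{\mathcal{M}}(zf)$, $f\in\mathcal{M}$, where $P_{\mathcal{M}}$ is the orthogonal projection of $L^2$ onto $\mathcal{M}$. A bounded operator $T$ is Fredholm if its range $R(T)$ is closed and both $R(T)^\perp$ and the null space of $T$ are finite-dimensional; $\sigma_e(T)=\{\lambda\in\mathbb{C}:T-\lambda I\text{ is not Fredholm}\}$.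 For a nonconstant inner function $\theta=e^{iy}Bs_\mu$, with $B$ a Blaschke product with zeros $\{a_n\}$ in $\mathbb{D}$ and $s_\mu(z)=\exp\left(-\int_{\mathbb{T}}\frac{\xi+z}{\xi-z}\,d\mu(\xi)\right)$ the singular inner factor with positive singular measure $\mu$, the spectrum of $\theta$ is $\sigma(\theta)=\{a_n\}^-\cup\operatorname{supp}\mu$ (the bar denoting closure); equivalently $\sigma(\theta)=\{\lambda\in\overline{\mathbb{D}}:\liminf_{z\to\lambda,\,z\in\mathbb{D}}|\theta(z)|=0\}$. *)

(* Defs.v *)
From HB Require Import structures.
From mathcomp Require Import all_boot all_order all_algebra.
From mathcomp Require Import all_classical all_reals all_analysis.
From mathcomp Require Export complex.

Set Implicit Arguments.
Unset Strict Implicit.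
Unset Printing Implicit Defensive.

Import Order.TTheory GRing.Theory Num.Theory.
Import numFieldTopology.Exports numFieldNormedType.Exports.

Local Open Scope classical_set_scope.
Local Open Scope ring_scope.

(* The complex numbers, with the usual topology: R[i] alone carries only the
   algebraic structure, the topology lives on its regular module R[i]^o. *)
Notation Cplx R := ((R[i])^o).

(* The modulus as an element of R; the ring norm `|z| of R[i] is valued
   in R[i]. *)
Notation cmod := Normc.normc.

Definition disc (R : realType) : set (Cplx R) := [set z | cmod z < 1].

Definition circle (R : realType) : set (Cplx R) := [set z | cmod z = 1].

(* e^{it} *)
Definition expi (R : realType) (t : R) : Cplx R := Complex (cos t) (sin t).

Definition cexp (R : realType) (z : Cplx R) : Cplx R :=
  Complex (expR (complex.Re z)) 0 * expi (complex.Im z).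

(* A function f holomorphic in the disc is represented by its Taylor
   coefficients at 0, which for f in H^2 are also the Fourier coefficients of
   its boundary function in L^2(T). By Parseval, the L^2(T) inner product of
   two elements of H^2 (normalized arc length) is l2dot of the coefficients.
   In particular f 0%N is the value f(0). *)
Notation taylor R := (nat -> Cplx R).

Definition eval (R : realType) (f : taylor R) (z : Cplx R) : Cplx R :=
  limn (series (fun n => f n * z ^+ n : Cplx R)).

(* Cauchy product, i.e. pointwise multiplication of functions on the disc *)
Definition pmul (R : realType) (f g : taylor R) : taylor R :=
  fun n => \sum_(k < n.+1) f k * g (n - k)%N.

Definition l2dot (R : realType) (f g : taylor R) : Cplx R :=
  limn (series (fun n => f n * conjc (g n) : Cplx R)).

Definition l2norm (R : realType) (f : taylor R) : R :=
  Num.sqrt (limn (series (fun n => cmod (f n) ^+ 2))).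

Definition H2 (R : realType) : set (taylor R) :=
  [set f | cvgn (series (fun n => cmod (f n) ^+ 2))].

Definition shift (R : realType) (f : taylor R) : taylor R :=
  fun n => if n is m.+1 then f m else 0.

(* The adjoint of shift, see l2dot_shift. *)
Definition bshift (R : realType) (f : taylor R) : taylor R :=
  fun n => f n.+1.

Lemma l2dot_shift (R : realType) (f g : taylor R) :
  l2dot (shift f) g = l2dot f (bshift g).
Proof.
rewrite /l2dot; set u := series _; set v := series _.
have uv : (fun n => u n.+1) = v.
  apply/funext => n; rewrite /u /v /series /= big_nat_recl //= mul0r add0r.
  by [].
rewrite -uv /lim /lim_in; congr (get _).
apply/seteqP; split => l /=.
  by rewrite -cvg_shiftS.
by rewrite -[X in _ -> X]cvg_shiftS.
Qed.

Definition l2closed (R : realType) (V : set (taylor R)) : Prop :=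
  forall (u : nat -> taylor R) (f : taylor R),
    (forall k, V (u k)) -> H2 f -> l2norm (u k - f) @[k --> \oo] --> (0 : R) ->
    V f.

Definition closed_subspace (R : realType) (M : set (taylor R)) : Prop :=
  [/\ M `<=` @H2 R, M 0,
      forall (a : R[i]) f g, M f -> M g -> M (a *: f + g) &
      l2closed M].

Definition nearly_bshift_invariant (R : realType) (M : set (taylor R)) : Prop :=
  closed_subspace M /\ forall f, M f -> f 0%N = 0 -> M (bshift f).

Definition inner (R : realType) (theta : taylor R) : Prop :=
  [/\ H2 theta,
      exists K : R, forall z, disc z -> cmod (eval theta z) <= K &
      \forall t \ae (@lebesgue_measure R),
        cmod (eval theta (Complex r 0 * expi t)) @[r --> 1^'-] --> (1 : R)].

Definition model_space (R : realType) (theta : taylor R) : set (taylor R) :=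
  [set g | H2 g /\ forall f, H2 f -> l2dot g (pmul theta f) = 0].

(* M = h K_theta, with h the extremal function of M and theta the associated
   inner function. In R[i], 0 < x means that x is real and positive. *)
Definition hitt (R : realType) (M : set (taylor R)) (h theta : taylor R) :
    Prop :=
  [/\ [/\ inner theta & theta 0%N = 0],
      [/\ M h, l2norm h = 1 & 0 < h 0%N],
      forall f, M f -> f 0%N = 0 -> l2dot h f = 0,
      forall g, model_space theta g -> l2norm (pmul h g) = l2norm g &
      pmul h @` model_space theta = M].

Definition orthproj (R : realType) (M : set (taylor R)) (f : taylor R) :
    taylor R :=
  xget 0 [set g | M g /\ forall k, M k -> l2dot (f - g) k = 0].

Definition compressed_shift (R : realType) (M : set (taylor R))
    (f : taylor R) : taylor R :=
  orthproj M (shift f).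

Definition findim (R : realType) (V : set (taylor R)) : Prop :=
  exists n (b : 'I_n -> taylor R), forall f, V f ->
    exists c : 'I_n -> R[i], f = \sum_(i < n) c i *: b i.

(* T is an operator on the Hilbert space M; its values outside M are
   irrelevant, and the orthogonal complement of the range is taken in M. *)
Definition fredholm (R : realType) (M : set (taylor R))
    (T : taylor R -> taylor R) : Prop :=
  [/\ l2closed (T @` M),
      findim [set g | M g /\ forall f, M f -> l2dot (T f) g = 0] &
      findim [set f | M f /\ T f = 0]].

Definition ess_spectrum (R : realType) (M : set (taylor R))
    (T : taylor R -> taylor R) : set (Cplx R) :=
  [set lam : Cplx R | ~ fredholm M (fun f => T f - (lam : R[i]) *: f)].

Definition liminf_spectrum (R : realType) (theta : taylor R) :
    set (Cplx R) :=
  [set lam : Cplx R | cmod lam <= 1 /\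
    limf_einf (fun z : Cplx R => (cmod (eval theta z))%:E)
      (within (@disc R) (nbhs lam)) = 0%E].

(* The zeros of a Blaschke product, repeated according to multiplicity, are the
   c such that a n = Some c; indices with a n = None contribute no factor, so
   that finite products are included. *)
Definition blaschke_factor (R : realType) (a z : Cplx R) : Cplx R :=
  if a == 0 then z
  else Complex (cmod a) 0 / a * ((a - z) / (1 - conjc a * z)).

Definition blaschke (R : realType) (a : nat -> option (Cplx R)) (z : Cplx R) :
    Cplx R :=
  limn (fun n => \prod_(k < n)
    (if a k is Some c then blaschke_factor c z else 1) : Cplx R).

Definition blaschke_zeros (R : realType) (a : nat -> option (Cplx R)) : Prop :=
  (forall n c, a n = Some c -> disc c) /\
  cvgn (series (fun n => if a n is Some c then 1 - cmod c else 0 : R)).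

(* A measure on the circle is represented by a measure on the line concentrated
   on [0, 2 pi[, through t |-> e^{it}. *)
Definition singular_circle_measure (R : realType)
    (mu : {finite_measure set (measurableTypeR R) -> \bar R}) : Prop :=
  mu (~` `[0, 2 * pi[%classic) = 0%E /\
  exists A : set (measurableTypeR R),
    [/\ measurable A, @lebesgue_measure R A = 0%E & mu (~` A) = 0%E].

Definition circle_supp (R : realType)
    (mu : {finite_measure set (measurableTypeR R) -> \bar R}) :
    set (Cplx R) :=
  [set lam : Cplx R | circle lam /\
    forall e : R, 0 < e -> (0 < mu [set t | (cmod (expi t - lam) < e)%R])%E].

Definition herglotz_kernel (R : realType) (z : Cplx R) (t : R) : Cplx R :=
  (expi t + z) / (expi t - z).

Definition singular_inner (R : realType)
    (mu : {finite_measure set (measurableTypeR R) -> \bar R}) (z : Cplx R) :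
    Cplx R :=
  cexp (- Complex (\int[mu]_t complex.Re (herglotz_kernel z t))
                  (\int[mu]_t complex.Im (herglotz_kernel z t))).

Definition canonical_factorization (R : realType) (theta : taylor R) (y : R)
    (a : nat -> option (Cplx R))
    (mu : {finite_measure set (measurableTypeR R) -> \bar R}) : Prop :=
  [/\ blaschke_zeros a, singular_circle_measure mu &
      forall z, disc z ->
        eval theta z = expi y * blaschke a z * singular_inner mu z].

Definition factor_spectrum (R : realType) (a : nat -> option (Cplx R))
    (mu : {finite_measure set (measurableTypeR R) -> \bar R}) :
    set (Cplx R) :=
  closure [set c : Cplx R | exists n, a n = Some c] `|` circle_supp mu.

(* Main.v *)
Require Import Defs.
From mathcomp Require Import all_boot all_order all_algebra.
From mathcomp Require Import all_classical all_reals all_analysis.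
From mathcomp Require Import measurable_realfun.
From mathcomp Require Import ring lra zify.

(* Multiplication by h identifies M with K_theta and intertwines the shift with
   multiplication by z on the hyperplane of those f for which z f stays in M.
   Hence T = A_z^M - lam acts there as multiplication by z - lam, which is
   injective; so the kernel and the cokernel of T are at most one-dimensional and
   T is Fredholm exactly when its range is closed.

   If |lam| <> 1, z - lam is bounded below. If |lam| = 1 and |theta| >= ep on the
   part of the disc near lam, z - lam is bounded below on K_theta: away from lam
   this is clear, and near lam one writes, for f in K_theta,
   conj(f) theta = k on the circle with k in z H^2, so that a cutoff times |f|^2
   equals the cutoff times f k / theta, and the contour may be pushed into the
   disc, where |f| is controlled by |(z - lam) f|. To keep the boundary integrals
   elementary this is carried out for polynomials and means over roots of unity.

   Conversely, if T has closed range, then S^* - conj(lam) is bounded below on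
   the elements of M vanishing at 0, by the uniform boundedness principle. The
   functions h (k_w - 1), with k_w the reproducing kernel of K_theta, violate
   this when w tends to lam and theta(w) tends to 0.

   For theta = e^{iy} B s_mu, a lower bound of |theta| near lam forces
   mu(I) <= C |I| on short arcs I near lam, since the Poisson integral of mu
   dominates mu(I)/|I|; as mu is singular, it vanishes near lam. *)

Set Implicit Arguments.
Unset Strict Implicit.
Unset Printing Implicit Defensive.

Import Order.TTheory GRing.Theory Num.Theory.
Import numFieldTopology.Exports numFieldNormedType.Exports.

Local Open Scope classical_set_scope.
Local Open Scope ring_scope.

(** The lower bound on [K_theta] needs a constant that depends only on the bounds for [theta],
    although [theta] need not extend continuously to the circle. Three limits are therefore taken in
    turn with one constant: in the number of roots of unity, in the dilation [theta(rz)] and in the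
    truncation of an element of [K_theta]. A truncation leaves [K_theta], so the polynomial estimate
    carries an extra term, the pairings with [z^m theta], which disappears in the limit by Bessel's
    inequality. The boundary values of [theta] serve only to make the [z^m theta] orthonormal;
    [K_theta], multiplication by [theta] and the kernels are then treated through expansions in this
    system. The bounds on kernel and cokernel come from two functionals: pairing with the unit
    vector [h S^* theta], whose orthogonal complement in [M] is mapped into [M] by the shift, and
    evaluation at 0, because near invariance makes the adjoint of [T] act as [S^* - conj(lam)] on
    the elements of [M] vanishing at 0. *)

Local Notation shift := Defs.shift.
Local Notation eval := Defs.eval.

(** * Real-valued modulus of complex numbers *)

Section Modulus.
Variable R : realType.
Implicit Types z w : R[i].

Lemma cmod_ge0 z : 0 <= cmod z.
Proof. by case: z => a b; exact: sqrtr_ge0. Qed.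

Lemma cmod0 : cmod (0 : R[i]) = 0.
Proof. exact: Normc.normc0. Qed.

Lemma cmod1 : cmod (1 : R[i]) = 1.
Proof. exact: Normc.normc1. Qed.

Lemma cmod_eq0 z : (cmod z == 0) = (z == 0).
Proof.
by apply/eqP/eqP => [/Normc.eq0_normc//|->]; rewrite cmod0.
Qed.

Lemma cmod_gt0 z : (0 < cmod z) = (z != 0).
Proof. by rewrite lt_def cmod_eq0 cmod_ge0 andbT. Qed.

Lemma cmodM z w : cmod (z * w) = cmod z * cmod w.
Proof. exact: Normc.normcM. Qed.

Lemma cmodV z : cmod z^-1 = (cmod z)^-1.
Proof. exact: Normc.normcV. Qed.

Lemma cmodX z n : cmod (z ^+ n) = cmod z ^+ n.
Proof. by elim: n => [|n IH]; rewrite ?expr0 ?cmod1// !exprS cmodM IH. Qed.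

Lemma cmodN z : cmod (- z) = cmod z.
Proof. exact: normcN. Qed.

Lemma cmodD z w : cmod (z + w) <= cmod z + cmod w.
Proof. exact: le_normcD. Qed.

Lemma cmodB z w : cmod (z - w) <= cmod z + cmod w.
Proof. by rewrite -(cmodN w); exact: cmodD. Qed.

Lemma cmodC z w : cmod (z - w) = cmod (w - z).
Proof. by rewrite -cmodN opprB. Qed.

Lemma cmod_triB z w : cmod z - cmod w <= cmod (z - w).
Proof. by rewrite lerBlDr -{1}(subrK w z); exact: cmodD. Qed.

Lemma cmodJ z : cmod (conjc z) = cmod z.
Proof. by case: z => a b /=; rewrite sqrrN. Qed.

Lemma cmod_real (x : R) : cmod (Complex x 0) = `|x|.
Proof. by rewrite /= expr0n /= addr0 sqrtr_sqr. Qed.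

Lemma cmod_i : cmod (Complex 0 1 : R[i]) = 1.
Proof. by rewrite /= expr0n /= add0r expr1n sqrtr1. Qed.

Lemma cmod_sqE z : cmod z ^+ 2 = complex.Re z ^+ 2 + complex.Im z ^+ 2.
Proof. by case: z => a b /=; rewrite sqr_sqrtr// addr_ge0 ?sqr_ge0. Qed.

Lemma cmod_sum (I : Type) (r : seq I) (P : pred I) (F : I -> R[i]) :
  cmod (\sum_(i <- r | P i) F i) <= \sum_(i <- r | P i) cmod (F i).
Proof.
elim/big_rec2: _ => [|i y x _ le]; first by rewrite cmod0.
by apply: (le_trans (cmodD _ _)); rewrite lerD2l.
Qed.

Lemma mul_conjc z : z * conjc z = Complex (cmod z ^+ 2) 0.
Proof.
rewrite cmod_sqE; case: z => a b /=; apply/eqP; rewrite eq_complex /=.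
by apply/andP; split; apply/eqP; ring.
Qed.

Lemma normcE z : `|z| = Complex (cmod z) 0.
Proof. by case: z. Qed.

Lemma cmod_ge_Re z : `|complex.Re z| <= cmod z.
Proof.
rewrite -(ler_pXn2r (_ : (0 < 2)%N)) ?nnegrE ?cmod_ge0// cmod_sqE.
by rewrite real_normK ?num_real// lerDl sqr_ge0.
Qed.

Lemma cmod_ge_Im z : `|complex.Im z| <= cmod z.
Proof.
rewrite -(ler_pXn2r (_ : (0 < 2)%N)) ?nnegrE ?cmod_ge0// cmod_sqE.
by rewrite real_normK ?num_real// lerDr sqr_ge0.
Qed.

Lemma cmod_le_ReIm z : cmod z <= `|complex.Re z| + `|complex.Im z|.
Proof.
rewrite -(ler_pXn2r (_ : (0 < 2)%N)) ?nnegrE ?cmod_ge0 ?addr_ge0//.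
rewrite cmod_sqE sqrrD !real_normK ?num_real//.
have := mulr_ge0 (normr_ge0 (complex.Re z)) (normr_ge0 (complex.Im z)).
by set x := _ ^+ 2; set y := _ ^+ 2; set u := _ * _; rewrite mulr2n; lra.
Qed.

Lemma RecD z w : complex.Re (z + w) = complex.Re z + complex.Re w.
Proof. by case: z w => [? ?] [? ?]. Qed.

Lemma ImcD z w : complex.Im (z + w) = complex.Im z + complex.Im w.
Proof. by case: z w => [? ?] [? ?]. Qed.

Lemma RecB z w : complex.Re (z - w) = complex.Re z - complex.Re w.
Proof. by case: z w => [? ?] [? ?]. Qed.

Lemma ImcB z w : complex.Im (z - w) = complex.Im z - complex.Im w.
Proof. by case: z w => [? ?] [? ?]. Qed.

Lemma RecM z w :
  complex.Re (z * w) = complex.Re z * complex.Re w - complex.Im z * complex.Im w.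
Proof. by case: z w => [? ?] [? ?]. Qed.

Lemma ImcM z w :
  complex.Im (z * w) = complex.Re z * complex.Im w + complex.Im z * complex.Re w.
Proof. by case: z w => [? ?] [? ?]. Qed.

Lemma cmodD_sq z w :
  cmod (z + w) ^+ 2 = cmod z ^+ 2 + cmod w ^+ 2 + 2 * complex.Re (z * conjc w).
Proof.
by rewrite !cmod_sqE RecD ImcD RecM; case: z w => [a b] [c d] /=; ring.
Qed.

Lemma cmodD_sq_le z w : cmod (z + w) ^+ 2 <= 2 * cmod z ^+ 2 + 2 * cmod w ^+ 2.
Proof.
rewrite !cmod_sqE RecD ImcD; case: z w => [a b] [c d] /=.
by have := sqr_ge0 (a - c); have := sqr_ge0 (b - d); nra.
Qed.

Lemma expiD (s t : R) : expi (s + t) = expi s * expi t.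
Proof.
rewrite /expi cosD sinD; apply/eqP; rewrite eq_complex /=.
by apply/andP; split; apply/eqP; ring.
Qed.

Lemma cmod_expi (t : R) : cmod (expi t) = 1.
Proof. by rewrite /= cos2Dsin2 sqrtr1. Qed.

Lemma expiX (t : R) n : expi t ^+ n = expi (t *+ n) :> R[i].
Proof.
elim: n => [|n IH]; first by rewrite expr0 mulr0n /expi cos0 sin0.
by rewrite exprS IH mulrS expiD.
Qed.

Lemma cmod_inj_ball (u v : R[i]) (e : R) : (`|u - v| < Complex e 0) = (cmod (u - v) < e).
Proof. by rewrite normcE ltcE /= eqxx. Qed.

Lemma Complex_gt0 (e : R) : (0 < (Complex e 0 : R[i])) = (0 < e).
Proof. by rewrite ltcE /= eqxx. Qed.

Lemma gt0_Complex (e : R[i]) : 0 < e -> e = Complex (complex.Re e) 0 /\ 0 < complex.Re e.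
Proof. by case: e => a b; rewrite ltcE /= => /andP[/eqP -> ?]. Qed.

End Modulus.

(** * Convergence of complex sequences and series *)

Section Convergence.
Variable R : realType.

(** The norm behind the topology takes values in [R[i]], where the positive elements are the
    positive reals; this translates convergence to the real modulus. *)
Lemma cvg_cmodP (u : nat -> Cplx R) (l : Cplx R) :
  u n @[n --> \oo] --> l <->
  forall e : R, 0 < e -> \forall n \near \oo, cmod (u n - l) < e.
Proof.
split => [/cvgrPdist_lt H e e0|H].
  have := H (Complex e 0); rewrite Complex_gt0 => /(_ e0).
  by apply: filterS => n; rewrite cmod_inj_ball cmodC.
apply/cvgrPdist_lt => e /gt0_Complex[-> e0].
by apply: filterS (H _ e0) => n; rewrite cmod_inj_ball cmodC.
Qed.

Lemma cvg_cmod (u : nat -> Cplx R) (l : Cplx R) :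
  u n @[n --> \oo] --> l -> cmod (u n) @[n --> \oo] --> cmod l.
Proof.
move=> /cvg_cmodP H; apply/cvgrPdist_lt => e e0; apply: filterS (H _ e0) => n.
apply: le_lt_trans; rewrite ler_norml; apply/andP; split.
  by rewrite lerNl opprB; exact: cmod_triB.
by rewrite cmodC; exact: cmod_triB.
Qed.

Lemma cvg_ReIm (u : nat -> Cplx R) (a b : R) :
  complex.Re (u n) @[n --> \oo] --> a -> complex.Im (u n) @[n --> \oo] --> b ->
  u n @[n --> \oo] --> (Complex a b : Cplx R).
Proof.
move=> /cvgrPdist_lt A /cvgrPdist_lt B; apply/cvg_cmodP => e e0.
have e2 : 0 < e / 2 by rewrite divr_gt0.
near=> n; apply: (le_lt_trans (cmod_le_ReIm _)).
rewrite [e]splitr ltrD//.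
  have : `|a - complex.Re (u n)| < e / 2 by near: n; exact: A.
  by rewrite distrC; case: (u n).
have : `|b - complex.Im (u n)| < e / 2 by near: n; exact: B.
by rewrite distrC; case: (u n).
Unshelve. all: by end_near. Qed.

Lemma cvg_conjc (u : nat -> Cplx R) (l : Cplx R) :
  u n @[n --> \oo] --> l -> (conjc (u n) : Cplx R) @[n --> \oo] --> (conjc l : Cplx R).
Proof.
move=> /cvg_cmodP H; apply/cvg_cmodP => e e0; apply: filterS (H _ e0) => n.
by rewrite -cmodJ rmorphB.
Qed.

Lemma Re_sum (n : nat) (F : nat -> R[i]) :
  complex.Re (\sum_(0 <= i < n) F i) = \sum_(0 <= i < n) complex.Re (F i).
Proof.
by elim: n => [|n IH]; [rewrite !big_geq | rewrite !big_nat_recr//= RecD IH].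
Qed.

Lemma Im_sum (n : nat) (F : nat -> R[i]) :
  complex.Im (\sum_(0 <= i < n) F i) = \sum_(0 <= i < n) complex.Im (F i).
Proof.
by elim: n => [|n IH]; [rewrite !big_geq | rewrite !big_nat_recr//= ImcD IH].
Qed.

Lemma abs_cvg_series (u : nat -> Cplx R) :
  cvgn (series (fun n => cmod (u n))) -> cvgn (series u).
Proof.
move=> H.
have Hr : cvgn (series (fun n => complex.Re (u n))).
  apply: normed_cvg; apply: series_le_cvg H => n //=; first exact: cmod_ge0.
  exact: cmod_ge_Re.
have Hi : cvgn (series (fun n => complex.Im (u n))).
  apply: normed_cvg; apply: series_le_cvg H => n //=; first exact: cmod_ge0.
  exact: cmod_ge_Im.
apply/cvg_ex; exists (Complex (limn (series (fun n => complex.Re (u n))))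
  (limn (series (fun n => complex.Im (u n))))).
apply: cvg_ReIm.
  by under eq_fun do rewrite /series /= Re_sum.
by under eq_fun do rewrite /series /= Im_sum.
Qed.

End Convergence.

(** * Inequalities for finite real sums *)

Section RealSums.
Variable R : realType.

Lemma le_of_sqr (a b : R) : 0 <= b -> a ^+ 2 <= b ^+ 2 -> a <= b.
Proof. by move=> b0 ab; rewrite leNgt; apply/negP => ba; nra. Qed.

Lemma cvg_le_bound (u : nat -> R) (l b : R) :
  u n @[n --> \oo] --> l -> (forall n, u n <= b) -> l <= b.
Proof.
move=> ul ub; rewrite -(cvg_lim _ ul)//; apply: limr_le; first by apply/cvg_ex; exists l.
exact: nearW.
Qed.

Lemma cauchy_schwarz_sum (I : Type) (r : seq I) (x y : I -> R) :
  \sum_(i <- r) x i * y i <=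
  Num.sqrt (\sum_(i <- r) x i ^+ 2) * Num.sqrt (\sum_(i <- r) y i ^+ 2).
Proof.
elim: r => [|i r IH]; first by rewrite !big_nil sqrtr0 mulr0.
rewrite !big_cons.
have A0 : 0 <= \sum_(j <- r) x j ^+ 2 by apply: sumr_ge0 => j _; exact: sqr_ge0.
have B0 : 0 <= \sum_(j <- r) y j ^+ 2 by apply: sumr_ge0 => j _; exact: sqr_ge0.
move: IH A0 B0; set C := \sum_(j <- r) _; set A := \sum_(j <- r) _.
set B := \sum_(j <- r) _ => IH A0 B0.
have [sA sB] := (sqr_sqrtr A0, sqr_sqrtr B0).
have [pA pB] := (sqrtr_ge0 A, sqrtr_ge0 B).
apply: (@le_trans _ _ (x i * y i + Num.sqrt A * Num.sqrt B)).
  by rewrite lerD2l.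
apply: le_of_sqr; first by rewrite mulr_ge0 ?sqrtr_ge0.
rewrite exprMn !sqr_sqrtr ?addr_ge0 ?sqr_ge0//.
move: sA sB pA pB; set a := Num.sqrt A; set b := Num.sqrt B => sA sB pA pB.
have := sqr_ge0 (a * y i - b * x i).
by rewrite -sA -sB; nra.
Qed.

Lemma minkowski_sum (I : Type) (r : seq I) (x y : I -> R) :
  \sum_(i <- r) (x i + y i) ^+ 2 <=
  (Num.sqrt (\sum_(i <- r) x i ^+ 2) + Num.sqrt (\sum_(i <- r) y i ^+ 2)) ^+ 2.
Proof.
rewrite sqrrD !sqr_sqrtr ?sumr_ge0// => [|i _|i _]; rewrite ?sqr_ge0//.
under eq_bigr do rewrite sqrrD.
rewrite !big_split/= lerD2r lerD2l.
rewrite -mulr2n lerMn2r/=.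
exact: cauchy_schwarz_sum.
Qed.

End RealSums.

(** * The space H^2 *)

Section L2.
Variable R : realType.
Notation C := (Cplx R).
Implicit Types (f g : taylor R) (a : R[i]).

Definition psq f : nat -> R := series (fun n => cmod (f n) ^+ 2).

Lemma psq_ge0 f n : 0 <= psq f n.
Proof. by apply: sumr_ge0 => i _; exact: sqr_ge0. Qed.

Lemma psq_nd f : nondecreasing_seq (psq f).
Proof.
apply/nondecreasing_seqP => n; rewrite /psq /series /= big_nat_recr//= lerDl.
exact: sqr_ge0.
Qed.

Lemma psq_le f n : H2 f -> psq f n <= l2norm f ^+ 2.
Proof.
move=> Hf; rewrite /l2norm sqr_sqrtr.
  by apply: nondecreasing_cvgn_le => //; exact: psq_nd.
apply: limr_ge => //; near=> k; exact: psq_ge0.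
Unshelve. all: by end_near. Qed.

Lemma psq_cvg f : H2 f -> psq f n @[n --> \oo] --> l2norm f ^+ 2.
Proof.
move=> Hf; rewrite /l2norm sqr_sqrtr; first exact: Hf.
apply: limr_ge => //; near=> k; exact: psq_ge0.
Unshelve. all: by end_near. Qed.

Lemma l2norm_ge0 f : 0 <= l2norm f.
Proof. exact: sqrtr_ge0. Qed.

Lemma H2_bounded f (b : R) : 0 <= b -> (forall n, psq f n <= b ^+ 2) ->
  H2 f /\ l2norm f <= b.
Proof.
move=> b0 H.
have Hf : H2 f.
  apply: nondecreasing_is_cvgn; first exact: psq_nd.
  by exists (b ^+ 2) => _ [n _ <-]; exact: H.
split=> //; apply: le_of_sqr => //.
exact: cvg_le_bound (psq_cvg Hf) H.
Qed.

Lemma l2norm_unique f (b : R) : 0 <= b ->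
  psq f n @[n --> \oo] --> b ^+ 2 -> H2 f /\ l2norm f = b.
Proof.
move=> b0 H; have Hf : H2 f by apply/cvg_ex; exists (b ^+ 2).
split=> //; rewrite /l2norm; have -> := cvg_lim _ H => //.
by rewrite sqrtr_sqr ger0_norm.
Qed.

Lemma coef_le f n : H2 f -> cmod (f n) <= l2norm f.
Proof.
move=> Hf; apply: le_of_sqr; first exact: l2norm_ge0.
apply: (le_trans _ (psq_le n.+1 Hf)).
by rewrite /psq /series /= big_nat_recr//= lerDr psq_ge0.
Qed.

Lemma l2norm_eq0 f : H2 f -> l2norm f = 0 -> f = 0.
Proof.
move=> Hf f0; apply/funext => n; apply/eqP; rewrite -cmod_eq0 eq_le cmod_ge0.
by rewrite andbT -f0; exact: coef_le.
Qed.

Lemma H2_0 : @H2 R 0 /\ l2norm (0 : taylor R) = 0.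
Proof.
apply: l2norm_unique => //.
rewrite (_ : psq 0 = cst 0); first by rewrite expr0n /=; exact: cvg_cst.
apply/funext => n; rewrite /psq /series /= big1// => i _.
by rewrite !expr0n /= addr0 sqrtr0 expr0n.
Qed.

Lemma psqE f n : psq f n = \sum_(i < n) cmod (f i) ^+ 2.
Proof. by rewrite /psq /series /= big_mkord. Qed.

Lemma sqrt_psq f n : H2 f -> Num.sqrt (psq f n) <= l2norm f.
Proof.
move=> Hf; apply: le_of_sqr; first exact: l2norm_ge0.
by rewrite sqr_sqrtr ?psq_ge0 ?psq_le.
Qed.

Lemma psqD f g n : psq (f + g) n <= (Num.sqrt (psq f n) + Num.sqrt (psq g n)) ^+ 2.
Proof.
rewrite /psq /series /=; apply: le_trans (minkowski_sum _ _ _).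
apply: ler_sum => i _; rewrite ler_pXn2r ?nnegrE ?cmod_ge0 ?addr_ge0 ?cmod_ge0//.
exact: cmodD.
Qed.

Lemma H2D f g : H2 f -> H2 g -> H2 (f + g) /\ l2norm (f + g) <= l2norm f + l2norm g.
Proof.
move=> Hf Hg; apply: H2_bounded => [|n]; first by rewrite addr_ge0 ?l2norm_ge0.
apply: (le_trans (psqD _ _ _)).
rewrite ler_pXn2r ?nnegrE ?addr_ge0 ?l2norm_ge0 ?sqrtr_ge0//.
by rewrite lerD ?sqrt_psq.
Qed.

Lemma H2Z a f : H2 f -> H2 (a *: f) /\ l2norm (a *: f) = cmod a * l2norm f.
Proof.
move=> Hf; apply: l2norm_unique; first by rewrite mulr_ge0 ?cmod_ge0 ?l2norm_ge0.
suff -> : psq (a *: f) = (fun n => cmod a ^+ 2 * psq f n).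
  by rewrite exprMn; apply: cvgM; [exact: cvg_cst|exact: psq_cvg].
apply/funext => n; rewrite /psq /series /= mulr_sumr; apply: eq_bigr => i _.
by rewrite -exprMn -cmodM.
Qed.

Lemma H2N f : H2 f -> H2 (- f) /\ l2norm (- f) = l2norm f.
Proof. by move=> Hf; rewrite -scaleN1r; have := H2Z (-1) Hf; rewrite cmodN cmod1 mul1r. Qed.

Lemma H2B f g : H2 f -> H2 g -> H2 (f - g) /\ l2norm (f - g) <= l2norm f + l2norm g.
Proof. by move=> Hf Hg; have [Hg' <-] := H2N Hg; exact: H2D. Qed.

Lemma l2normBC f g : H2 f -> H2 g -> l2norm (f - g) = l2norm (g - f).
Proof. by move=> Hf Hg; rewrite -opprB; have [] := H2N (H2B Hg Hf).1. Qed.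

Lemma l2norm_triB f g : H2 f -> H2 g -> l2norm f - l2norm g <= l2norm (f - g).
Proof.
by move=> Hf Hg; rewrite lerBlDr -{1}(subrK g f); have [] := H2D (H2B Hf Hg).1 Hg.
Qed.

Lemma abs_dot_le f g n : H2 f -> H2 g ->
  \sum_(0 <= i < n) cmod (f i * conjc (g i)) <= l2norm f * l2norm g.
Proof.
move=> Hf Hg; under eq_bigr do rewrite cmodM cmodJ.
apply: (le_trans (cauchy_schwarz_sum _ _ _)).
by apply: ler_pM; rewrite ?sqrtr_ge0//; exact: sqrt_psq.
Qed.

Lemma l2dot_cvg f g : H2 f -> H2 g ->
  (series (fun n => f n * conjc (g n) : C) n) @[n --> \oo] --> l2dot f g.
Proof.
move=> Hf Hg; apply: abs_cvg_series; apply: nondecreasing_is_cvgn.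
  apply/nondecreasing_seqP => n; rewrite /series /= big_nat_recr//= lerDl.
  exact: cmod_ge0.
by exists (l2norm f * l2norm g) => _ [n _ <-]; exact: abs_dot_le.
Qed.

Lemma l2dot_unique f g (l : C) :
  (series (fun n => f n * conjc (g n) : C) n) @[n --> \oo] --> l -> l2dot f g = l.
Proof. by move=> H; rewrite /l2dot; exact: cvg_lim. Qed.

Lemma cauchy_schwarz f g : H2 f -> H2 g ->
  cmod (l2dot f g) <= l2norm f * l2norm g.
Proof.
move=> Hf Hg; have H := cvg_cmod (l2dot_cvg Hf Hg).
apply: (cvg_le_bound H) => n; rewrite /series /=; apply: le_trans (abs_dot_le n Hf Hg).
exact: cmod_sum.
Qed.

Lemma l2dotDl f f' g : H2 f -> H2 f' -> H2 g ->
  l2dot (f + f') g = l2dot f g + l2dot f' g.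
Proof.
move=> Hf Hf' Hg; apply: l2dot_unique.
suff -> : (series (fun n => (f + f') n * conjc (g n) : C)) = (fun n =>
    series (fun n => f n * conjc (g n) : C) n + series (fun n => f' n * conjc (g n) : C) n).
  by apply: cvgD; exact: l2dot_cvg.
apply/funext => n; rewrite /series /= -big_split; apply: eq_bigr => i _ /=.
by rewrite -mulrDl.
Qed.

Lemma l2dotZl a f g : H2 f -> H2 g -> l2dot (a *: f) g = a * l2dot f g.
Proof.
move=> Hf Hg; apply: l2dot_unique.
suff -> : (series (fun n => (a *: f) n * conjc (g n) : C)) = (fun n =>
    (a : C) * series (fun n => f n * conjc (g n) : C) n).
  by apply: cvgM; [exact: cvg_cst|exact: l2dot_cvg].
apply/funext => n; rewrite /series /= mulr_sumr; apply: eq_bigr => i _ /=.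
by rewrite mulrA.
Qed.

Lemma l2dotC f g : H2 f -> H2 g -> l2dot g f = conjc (l2dot f g).
Proof.
move=> Hf Hg; apply: l2dot_unique; suff -> : series (fun n => g n * conjc (f n) : C) = (fun n =>
    conjc (series (fun n => f n * conjc (g n) : C) n) : C).
  by apply: cvg_conjc; exact: l2dot_cvg.
apply/funext => n; rewrite /series /= rmorph_sum; apply: eq_bigr => i _ /=.
by rewrite rmorphM /= conjcK mulrC.
Qed.

Lemma l2dotDr f g g' : H2 f -> H2 g -> H2 g' ->
  l2dot f (g + g') = l2dot f g + l2dot f g'.
Proof.
move=> Hf Hg Hg'; rewrite l2dotC ?l2dotDl//; last exact: (H2D _ _).1.
by rewrite rmorphD /= -!l2dotC.
Qed.

Lemma l2dotZr a f g : H2 f -> H2 g -> l2dot f (a *: g) = conjc a * l2dot f g.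
Proof.
move=> Hf Hg; rewrite l2dotC ?l2dotZl//; last exact: (H2Z _ _).1.
by rewrite rmorphM /= -l2dotC.
Qed.

Lemma l2dotNl f g : H2 f -> H2 g -> l2dot (- f) g = - l2dot f g.
Proof. by move=> Hf Hg; rewrite -scaleN1r l2dotZl// mulN1r. Qed.

Lemma l2dotNr f g : H2 f -> H2 g -> l2dot f (- g) = - l2dot f g.
Proof.
by move=> Hf Hg; rewrite -scaleN1r l2dotZr// rmorphN1 mulN1r.
Qed.

Lemma l2dotBl f f' g : H2 f -> H2 f' -> H2 g ->
  l2dot (f - f') g = l2dot f g - l2dot f' g.
Proof. by move=> Hf Hf' Hg; rewrite l2dotDl ?l2dotNl//; exact: (H2N _).1. Qed.

Lemma l2dotBr f g g' : H2 f -> H2 g -> H2 g' ->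
  l2dot f (g - g') = l2dot f g - l2dot f g'.
Proof. by move=> Hf Hg Hg'; rewrite l2dotDr ?l2dotNr//; exact: (H2N _).1. Qed.

Lemma l2dot0l g : l2dot 0 g = 0.
Proof.
apply: l2dot_unique; rewrite /series /=.
rewrite (_ : (fun n => _) = cst 0); first exact: cvg_cst.
by apply/funext => n; rewrite big1// => i _; rewrite mul0r.
Qed.

Lemma l2dot_norm f : H2 f -> l2dot f f = Complex (l2norm f ^+ 2) 0.
Proof.
move=> Hf; apply: l2dot_unique; apply: cvg_ReIm.
  rewrite (_ : (fun n => _) = psq f); first exact: psq_cvg.
  apply/funext => n; rewrite /series /= Re_sum; apply: eq_bigr => i _.
  by rewrite mul_conjc.
rewrite (_ : (fun n => _) = cst 0); first exact: cvg_cst.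
apply/funext => n; rewrite /series /= Im_sum big1// => i _.
by rewrite mul_conjc.
Qed.

Lemma l2norm_eq0_dot f : H2 f -> l2dot f f = 0 -> f = 0.
Proof.
move=> Hf; rewrite l2dot_norm// => -[/eqP]; rewrite sqrf_eq0 => /eqP.
exact: l2norm_eq0.
Qed.

Lemma l2normD_sq f g : H2 f -> H2 g ->
  l2norm (f + g) ^+ 2 =
  l2norm f ^+ 2 + l2norm g ^+ 2 + 2 * complex.Re (l2dot f g).
Proof.
move=> Hf Hg; have Hfg := (H2D Hf Hg).1.
have := l2dot_norm Hfg; rewrite l2dotDl// !l2dotDr// !l2dot_norm// (l2dotC Hf Hg).
move=> /(congr1 (@complex.Re R)); rewrite !RecD /= => <-.
by case: (l2dot f g) => x y /=; ring.
Qed.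

Lemma shift_H2 f : H2 f -> H2 (shift f) /\ l2norm (shift f) = l2norm f.
Proof.
move=> Hf; apply: l2norm_unique; first exact: l2norm_ge0.
rewrite -cvg_shiftS; have := psq_cvg Hf.
rewrite (_ : psq f = (fun n => psq (shift f) n.+1))//.
apply/funext => n; rewrite /psq /series /= big_nat_recl//= !expr0n /= addr0 sqrtr0 expr0n add0r.
by [].
Qed.

Lemma bshift_H2 f : H2 f -> H2 (bshift f) /\ l2norm (bshift f) <= l2norm f.
Proof.
move=> Hf; apply: H2_bounded; first exact: l2norm_ge0.
move=> n; apply: le_trans (psq_le n.+1 Hf).
by rewrite /psq /series /= big_nat_recl//= lerDr sqr_ge0.
Qed.

Lemma shiftD f g : shift (f + g) = shift f + shift g.
Proof. by apply/funext => -[|n] //=; rewrite /GRing.add /= addr0. Qed.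

Lemma shiftZ a f : shift (a *: f) = a *: shift f.
Proof. by apply/funext => -[|n] //; apply/esym; exact: mulr0. Qed.

End L2.

(** * Projections and uniform boundedness *)

Lemma subrBB (W : zmodType) (a b c : W) : a - b - (a - c) = c - b.
Proof. by rewrite opprB addrC addrA subrK. Qed.

Lemma subrDB (W : zmodType) (a b : W) : a + b - (a - b) = b + b.
Proof. by rewrite opprB addrC addrA subrK. Qed.

Section Hilbert.
Variable R : realType.
Notation C := (Cplx R).
Implicit Types (f g : taylor R) (a : R[i]) (V : set (taylor R)).

Lemma real_cauchy_cvg (u : nat -> R) :
  (forall e : R, 0 < e -> exists N, forall m n, (N <= m)%N -> (N <= n)%N ->
     `|u m - u n| < e) -> cvgn u.
Proof.
move=> H; apply/cauchy_cvgP; apply: cauchy_exP => e e0.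
have [N HN] := H e e0; exists (u N); exists N => // n /= Nn.
exact: HN.
Qed.

Lemma inv_nat_small (e : R) : 0 < e ->
  exists N, forall n, (N <= n)%N -> n.+1%:R^-1 < e.
Proof.
move=> e0; have /cvgr0Pnorm_lt/(_ e e0)[N _ HN] := @cvg_harmonic R.
exists N => n Nn; have := HN n Nn.
by rewrite /= ger0_norm ?invr_ge0.
Qed.

Lemma cplx_cauchy_cvg (u : nat -> C) :
  (forall e : R, 0 < e -> exists N, forall m n, (N <= m)%N -> (N <= n)%N ->
     cmod (u m - u n) < e) -> cvgn u.
Proof.
move=> H; apply/cvg_ex; exists (Complex (limn (fun n => complex.Re (u n)))
  (limn (fun n => complex.Im (u n)))); apply: cvg_ReIm; apply: real_cauchy_cvg => e e0.
  have [N HN] := H e e0; exists N => m n Nm Nn; apply: le_lt_trans (HN m n Nm Nn).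
  by rewrite -RecB; exact: cmod_ge_Re.
have [N HN] := H e e0; exists N => m n Nm Nn; apply: le_lt_trans (HN m n Nm Nn).
by rewrite -ImcB; exact: cmod_ge_Im.
Qed.

Lemma psq_cvg_coef (u : nat -> taylor R) f n :
  (forall i, (u k i : C) @[k --> \oo] --> (f i : C)) ->
  psq (u k) n @[k --> \oo] --> psq f n.
Proof.
move=> H; elim: n => [|n IH].
  under eq_fun do rewrite /psq /series /= big_geq//.
  by rewrite /psq /series /= big_geq//; exact: cvg_cst.
have E g : psq g n.+1 = psq g n + cmod (g n) ^+ 2.
  by rewrite /psq /series /= big_nat_recr.
under eq_fun do rewrite E; rewrite E; apply: cvgD => //.
under eq_fun do rewrite expr2; rewrite expr2.
by apply: cvgM; exact: cvg_cmod.
Qed.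

Lemma cvgC_subl (u : nat -> C) (c l : C) :
  u k @[k --> \oo] --> l -> (c - u k) @[k --> \oo] --> c - l.
Proof. by move=> H; exact: (cvgB (cvg_cst c) H). Qed.

Lemma l2_complete (u : nat -> taylor R) :
  (forall k, H2 (u k)) ->
  (forall e : R, 0 < e -> exists N, forall m n, (N <= m)%N -> (N <= n)%N ->
     l2norm (u m - u n) < e) ->
  exists2 f, H2 f & l2norm (u k - f) @[k --> \oo] --> (0 : R).
Proof.
move=> Hu H.
have cu i : cvgn (fun k => u k i : C).
  apply: cplx_cauchy_cvg => e e0; have [N HN] := H e e0.
  exists N => m n Nm Nn; apply: le_lt_trans (HN m n Nm Nn).
  by apply: (coef_le (f := u m - u n)); exact: (H2B _ _).1.
pose f : taylor R := fun i => limn (fun k => u k i : C).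
(* [key] serves twice: with [e = 1] it puts the coefficientwise limit in H^2, and then it gives
   convergence in norm. The bound passes to the limit on finitely many coefficients at a time; the
   shift by [N] keeps the indices in the Cauchy range. *)
have key (e : R) N m : 0 <= e -> (forall n, (N <= n)%N -> l2norm (u m - u n) <= e) ->
    H2 (u m - f) /\ l2norm (u m - f) <= e.
  move=> e0 HN; apply: H2_bounded => // n.
  have cv : psq (u m - u (k + N)%N) n @[k --> \oo] --> psq (u m - f) n.
    apply: psq_cvg_coef => i.
    by apply: cvgC_subl; rewrite (cvg_shiftn _ (fun k => u k i : C)); exact: cu.
  apply: (cvg_le_bound cv) => k; apply: le_trans (psq_le _ _) _.
    exact: (H2B _ _).1.
  by rewrite ler_pXn2r ?nnegrE ?l2norm_ge0// HN// leq_addl.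
have Hf : H2 f.
  have [N HN] := H 1 ltr01.
  have [] := @key 1 N N ler01 => [n Nn|Huf _]; first by apply/ltW/HN.
  by rewrite -(subKr (u N) f); exact: (H2B _ _).1.
exists f => //; apply/cvgr0Pnorm_le => e e0.
have [N HN] := H e e0; exists N => // m /= Nm.
rewrite ger0_norm ?l2norm_ge0//.
by have [] := @key e N m (ltW e0) => [n Nn|_ //]; apply/ltW/HN.
Qed.

Lemma l2_cvg_norm (u : nat -> taylor R) f : (forall k, H2 (u k)) -> H2 f ->
  l2norm (u k - f) @[k --> \oo] --> (0 : R) ->
  l2norm (u k) @[k --> \oo] --> l2norm f.
Proof.
move=> Hu Hf /cvgr0Pnorm_lt H; apply/cvgrPdist_lt => e e0.
apply: filterS (H e e0) => k; rewrite ger0_norm ?l2norm_ge0//.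
apply: le_lt_trans; rewrite ler_norml; apply/andP; split.
  by rewrite lerNl opprB; exact: l2norm_triB.
by rewrite l2normBC//; exact: l2norm_triB.
Qed.

Lemma l2_cvg_dotl (u : nat -> taylor R) f g : (forall k, H2 (u k)) -> H2 f -> H2 g ->
  l2norm (u k - f) @[k --> \oo] --> (0 : R) ->
  l2dot (u k) g @[k --> \oo] --> l2dot f g.
Proof.
move=> Hu Hf Hg /cvgr0Pnorm_lt H; apply/cvg_cmodP => e e0.
have g1 : 0 < l2norm g + 1 by rewrite ltr_wpDl ?l2norm_ge0.
apply: filterS (H _ (divr_gt0 e0 g1)) => k; rewrite ger0_norm ?l2norm_ge0// => lt.
rewrite -l2dotBl//; apply: (le_lt_trans (cauchy_schwarz (H2B _ _).1 _)) => //.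
apply: (@le_lt_trans _ _ (l2norm (u k - f) * (l2norm g + 1))).
  by rewrite ler_wpM2l ?l2norm_ge0// lerDl.
by rewrite -ltr_pdivlMr.
Qed.

Lemma l2_cvg_coef (u : nat -> taylor R) f i : (forall k, H2 (u k)) -> H2 f ->
  l2norm (u k - f) @[k --> \oo] --> (0 : R) -> (u k i : C) @[k --> \oo] --> (f i : C).
Proof.
move=> Hu Hf /cvgr0Pnorm_lt H; apply/cvg_cmodP => e e0.
apply: filterS (H e e0) => k; rewrite ger0_norm ?l2norm_ge0//; apply: le_lt_trans.
exact: (coef_le (f := u k - f) i (H2B _ _).1).
Qed.

Lemma l2_cvg_cauchy (u : nat -> taylor R) f : (forall k, H2 (u k)) -> H2 f ->
  l2norm (u k - f) @[k --> \oo] --> (0 : R) ->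
  forall e : R, 0 < e -> exists N, forall m n, (N <= m)%N -> (N <= n)%N ->
     l2norm (u m - u n) < e.
Proof.
move=> Hu Hf /cvgr0Pnorm_lt H e e0.
have e2 : 0 < e / 2 by rewrite divr_gt0.
have [N _ HN] := H _ e2; exists N => m n Nm Nn.
rewrite (_ : u m - u n = (u m - f) - (u n - f)); last first.
  by rewrite opprB addrA subrK.
have [_] := H2B (H2B (Hu m) Hf).1 (H2B (Hu n) Hf).1.
have := HN m Nm; have := HN n Nn; rewrite /= !ger0_norm ?l2norm_ge0//.
by lra.
Qed.

Lemma parallelogram f g : H2 f -> H2 g ->
  l2norm (f + g) ^+ 2 + l2norm (f - g) ^+ 2 = 2 * l2norm f ^+ 2 + 2 * l2norm g ^+ 2.
Proof.
move=> Hf Hg; rewrite (l2normD_sq Hf Hg) (l2normD_sq Hf (H2N Hg).1) l2dotNr// (H2N Hg).2.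
by case: (l2dot f g) => x y /=; ring.
Qed.

Section Subspace.
Variable V : set (taylor R).
Hypothesis HV : closed_subspace V.

Let VH2 f : V f -> H2 f.
Proof. by case: HV => + _ _ _; apply. Qed.

Lemma subspace0 : V 0.
Proof. by case: HV. Qed.

Lemma subspaceZD a f g : V f -> V g -> V (a *: f + g).
Proof. by case: HV => _ _ + _; apply. Qed.

Lemma subspaceZ a f : V f -> V (a *: f).
Proof. by move=> Vf; rewrite -[_ *: _]addr0; apply: subspaceZD => //; exact: subspace0. Qed.

Lemma subspaceD f g : V f -> V g -> V (f + g).
Proof. by move=> Vf Vg; rewrite -[f]scale1r; exact: subspaceZD. Qed.

Lemma subspaceN f : V f -> V (- f).
Proof. by move=> Vf; rewrite -scaleN1r; exact: subspaceZ. Qed.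

Lemma subspaceB f g : V f -> V g -> V (f - g).
Proof. by move=> Vf Vg; apply: subspaceD => //; exact: subspaceN. Qed.

Lemma subspace_closed : l2closed V.
Proof. by case: HV. Qed.

Lemma minimizer_orthogonal f p : H2 f -> V p ->
  (forall v, V v -> l2norm (f - p) <= l2norm (f - v)) ->
  forall k, V k -> l2dot (f - p) k = 0.
Proof.
move=> Hf Vp Hmin k Vk; have [Hp Hk] := (VH2 Vp, VH2 Vk).
have Hfp := (H2B Hf Hp).1.
(* Replacing [p] by [p + t c k] changes the squared distance by [- 2 t |c|^2 + t^2 |c|^2 |k|^2].
   This [t] gives [t |k|^2 = 1 - t < 1], so minimality forces [c = 0], also when [k = 0]. *)
set c := l2dot _ _; pose t : R := (l2norm k ^+ 2 + 1)^-1.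
have k1 : 0 < l2norm k ^+ 2 + 1 by rewrite ltr_wpDl ?sqr_ge0.
have t0 : 0 < t by rewrite invr_gt0.
have := Hmin _ (subspaceD Vp (subspaceZ ((Complex t 0) * c) Vk)).
rewrite opprD addrA => Hle.
have [Hk' nk'] := H2Z (Complex t 0 * c) Hk.
have := l2normD_sq Hfp (H2N Hk').1; rewrite l2dotNr// l2dotZr// -/c (H2N Hk').2 nk'.
have -> : complex.Re (- (conjc (Complex t 0 * c) * c)) = - (t * cmod c ^+ 2).
  by rewrite cmod_sqE; case: (c) => x y /=; ring.
rewrite cmodM cmod_real gtr0_norm// => E.
have : l2norm (f - p) ^+ 2 <= l2norm (f - p - Complex t 0 * c *: k) ^+ 2.
  by rewrite ler_pXn2r ?nnegrE ?l2norm_ge0.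
rewrite E => Hle2.
have tk : t * (l2norm k ^+ 2 + 1) = 1 by rewrite mulVf// gt_eqF.
apply/eqP; rewrite -cmod_eq0 -sqrf_eq0; apply/eqP.
have c2 := sqr_ge0 (cmod c).
have : 2 * (t * cmod c ^+ 2) <= t * cmod c ^+ 2 * (t * l2norm k ^+ 2).
  by move: Hle2; rewrite !exprMn; set X := cmod c ^+ 2; set Y := l2norm k ^+ 2; lra.
have -> : t * l2norm k ^+ 2 = 1 - t by move: tk; rewrite mulrDr mulr1; lra.
move: c2; set X := cmod c ^+ 2 => c2 H3.
apply/eqP; rewrite eq_le c2 andbT -(pmulr_rle0 _ t0).
by have := mulr_ge0 (ltW t0) c2; nra.
Qed.

Lemma projection f : H2 f -> exists2 p, V p & forall k, V k -> l2dot (f - p) k = 0.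
Proof.
move=> Hf; pose D : set R := [set l2norm (f - v) ^+ 2 | v in V].
have D0 : D !=set0 by exists (l2norm (f - 0) ^+ 2); exists 0 => //; exact: subspace0.
have Dlb : has_inf D by split=> //; exists 0 => _ [v _ <-]; exact: sqr_ge0.
have near_min n : exists v, V v /\ l2norm (f - v) ^+ 2 < inf D + n.+1%:R^-1.
  have n0 : 0 < n.+1%:R^-1 :> R by rewrite invr_gt0.
  have [_ [v Vv <-] lt] := inf_adherent n0 Dlb.
  by exists v.
have [v Hv] := choice near_min.
have Vv n : V (v n) := (Hv n).1; have Hvn n : H2 (v n) := VH2 (Vv n).
have inf_le w : V w -> inf D <= l2norm (f - w) ^+ 2.
  by move=> Vw; apply: ge_inf; [exact: Dlb.2|exists w].
(* Parallelogram law: the midpoint [w] of [v n] and [v m] lies in [V], so [4 |f - w|^2 >= 4 inf D]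
   cancels the main part of [2 |f - v n|^2 + 2 |f - v m|^2]. *)
have cauchy_v m n : l2norm (v m - v n) ^+ 2 <= 2 * m.+1%:R^-1 + 2 * n.+1%:R^-1.
  have Hm := (H2B Hf (Hvn m)).1; have Hn := (H2B Hf (Hvn n)).1.
  have := parallelogram Hn Hm.
  rewrite subrBB.
  pose w := (2^-1 : R[i]) *: (v n + v m).
  have Vw : V w by apply: subspaceZ; exact: subspaceD.
  have -> : f - v n + (f - v m) = (2 : R[i]) *: (f - w).
    rewrite scalerBr scalerA divff ?pnatr_eq0// scale1r scaler_nat mulr2n.
    by rewrite opprD addrACA.
  have [_ ->] := H2Z 2 (H2B Hf (VH2 Vw)).1.
  have -> : cmod (2 : R[i]) = 2.
    by rewrite (_ : 2 = Complex 2 0) ?cmod_real ?ger0_norm//; apply/eqP; rewrite eq_complex /= addr0 !eqxx.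
  have := inf_le _ Vw; have := (Hv m).2; have := (Hv n).2.
  rewrite exprMn; move: (l2norm (f - w)) (l2norm (f - v n)) (l2norm (f - v m)) (l2norm (v m - v n)).
  move: (inf D) (n.+1%:R^-1) (m.+1%:R^-1) => d x y a b c e; nra.
have [p Hp vp] : exists2 p, H2 p & l2norm (v k - p) @[k --> \oo] --> (0 : R).
  apply: l2_complete => // e e0.
  have e4 : 0 < e ^+ 2 / 4 by rewrite divr_gt0// exprn_gt0.
  have [N HN] := inv_nat_small e4.
  exists N => m n Nm Nn; rewrite -(ltr_pXn2r (_ : (0 < 2)%N)) ?nnegrE ?l2norm_ge0 ?ltW//.
  apply: (le_lt_trans (cauchy_v m n)).
  have := HN m Nm; have := HN n Nn.
  by move: (m.+1%:R^-1) (n.+1%:R^-1) => x y; lra.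
have Vp : V p by apply: (subspace_closed _ _ vp).
exists p => //; apply: minimizer_orthogonal => // w Vw.
rewrite -(ler_pXn2r (_ : (0 < 2)%N)) ?nnegrE ?l2norm_ge0//.
apply: le_trans (inf_le _ Vw).
have cv : l2norm (f - v k) @[k --> \oo] --> l2norm (f - p).
  apply: l2_cvg_norm => [k||]; [exact: (H2B _ _).1|exact: (H2B _ _).1|].
  suff -> : (fun k => l2norm (f - v k - (f - p))) = (fun k => l2norm (v k - p)) by [].
  by apply/funext => k; rewrite subrBB (l2normBC Hp (Hvn k)).
have cv2 : l2norm (f - v k) ^+ 2 - k.+1%:R^-1 @[k --> \oo] --> l2norm (f - p) ^+ 2 - 0.
  apply: cvgB; last exact: cvg_harmonic.
  by under eq_fun do rewrite expr2; rewrite expr2; exact: cvgM.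
rewrite -[X in X <= _]subr0; apply: (cvg_le_bound cv2) => k.
by have := (Hv k).2; rewrite -ltrBlDr => /ltW.
Qed.

Lemma orthproj_spec f : H2 f ->
  V (orthproj V f) /\ forall k, V k -> l2dot (f - orthproj V f) k = 0.
Proof.
move=> Hf; rewrite /orthproj; case: xgetP => [g _ //|H].
by have [p Vp Op] := projection Hf; case: (H p).
Qed.

(* Gliding hump: the vector p = sum of +-(r n)/(3^n |r n|), with signs chosen so
   that no cancellation occurs against r n, would have unbounded products with P. *)
Lemma uniform_boundedness (P : set (taylor R)) :
  P `<=` V -> (forall u, V u -> exists b, forall r, P r -> cmod (l2dot u r) <= b) ->
  exists B, forall r, P r -> l2norm r <= B.
Proof.
move=> PV Hb; apply: contrapT => nB.
have big n : exists r, P r /\ 2 * n%:R * 3 ^+ n < l2norm r.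
  apply: contrapT => nr; apply: nB; exists (2 * n%:R * 3 ^+ n) => r Pr.
  by rewrite leNgt; apply/negP => lt; apply: nr; exists r.
have [r Hr] := choice big.
have Pr n : P (r n) := (Hr n).1.
have Vr n : V (r n) := PV _ (Pr n); have H2r n : H2 (r n) := VH2 (Vr n).
have r0 n : 0 < l2norm (r n).
  by apply: le_lt_trans (Hr n).2; rewrite !mulr_ge0 ?exprn_ge0.
pose e n : taylor R := Complex ((3 ^+ n)^-1 / l2norm (r n)) 0 *: r n.
have Ve n : V (e n) by exact: subspaceZ.
have t0 n : 0 < (3 ^+ n)^-1 :> R by rewrite invr_gt0 exprn_gt0.
have ne n : l2norm (e n) = (3 ^+ n)^-1.
  have [_ ->] := H2Z (Complex ((3 ^+ n)^-1 / l2norm (r n)) 0) (H2r n).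
  by rewrite cmod_real gtr0_norm ?divr_gt0// divfK// gt_eqF.
have der n : l2dot (e n) (r n) = Complex ((3 ^+ n)^-1 * l2norm (r n)) 0.
  rewrite l2dotZl// l2dot_norm//; apply/eqP; rewrite eq_complex /= !mul0r mulr0 subr0 addr0 eqxx andbT.
  by rewrite expr2 mulrA divfK// gt_eqF.
pose step n x := if (3 ^+ n)^-1 * l2norm (r n) <= cmod (l2dot (x + e n) (r n))
  then x + e n else x - e n.
pose fix x n : taylor R := if n is m.+1 then step m (x m) else 0.
have Vx n : V (x n).
  elim: n => [|n IH] /=; first exact: subspace0.
  by rewrite /step; case: ifP => _; [exact: subspaceD|exact: subspaceB].
have xr n : (3 ^+ n)^-1 * l2norm (r n) <= cmod (l2dot (x n.+1) (r n)).
  rewrite /= /step; case: ifP => // /negbT; rewrite -ltNge => lt.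
  have Hxn := VH2 (Vx n); have Hen := VH2 (Ve n).
  have := cmodB (l2dot (x n + e n) (r n)) (l2dot (x n - e n) (r n)).
  rewrite -l2dotBl//; [|exact: (H2D _ _).1|exact: (H2B _ _).1].
  rewrite subrDB.
  have -> : l2dot (e n + e n) (r n) = Complex (2 * ((3 ^+ n)^-1 * l2norm (r n))) 0.
    rewrite l2dotDl// der; apply/eqP.
    by rewrite eq_complex /= addr0 eqxx andbT mulr_natl mulr2n.
  rewrite cmod_real ger0_norm; last by rewrite !mulr_ge0// ltW.
  by move: lt; set A := cmod _; set B := cmod _; lra.
have xS n : l2norm (x n.+1 - x n) = (3 ^+ n)^-1.
  rewrite /= /step; case: ifP => _.
    by rewrite addrC addKr ne.
  by rewrite addrC addKr (H2N (VH2 (Ve n))).2 ne.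
(* The right-hand side is the sum of the increments [3^-j] for [n <= j < n + k]. *)
have xk n k : l2norm (x (k + n)%N - x n) <= 3 / 2 * ((3 ^+ n)^-1 - (3 ^+ (k + n))^-1).
  elim: k => [|k IH]; first by rewrite add0n !subrr mulr0 (H2_0 R).2.
  have [Hn [Hk Hk1]] := (VH2 (Vx n), (VH2 (Vx (k + n)%N), VH2 (Vx (k + n).+1))).
  rewrite addSn -(subrK (x (k + n)%N) (x (k + n).+1)) -addrA.
  apply: (le_trans (H2D (H2B Hk1 Hk).1 (H2B Hk Hn).1).2); rewrite xS.
  move: IH; rewrite exprS invfM.
  by set A := l2norm _; move: (3 ^- n) (3 ^- (k + n)) => y z; lra.
have xk' n k : l2norm (x (k + n)%N - x n) <= 3 / 2 * (3 ^+ n)^-1.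
  apply: (le_trans (xk n k)).
  by have := t0 (k + n)%N; move: (3 ^- n) (3 ^- (k + n)) => y z; lra.
have H2x n : H2 (x n) := VH2 (Vx n).
have [p Hp xp] : exists2 p, H2 p & l2norm (x k - p) @[k --> \oo] --> (0 : R).
  apply: l2_complete => // e' e0.
  have e3 : 0 < e' / 3 by rewrite divr_gt0.
  have /cvgr0Pnorm_lt/(_ _ e3)[N _ HN] : (3 ^+ n)^-1 @[n --> \oo] --> (0 : R).
    under eq_fun do rewrite -exprVn.
    by apply: cvg_expr; rewrite ger0_norm ?invr_ge0// invf_lt1// ltr1n.
  exists N => m n Nm Nn; have := xk' N (m - N)%N; have := xk' N (n - N)%N.
  rewrite !subnK//; have := HN N (leqnn N); rewrite /= ger0_norm ?(ltW (t0 _))//.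
  have [_] := H2B (H2B (H2x m) (H2x N)).1 (H2B (H2x n) (H2x N)).1.
  rewrite (_ : x m - x N - (x n - x N) = x m - x n); last by rewrite opprB addrA subrK.
  by move: (3 ^- N) => y; lra.
have Vp : V p by apply: (subspace_closed _ _ xp).
have px n : l2norm (p - x n) <= 3 / 2 * (3 ^+ n)^-1.
  have cv : l2norm (x (k + n)%N - x n) @[k --> \oo] --> l2norm (p - x n).
    apply: l2_cvg_norm => [k||]; [exact: (H2B _ _).1|exact: (H2B _ _).1|].
    have E k : x (k + n)%N - x n - (p - x n) = x (k + n)%N - p by rewrite opprB addrA subrK.
    have -> : (fun k => l2norm (x (k + n)%N - x n - (p - x n))) =
        (fun k => l2norm (x (k + n)%N - p)) by apply/funext => k; rewrite E.
    by move: xp; rewrite -(cvg_shiftn n).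
  exact: (cvg_le_bound cv).
have [b Hbp] := Hb _ Vp.
have := Num.Theory.archi_boundP (normr_ge0 b); set n := Num.bound _ => bn.
have := Hbp _ (Pr n); apply/negP; rewrite -ltNge.
apply: (le_lt_trans (ler_norm b)); apply: (lt_le_trans bn).
(* The tail after step [n] costs at most [3/2 * 3^-(n+1) = 3^-n / 2] times [|r n|], so the product
   of [p] with [r n] is at least [3^-n |r n| / 2], which exceeds [n > b] by the choice of [r n]. *)
have := cauchy_schwarz (H2B Hp (H2x n.+1)).1 (H2r n); rewrite l2dotBl//.
have := cmod_triB (l2dot (x n.+1) (r n)) (l2dot p (r n)); rewrite cmodC.
have := xr n; have := px n.+1; have := (Hr n).2; rewrite exprS invfM.
have := r0 n; have := t0 n.
have : (3 ^+ n)^-1 * 3 ^+ n = 1 :> R by rewrite mulVf// expf_neq0// pnatr_eq0.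
move: (3 ^+ n) (3 ^- n) (n%:R : R) (l2norm (r n)) (l2norm (p - x n.+1)) => T' t N' L P'.
move: (cmod (l2dot (x n.+1) (r n))) (cmod (l2dot p (r n))) => A1 A2.
move=> tT t_0 L0 LN Pt At1.
have : t * (2 * N' * T') < t * L by rewrite ltr_pM2l.
have -> : t * (2 * N' * T') = 2 * N' by rewrite mulrCA tT mulr1.
have : P' * L <= 3 / 2 * (3^-1 * t) * L by rewrite ler_pM2r.
by move=> U1 U2 U3 U4; nra.
Qed.

End Subspace.

End Hilbert.

(** * A contour estimate for polynomials *)

Section RootsOfUnity.
Variable R : realType.
Notation C := (Cplx R).

Lemma sin_le_id (x : R) : 0 <= x -> sin x <= x.
Proof.
move=> x0; have [c _] : exists2 c, c \in `[0, x]%R & sin x - sin 0 = cos c * (x - 0).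
  apply: (@MVT_segment R (@sin R) (@cos R)) => //.
  by apply: continuous_subspaceT => y; exact: continuous_sin.
rewrite sin0 !subr0 => ->; rewrite -[X in _ <= X]mul1r ler_wpM2r// cos_le1.
Qed.

Lemma cos_ge_sub (x : R) : 0 <= x -> 1 - x ^+ 2 <= cos x.
Proof.
move=> x0; have [c cx] : exists2 c, c \in `[0, x]%R & cos x - cos 0 = - sin c * (x - 0).
  apply: (@MVT_segment R (@cos R) (fun y => - sin y)) => //.
  by apply: continuous_subspaceT => y; exact: continuous_cos.
move: cx; rewrite in_itv /= => /andP[c0 cx].
rewrite cos0 subr0 => H; have := sin_le_id c0 => sc.
have : sin c * x <= x * x by rewrite ler_wpM2r// (le_trans sc).
by rewrite -expr2; lra.
Qed.

Lemma sin_ge_sub (x : R) : 0 <= x -> x <= 1 -> x - x ^+ 2 <= sin x.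
Proof.
move=> x0 x1; have [c cx] : exists2 c, c \in `[0, x]%R & sin x - sin 0 = cos c * (x - 0).
  apply: (@MVT_segment R (@sin R) (@cos R)) => //.
  by apply: continuous_subspaceT => y; exact: continuous_sin.
move: cx; rewrite in_itv /= => /andP[c0 cx].
rewrite sin0 !subr0 => ->; have := cos_ge_sub c0.
have : c ^+ 2 <= x by rewrite expr2; nra.
by rewrite expr2; nra.
Qed.

(** The second-order error is what makes a rotation by [x] comparable with a radial step of length
    [x]; the constant is crude, only the order in [x] matters. *)
Lemma expi_sub1 (x : R) : 0 <= x -> x <= 1 ->
  cmod (expi x - 1 - Complex 0 x) <= 2 * x ^+ 2.
Proof.
move=> x0 x1; apply: (le_trans (cmod_le_ReIm _)).
rewrite /expi !RecB !ImcB /= !subr0.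
rewrite (_ : 2 * x ^+ 2 = x ^+ 2 + x ^+ 2); last by rewrite mulr_natl mulr2n.
apply: lerD; rewrite ler_norml; apply/andP; split.
- by have := cos_ge_sub x0; lra.
- by have := cos_le1 x; have := sqr_ge0 x; lra.
- by have := sin_ge_sub x0 x1; lra.
- by have := sin_le_id x0; have := sqr_ge0 x; lra.
Qed.

Lemma expi_sub1_le (x : R) : 0 <= x -> x <= 1 -> cmod (expi x - 1) <= 3 * x.
Proof.
move=> x0 x1; rewrite -(subrK (Complex 0 x) (expi x - 1)).
apply: (le_trans (cmodD _ _)); have := expi_sub1 x0 x1.
rewrite (_ : cmod (Complex 0 x) = x).
  have : x ^+ 2 <= x by rewrite expr2; nra.
  by move: (cmod _) (x ^+ 2) => u v; lra.
by rewrite /= expr0n /= add0r sqrtr_sqr ger0_norm.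
Qed.

Lemma expi_eq1 (x : R) : 0 <= x < 2 * pi -> expi x = 1 :> R[i] -> x = 0.
Proof.
move=> /andP[x0 x2] [cx _]; apply/eqP; apply: contraT => xn0.
have x0' : 0 < x by rewrite lt_def xn0.
have : 0 < sin (x / 2) by apply: sin_gt0_pi; apply/andP; split; lra.
have : cos x = cos ((x / 2) *+ 2) by rewrite -mulr_natr divfK ?pnatr_eq0.
rewrite cx cos_mulr2n; have := sin2cos2 (x / 2); set s := sin _; set c := cos _ => E1.
rewrite mulr2n => E2 s0; have s2 : 0 < s ^+ 2 by rewrite exprn_gt0.
by exfalso; move: E1 E2 s2; move: (s ^+ 2) (c ^+ 2) => A B; lra.
Qed.

Definition root1 (N : nat) : R[i] := expi (2 * pi / N%:R).

Lemma root1X N : (0 < N)%N -> root1 N ^+ N = 1.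
Proof.
move=> N0; rewrite /root1 expiX -[(_ *+ N)]mulr_natr divfK ?pnatr_eq0 -?lt0n//.
by rewrite /expi mulr_natl cos2pi sin2pi.
Qed.

Lemma cmod_root1 N : cmod (root1 N) = 1.
Proof. exact: cmod_expi. Qed.

Lemma root1_inj N j k : (j < N)%N -> (k < N)%N -> root1 N ^+ j = root1 N ^+ k -> j = k.
Proof.
wlog kj : j k / (k <= j)%N.
  by move=> H jN kN E; case: (leqP k j) => [|/ltnW] le; [exact: H|apply/esym/H].
move=> jN kN E; have N0 : (0 < N)%N := leq_ltn_trans (leq0n _) jN.
have u0 : root1 N ^+ k != 0.
  by rewrite -cmod_eq0 cmodX cmod_root1 expr1n oner_eq0.
have : root1 N ^+ (j - k) = 1.
  by apply: (mulIf u0); rewrite mul1r -exprD subnK.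
have N0' : 0 < N%:R :> R by rewrite ltr0n.
rewrite /root1 expiX => /expi_eq1 H.
have : 2 * pi / N%:R *+ (j - k) = 0 :> R.
  apply: H; apply/andP; split.
    by rewrite mulrn_wge0// divr_ge0 ?mulr_ge0 ?pi_ge0.
  rewrite -[_ *+ (j - k)]mulr_natr mulrAC ltr_pdivrMr// ltr_pM2l ?mulr_gt0 ?pi_gt0//.
  by rewrite ltr_nat (leq_ltn_trans (leq_subr _ _)).
move/eqP; rewrite -[_ *+ (j - k)]mulr_natr !mulf_eq0 invr_eq0 !pnatr_eq0.
rewrite (gt_eqF (pi_gt0 R)) (gtn_eqF N0) /= subn_eq0 => jk; apply/eqP; rewrite eqn_leq jk kj.
by [].
Qed.

(** Orthogonality of characters: for [j <> k] the sum is geometric, with ratio an [N]-th root of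
    unity other than 1. *)
Lemma sum_root1 N j k : (j < N)%N -> (k < N)%N ->
  \sum_(a < N) (root1 N ^+ j * conjc (root1 N ^+ k)) ^+ a = (j == k)%:R * N%:R.
Proof.
move=> jN kN; have N0 : (0 < N)%N := leq_ltn_trans (leq0n _) jN.
set u := _ * _.
have u1 : root1 N ^+ k * conjc (root1 N ^+ k) = 1.
  by rewrite mul_conjc cmodX cmod_root1 !expr1n.
case: eqP => [jk|njk].
  rewrite (eq_bigr (fun=> 1)) => [|a _]; last by rewrite /u jk u1 expr1n.
  by rewrite sumr_const card_ord mul1r.
have uN : u ^+ N = 1.
  by rewrite /u exprMn -rmorphXn /= -!exprM !(mulnC _ N) !exprM root1X// !expr1n conjc1 mulr1.
have un1 : u != 1.
  apply/eqP => u_1; apply: njk; apply: (root1_inj jN kN).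
  by rewrite -[LHS]mulr1 -u1 mulrCA -/u u_1 mulr1.
rewrite mul0r; apply/eqP; rewrite -(mulrI_eq0 _ (_ : GRing.lreg (u - 1))).
  by rewrite -subrX1 uN subrr.
by apply/lregP; rewrite subr_eq0.
Qed.

Lemma discrete_parseval N (c : nat -> R[i]) :
  \sum_(a < N) cmod (\sum_(j < N) c j * (root1 N ^+ a) ^+ j) ^+ 2 =
  N%:R * \sum_(j < N) cmod (c j) ^+ 2.
Proof.
suff H : \sum_(a < N) (\sum_(j < N) c j * (root1 N ^+ a) ^+ j) *
      conjc (\sum_(j < N) c j * (root1 N ^+ a) ^+ j) =
    N%:R * \sum_(j < N) c j * conjc (c j).
  have mc (z : R[i]) : real_complex R (cmod z ^+ 2) = z * conjc z.
    by apply/esym; exact: mul_conjc.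
  apply: complexI; rewrite rmorphM !rmorph_sum rmorph_nat.
  rewrite (eq_bigr _ (fun a _ => mc _)) [in RHS](eq_bigr _ (fun a _ => mc _)).
  exact: H.
under eq_bigr => a _ do rewrite rmorph_sum big_distrlr /=.
rewrite exchange_big mulr_sumr /=; apply: eq_bigr => j _.
have E (k : 'I_N) : \sum_(a < N) c j * root1 N ^+ a ^+ j * conjc (c k * root1 N ^+ a ^+ k) =
    c j * conjc (c k) * ((j == k :> nat)%:R * N%:R).
  rewrite -sum_root1// mulr_sumr; apply: eq_bigr => a _.
  rewrite rmorphM /= mulrACA; congr (_ * _).
  by rewrite exprMn -rmorphXn /= -!exprM !(mulnC a).
rewrite exchange_big /= (bigD1 j)//= [X in _ + X]big1 ?addr0 => [|k kj].
  by rewrite E eqxx mul1r mulrC.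
by rewrite E eq_sym val_eqE (negbTE kj) mul0r mulr0.
Qed.

Definition pn2 (p : {poly R[i]}) : R := \sum_(j < size p) cmod p`_j ^+ 2.

Lemma pn2_ge0 p : 0 <= pn2 p.
Proof. by apply: sumr_ge0 => i _; exact: sqr_ge0. Qed.

Lemma pn2_wide N (p : {poly R[i]}) : (size p <= N)%N -> pn2 p = \sum_(j < N) cmod p`_j ^+ 2.
Proof.
move=> sN; rewrite /pn2 (big_ord_widen N (fun j => cmod p`_j ^+ 2))//.
rewrite big_mkcond /=; apply: eq_bigr => j _; case: ltnP => // le.
by rewrite nth_default// cmod0 expr0n.
Qed.

(** Once [N] reaches the size of the polynomial, the mean of its squared modulus over the [N]-th
    roots of unity is exactly its squared H^2 norm, so these norms need no integral and no limit in
    [N]. *)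
Lemma poly_parseval N (p : {poly R[i]}) : (size p <= N)%N ->
  \sum_(a < N) cmod p.[root1 N ^+ a] ^+ 2 = N%:R * pn2 p.
Proof.
move=> sN; rewrite (pn2_wide sN) -discrete_parseval; apply: eq_bigr => a _.
by rewrite (horner_coef_wide _ sN).
Qed.

Lemma poly_parseval_le N (p : {poly R[i]}) (r : R) : (size p <= N)%N ->
  0 <= r <= 1 ->
  \sum_(a < N) cmod p.[Complex r 0 * root1 N ^+ a] ^+ 2 <= N%:R * pn2 p.
Proof.
move=> sN /andP[r0 r1].
have -> : \sum_(a < N) cmod p.[Complex r 0 * root1 N ^+ a] ^+ 2 =
    N%:R * \sum_(j < N) cmod (p`_j * (Complex r 0) ^+ j) ^+ 2.
  rewrite -(discrete_parseval N (fun j => p`_j * (Complex r 0) ^+ j)).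
  apply: eq_bigr => a _; rewrite (horner_coef_wide _ sN).
  by congr (cmod _ ^+ 2); apply: eq_bigr => j _; rewrite exprMn mulrA.
rewrite (pn2_wide sN) ler_wpM2l//; apply: ler_sum => j _.
rewrite ler_pXn2r ?nnegrE ?cmod_ge0// cmodM cmodX cmod_real ger0_norm//.
by rewrite ler_piMr ?cmod_ge0// exprn_ile1.
Qed.

End RootsOfUnity.

(** * Approximate Cauchy-Riemann equation for polynomials and their quotients *)

Section ApproxCauchyRiemann.
Variable R : realType.
Implicit Types (eta c : R) (a b d e z : R[i]).

Definition im1 : R[i] := Complex 0 1.

Lemma cmod_im1 z : cmod (im1 * z) = cmod z.
Proof. by rewrite cmodM cmod_i mul1r. Qed.

(* [d] and [e] stand for the increments of a function under a small radial step
   and under the rotation of the same size; for a holomorphic function they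
   agree up to the factor [i] and a second-order error. *)
Definition near_cr eta c a d e :=
  [/\ cmod a <= c, cmod d <= c * eta, cmod e <= c * eta &
      cmod (d - im1 * e) <= c * eta ^+ 2].

Lemma near_crD eta c1 c2 a1 a2 d1 d2 e1 e2 :
  near_cr eta c1 a1 d1 e1 -> near_cr eta c2 a2 d2 e2 ->
  near_cr eta (c1 + c2) (a1 + a2) (d1 + d2) (e1 + e2).
Proof.
move=> [A1 B1 D1 E1] [A2 B2 D2 E2]; split; rewrite ?mulrDl.
- by apply: (le_trans (cmodD _ _)); exact: lerD.
- by apply: (le_trans (cmodD _ _)); exact: lerD.
- by apply: (le_trans (cmodD _ _)); exact: lerD.
- rewrite mulrDr opprD addrACA; apply: (le_trans (cmodD _ _)); exact: lerD.
Qed.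

Lemma cmodM_le z w (x y : R) : cmod z <= x -> cmod w <= y -> cmod (z * w) <= x * y.
Proof. by move=> zx wy; rewrite cmodM ler_pM ?cmod_ge0. Qed.

(** Product rule: the defect consists of the two defects of the factors and of the products [d1 d2]
    and [e1 e2], each at most [c1 c2 eta^2]; hence the factor 4. *)
Lemma near_crM eta c1 c2 a1 a2 d1 d2 e1 e2 : 0 <= eta <= 1 ->
  near_cr eta c1 a1 d1 e1 -> near_cr eta c2 a2 d2 e2 ->
  near_cr eta (4 * (c1 * c2)) (a1 * a2)
    ((a1 + d1) * (a2 + d2) - a1 * a2) ((a1 + e1) * (a2 + e2) - a1 * a2).
Proof.
move=> /andP[eta0 eta1] [A1 B1 D1 E1] [A2 B2 D2 E2].
have c10 : 0 <= c1 := le_trans (cmod_ge0 _) A1.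
have c20 : 0 <= c2 := le_trans (cmod_ge0 _) A2.
have expand (x y : R[i]) : (a1 + x) * (a2 + y) - a1 * a2 = x * a2 + a1 * y + x * y.
  by ring.
have cc : 0 <= c1 * c2 by rewrite mulr_ge0.
have cce : 0 <= c1 * c2 * eta by rewrite mulr_ge0.
have ee : eta ^+ 2 <= eta by rewrite expr2 ler_piMl.
have ccee : c1 * c2 * eta ^+ 2 <= c1 * c2 * eta by rewrite ler_wpM2l.
have ccee0 : 0 <= c1 * c2 * eta ^+ 2 by rewrite mulr_ge0 ?sqr_ge0.
have inc x y : cmod x <= c1 * eta -> cmod y <= c2 * eta ->
    cmod ((a1 + x) * (a2 + y) - a1 * a2) <= 4 * (c1 * c2) * eta.
  move=> X Y; rewrite expand; apply: (le_trans (cmodD _ _)).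
  have := cmodD (x * a2) (a1 * y).
  have := cmodM_le X A2; have := cmodM_le A1 Y; have := cmodM_le X Y.
  by move: ccee cce; rewrite expr2; nra.
split; [|exact: inc|exact: inc|].
  by apply: (le_trans (cmodM_le A1 A2)); lra.
rewrite !expand (_ : _ - im1 * _ = (d1 - im1 * e1) * a2 + a1 * (d2 - im1 * e2) +
   (d1 * d2 - im1 * (e1 * e2))); last by ring.
apply: (le_trans (cmodD _ _)).
have := cmodD ((d1 - im1 * e1) * a2) (a1 * (d2 - im1 * e2)).
have := cmodB (d1 * d2) (im1 * (e1 * e2)); rewrite cmod_im1.
have := cmodM_le E1 A2; have := cmodM_le A1 E2.
have := cmodM_le B1 B2; have := cmodM_le D1 D2.
have -> : c1 * eta * (c2 * eta) = c1 * c2 * eta ^+ 2 by ring.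
have -> : c1 * eta ^+ 2 * c2 = c1 * c2 * eta ^+ 2 by ring.
have -> : c1 * (c2 * eta ^+ 2) = c1 * c2 * eta ^+ 2 by ring.
have -> : 4 * (c1 * c2) * eta ^+ 2 = 4 * (c1 * c2 * eta ^+ 2) by ring.
by lra.
Qed.

(** Up to sign the defect is [(d - i e) / ((a + d) a) + i e (e - d) / ((a + d) (a + e) a)]. The last
    two summands of the constant bound these two terms, the first one bounds the inverse itself. *)
Lemma near_crV eta c ep a d e : 0 <= eta <= 1 -> 0 < ep ->
  ep <= cmod a -> ep <= cmod (a + d) -> ep <= cmod (a + e) ->
  near_cr eta c a d e ->
  near_cr eta (ep^-1 + c / ep ^+ 2 + 2 * c ^+ 2 / ep ^+ 3) a^-1
    ((a + d)^-1 - a^-1) ((a + e)^-1 - a^-1).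
Proof.
move=> /andP[eta0 eta1] ep0 ea ed ee [A B D E].
have c0 : 0 <= c := le_trans (cmod_ge0 _) A.
have nz z : ep <= cmod z -> z != 0.
  by move=> le; rewrite -cmod_gt0; exact: lt_le_trans le.
have inv_le z : ep <= cmod z -> cmod z^-1 <= ep^-1.
  by move=> le; rewrite cmodV lef_pV2 ?posrE//; exact: lt_le_trans le.
have [a0 [d0 e0]] := (nz _ ea, (nz _ ed, nz _ ee)).
have diff x : a + x != 0 -> (a + x)^-1 - a^-1 = - (x * ((a + x)^-1 * a^-1)).
  by move=> x0; field; rewrite a0 x0.
have p1 : 0 <= ep^-1 by rewrite invr_ge0 ltW.
have p2 : 0 <= c / ep ^+ 2 by rewrite divr_ge0 ?exprn_ge0 ?(ltW ep0).
have p3 : 0 <= 2 * c ^+ 2 / ep ^+ 3 by rewrite divr_ge0 ?mulr_ge0 ?exprn_ge0 ?(ltW ep0).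
have inc x : cmod x <= c * eta -> ep <= cmod (a + x) ->
    cmod ((a + x)^-1 - a^-1) <= (ep^-1 + c / ep ^+ 2 + 2 * c ^+ 2 / ep ^+ 3) * eta.
  move=> X ex; rewrite diff ?nz// cmodN.
  apply: (le_trans (cmodM_le X (cmodM_le (inv_le _ ex) (inv_le _ ea)))).
  rewrite -invfM -expr2 mulrAC ler_wpM2r//.
  by move: p1 p3; set u := ep^-1; set v := _ / ep ^+ 2; set w := _ / ep ^+ 3; lra.
split; [|exact: inc|exact: inc|].
  by apply: (le_trans (inv_le _ ea)); move: p2 p3; set u := ep^-1;
    set v := _ / ep ^+ 2; set w := _ / ep ^+ 3; lra.
rewrite !diff// (_ : _ - im1 * _ = - ((d - im1 * e) * ((a + d)^-1 * a^-1) +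
   im1 * (e * (e - d) * (((a + d)^-1 * (a + e)^-1) * a^-1)))); last first.
  by field; rewrite a0 d0 e0.
rewrite cmodN; apply: (le_trans (cmodD _ _)); rewrite cmod_im1.
have DB : cmod (e - d) <= 2 * c * eta.
  by apply: (le_trans (cmodB _ _)); lra.
have := cmodM_le E (cmodM_le (inv_le _ ed) (inv_le _ ea)).
have := cmodM_le (cmodM_le D DB)
  (cmodM_le (cmodM_le (inv_le _ ed) (inv_le _ ee)) (inv_le _ ea)).
have -> : c * eta * (2 * c * eta) * (ep^-1 * ep^-1 * ep^-1) = 2 * c ^+ 2 / ep ^+ 3 * eta ^+ 2.
  by field; rewrite gt_eqF.
have -> : c * eta ^+ 2 * (ep^-1 * ep^-1) = c / ep ^+ 2 * eta ^+ 2.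
  by field; rewrite gt_eqF.
have : 0 <= ep^-1 * eta ^+ 2 by rewrite mulr_ge0 ?sqr_ge0.
by rewrite !mulrDl; lra.
Qed.

(** Horner induction from the product and sum rules. The constant may depend on [p]: it only
    multiplies an error that vanishes as the step tends to 0. *)
Lemma near_cr_poly (p : {poly R[i]}) : exists c : R, 0 <= c /\
  forall eta z, 0 <= eta <= 1 -> cmod z <= 1 ->
  near_cr eta c p.[z] (p.[z * Complex (1 - eta) 0] - p.[z]) (p.[z * expi eta] - p.[z]).
Proof.
elim/poly_ind: p => [|p k [c [c0 H]]].
  exists 0; split=> // eta z _ _; rewrite !horner0 subrr.
  by split; rewrite ?mulr0 ?subrr ?mul0r cmod0.
exists (4 * (c * 3) + cmod k); split.
  by rewrite addr_ge0 ?cmod_ge0// !mulr_ge0.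
move=> eta z /[dup] /andP[eta0 eta1] eta01 z1; rewrite !hornerMXaddC.
have X : near_cr eta 3 z (z * Complex (1 - eta) 0 - z) (z * expi eta - z).
  have dq : Complex (1 - eta) 0 - 1 = - Complex eta 0 :> R[i].
    by apply/eqP; rewrite eq_complex /=; apply/andP; split; apply/eqP; ring.
  split.
  - by apply: (le_trans z1); rewrite ler1n.
  - rewrite -[X in _ - X]mulr1 -mulrBr dq mulrN cmodN cmodM cmod_real ger0_norm//.
    by apply: ler_pM; rewrite ?cmod_ge0//; apply: (le_trans z1); rewrite ler1n.
  - rewrite -[X in _ - X]mulr1 -mulrBr cmodM -[X in _ <= X]mul1r.
    by apply: ler_pM; rewrite ?cmod_ge0//; exact: expi_sub1_le.
  - have f1 (u : R[i]) : z * u - z = z * (u - 1) by rewrite mulrBr mulr1.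
    rewrite !f1 mulrCA -mulrBr dq.
    (* For the identity function the defect is [- i z (e^{i eta} - 1 - i eta)], since
       [- eta = i (i eta)]. *)
    rewrite (_ : - Complex eta 0 - _ = - im1 * (expi eta - 1 - Complex 0 eta)); last first.
      have -> : - Complex eta 0 = im1 * Complex 0 eta :> R[i].
        by apply/eqP; rewrite eq_complex /=; apply/andP; split; apply/eqP; ring.
      by ring.
    rewrite cmodM mulNr cmodN cmod_im1 -[X in _ <= X]mul1r.
    apply: ler_pM; rewrite ?cmod_ge0//; apply: (le_trans (expi_sub1 eta0 eta1)).
    by rewrite ler_wpM2r ?sqr_ge0// ler_nat.
have K : near_cr eta (cmod k) k 0 0.
  by split; rewrite ?mulr0 ?subrr ?cmod0 ?mulr_ge0 ?cmod_ge0 ?sqr_ge0.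
have := near_crD (near_crM eta01 (H eta z eta01 z1) X) K.
have r1 (x y : R[i]) : x + (y - x) = y by rewrite addrC subrK.
have r2 (x y : R[i]) : x + k - (y + k) = x - y by rewrite opprD addrACA subrr addr0.
by rewrite !r1 !r2 !addr0.
Qed.

End ApproxCauchyRiemann.

Lemma bernoulli_le (R : realDomainType) (x : R) n : -1 <= x ->
  1 + n%:R * x <= (1 + x) ^+ n.
Proof.
move=> x1; elim: n => [|n IH]; first by rewrite mul0r addr0 expr0.
rewrite exprS; have x0 : 0 <= 1 + x by lra.
apply: (le_trans _ (ler_wpM2l x0 IH)).
rewrite -natr1; have : 0 <= n%:R * x ^+ 2 by rewrite mulr_ge0 ?sqr_ge0.
by rewrite expr2; nra.
Qed.

(** * Moving a discrete contour into the disc *)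

Section Contour.
Variable R : realType.
Variables (lam : R[i]) (ep sg : R) (Theta p k : {poly R[i]}).
Hypotheses (lam1 : cmod lam = 1) (ep0 : 0 < ep) (sg0 : 0 < sg) (sg1 : sg <= 1).
Hypothesis Theta_ge : forall z : R[i], cmod z <= 1 -> cmod (z - lam) < 4 * sg ->
  ep <= cmod Theta.[z].

Let f := ('X - lam%:P) * p.

(** A tent-shaped weight, piecewise linear in the distance to [lam]; summation by parts uses no more
    regularity than its Lipschitz constant [1/sg]. *)
Definition cutoff (z : R[i]) : R := Num.max 0 (Num.min 1 (2 - cmod (z - lam) / sg)).

Lemma cutoff_ge0 z : 0 <= cutoff z.
Proof. by rewrite /cutoff le_max lexx. Qed.

Lemma cutoff_le1 z : cutoff z <= 1.
Proof. by rewrite /cutoff ge_max ler01 ge_min lexx. Qed.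

Lemma cutoff_far z : 2 * sg <= cmod (z - lam) -> cutoff z = 0.
Proof.
move=> far; apply/max_idPl; rewrite ge_min; apply/orP; right.
by rewrite subr_le0 ler_pdivlMr.
Qed.

Lemma cutoff_near z : cmod (z - lam) <= sg -> cutoff z = 1.
Proof.
move=> near; rewrite /cutoff (min_idPl _) ?(max_idPr _)//.
have : cmod (z - lam) / sg <= 1 by rewrite ler_pdivrMr// mul1r.
by move: (cmod _ / _) => x; lra.
Qed.

Lemma cutoff_lip z w : `|cutoff z - cutoff w| <= cmod (z - w) / sg.
Proof.
have lipmm (x y : R) :
    `|Num.max 0 (Num.min 1 x) - Num.max 0 (Num.min 1 y)| <= `|x - y|.
  have clampP (t : R) : [\/ t <= 0 /\ Num.max 0 (Num.min 1 t) = 0,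
      0 <= t <= 1 /\ Num.max 0 (Num.min 1 t) = t |
      1 <= t /\ Num.max 0 (Num.min 1 t) = 1].
    case: (leP 1 t) => [t1|/ltW t1]; first by apply: Or33; rewrite (max_idPr _).
    case: (leP 0 t) => [t0|/ltW t0]; first by apply: Or32; rewrite t1.
    by apply: Or31.
  have := ler_norm (x - y); have := ler_norm (y - x); rewrite distrC.
  set n := `|_ - _| => N1 N2.
  by case: (clampP x) => -[+ ->]; case: (clampP y) => -[+ ->]; rewrite ler_norml => *;
    apply/andP; split; lra.
apply: (le_trans (lipmm _ _)).
rewrite opprB addrC addrA subrK -mulrBl normrM [X in _ * X]ger0_norm ?invr_ge0 ?(ltW sg0)//.
rewrite ler_wpM2r ?invr_ge0 ?(ltW sg0)// ler_norml; apply/andP; split.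
  rewrite lerNl opprB; apply: (le_trans (cmod_triB _ _)).
  by rewrite opprB addrA subrK.
apply: (le_trans (cmod_triB _ _)).
by rewrite opprB addrA subrK cmodC.
Qed.

(** Holomorphic near [lam]. For [k] equal to [Theta conj(p)] on the circle it would be [|p|^2]
    there, which is how it enters the final estimate. *)
Definition quot (z : R[i]) : R[i] := p.[z] * k.[z] * (Theta.[z])^-1.

(** Since [f = (z - lam) p], passing from [p] to [f] costs a factor [1/de] at distance at least [de]
    from [lam]. *)
Lemma quot_le z (de : R) : cmod z <= 1 -> cmod (z - lam) < 4 * sg ->
  0 < de -> de <= cmod (z - lam) ->
  cmod (quot z) <= (ep * de)^-1 * (cmod f.[z] * cmod k.[z]).
Proof.
move=> z1 zl de0 dez; rewrite /quot /f !cmodM hornerM hornerXsubC cmodM cmodV.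
have T := Theta_ge z1 zl; have T0 := lt_le_trans ep0 T.
rewrite invfM; apply: (@le_trans _ _ (cmod p.[z] * cmod k.[z] * ep^-1)).
  by rewrite ler_wpM2l ?mulr_ge0 ?cmod_ge0// lef_pV2.
rewrite (_ : ep^-1 / de * _ = cmod p.[z] * cmod k.[z] * ep^-1 * (cmod (z - lam) / de)).
  apply: ler_peMr; last by rewrite ler_pdivlMr// mul1r.
  by rewrite mulr_ge0 ?invr_ge0 ?(ltW ep0)// mulr_ge0 ?cmod_ge0.
by ring.
Qed.

Lemma quot_cr : exists c : R, 0 <= c /\ forall eta z, 0 <= eta <= 1 -> cmod z <= 1 ->
  ep <= cmod Theta.[z] -> ep <= cmod Theta.[z * Complex (1 - eta) 0] ->
  ep <= cmod Theta.[z * expi eta] ->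
  cmod ((quot (z * Complex (1 - eta) 0) - quot z) -
        im1 R * (quot (z * expi eta) - quot z)) <= c * eta ^+ 2.
Proof.
have [cp [cp0 Hp]] := near_cr_poly p.
have [ck [ck0 Hk]] := near_cr_poly k.
have [ct [ct0 Ht]] := near_cr_poly Theta.
set c := 4 * (4 * (cp * ck) * (ep^-1 + ct / ep ^+ 2 + 2 * ct ^+ 2 / ep ^+ 3)).
exists c; split.
  by rewrite !(mulr_ge0, addr_ge0, divr_ge0, exprn_ge0, invr_ge0)// ltW.
move=> eta z eta01 z1 T1 T2 T3.
have r1 (x y : R[i]) : x + (y - x) = y by rewrite addrC subrK.
have HV := near_crV eta01 ep0 T1 _ _ (Ht eta z eta01 z1).
rewrite !r1 in HV; have {}HV := HV T2 T3.
have [_ _ _] := near_crM eta01 (near_crM eta01 (Hp eta z eta01 z1) (Hk eta z eta01 z1)) HV.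
by rewrite !r1.
Qed.

(** The cutoff is read off at the point of the unit circle and depends on the angle alone; only the
    holomorphic factor moves with the radius. *)
Definition ring_sum N (r : R) : R[i] :=
  \sum_(a < N) Complex (cutoff (root1 R N ^+ a)) 0 * quot (Complex r 0 * root1 R N ^+ a).

Lemma sum_rotate N (g : R[i] -> R[i]) : (0 < N)%N ->
  \sum_(a < N) g (root1 R N ^+ a * root1 R N) = \sum_(a < N) g (root1 R N ^+ a).
Proof.
case: N => // n _; rewrite big_ord_recr big_ord_recl /= -exprSr root1X// expr0.
by rewrite addrC; congr (_ + _); apply: eq_bigr => a _; rewrite -exprSr.
Qed.

Let nf := Num.sqrt (pn2 f).
Let nk := Num.sqrt (pn2 k).

Lemma sum_fk_le N (r : R) : (size f <= N)%N -> (size k <= N)%N -> 0 <= r <= 1 ->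
  \sum_(a < N) cmod f.[Complex r 0 * root1 R N ^+ a] *
    cmod k.[Complex r 0 * root1 R N ^+ a] <= N%:R * (nf * nk).
Proof.
move=> sf sk r01; apply: (le_trans (cauchy_schwarz_sum _ _ _)).
have N0 : 0 <= N%:R :> R by [].
have -> : N%:R * (nf * nk) = Num.sqrt (N%:R * pn2 f) * Num.sqrt (N%:R * pn2 k).
  by rewrite !sqrtrM// mulrACA -expr2 sqr_sqrtr.
by apply: ler_pM; rewrite ?sqrtr_ge0// ler_wsqrtr//; exact: poly_parseval_le.
Qed.

Lemma dist_radial (u : R[i]) (r : R) : cmod u = 1 -> 0 <= r <= 1 ->
  cmod (u - lam) - (1 - r) <= cmod (Complex r 0 * u - lam) <= cmod (u - lam) + (1 - r).
Proof.
move=> u1 /andP[r0 r1].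
have d : cmod (u - Complex r 0 * u) = 1 - r.
  rewrite -{1}[u]mul1r -mulrBl cmodM u1 mulr1.
  rewrite (_ : 1 - Complex r 0 = Complex (1 - r) 0) ?cmod_real ?ger0_norm ?subr_ge0//.
  by apply/eqP; rewrite eq_complex /= subr0 !eqxx.
have := cmodD (Complex r 0 * u - lam) (u - Complex r 0 * u).
have := cmodD (u - lam) (Complex r 0 * u - u).
have tele (x y : R[i]) : x - lam + (y - x) = y - lam by rewrite addrC addrA subrK.
rewrite (cmodC (_ * u) u) d !tele.
by move=> H1 H2; apply/andP; split; lra.
Qed.

(* The increment of the cutoff vanishes both near [lam] and far from it. *)
Lemma cutoff_quot_le (eta r : R) (u : R[i]) : 0 <= eta -> 6 * eta <= sg ->
  cmod u = 1 -> 0 <= r <= 1 -> 1 - r <= sg / 4 ->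
  cmod (Complex (cutoff (conjc (expi eta) * u) - cutoff u) 0 * quot (Complex r 0 * u)) <=
  12 * eta / (sg ^+ 2 * ep) * (cmod f.[Complex r 0 * u] * cmod k.[Complex r 0 * u]).
Proof.
move=> eta0 eta6 u1 r01 rsg; have [sg0' sg1'] := (sg0, sg1).
have D : cmod (conjc (expi eta) * u - u) <= 3 * eta.
  rewrite -[X in _ - X]mul1r -mulrBl cmodM u1 mulr1.
  have := cmodJ (expi eta - 1 : R[i]); rewrite rmorphB rmorph1 => ->.
  by apply: expi_sub1_le => //; have := sg1; lra.
have B0 : 0 <= 12 * eta / (sg ^+ 2 * ep) * (cmod f.[Complex r 0 * u] * cmod k.[Complex r 0 * u]).
  apply: mulr_ge0; last by rewrite mulr_ge0 ?cmod_ge0.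
  by apply: divr_ge0; apply: mulr_ge0 => //; rewrite ?sqr_ge0 ?(ltW ep0).
have N1 : cmod (conjc (expi eta) * u - lam) <= cmod (u - lam) + 3 * eta.
  rewrite -(subrK u (_ * u)) -addrA; apply: (le_trans (cmodD _ _)).
  by rewrite [leLHS]addrC lerD2l.
have N2 : cmod (u - lam) - 3 * eta <= cmod (conjc (expi eta) * u - lam).
  rewrite lerBlDr; apply: le_trans (_ : _ <= cmod (conjc (expi eta) * u - lam) +
    cmod (u - conjc (expi eta) * u)) _.
    by rewrite -{1}(subrK (conjc (expi eta) * u) u) -addrA addrC; exact: cmodD.
  by rewrite lerD2l cmodC.
(* A rotation by [eta] moves [u] by at most [3 eta <= sg / 2]. Hence both cutoffs are 1 if [u] is
   within [sg / 2] of [lam], and both are 0 if it is beyond [3 sg]. *)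
case: (lerP (cmod (u - lam)) (sg / 2)) => [near|far].
  by rewrite !cutoff_near ?subrr; [rewrite mul0r cmod0|lra|lra].
case: (lerP (3 * sg) (cmod (u - lam))) => [vfar|nfar].
  by rewrite !cutoff_far ?subrr; [rewrite mul0r cmod0|lra|lra].
have /andP[R1 R2] := dist_radial u1 r01.
rewrite cmodM cmod_real.
(* The increment of the cutoff is at most [3 eta / sg], and [|r u - lam| >= sg/2 - sg/4 = sg/4]; the
   product of both bounds yields the constant 12. *)
apply: (@le_trans _ _ (3 * eta / sg * ((ep * (sg / 4))^-1 *
    (cmod f.[Complex r 0 * u] * cmod k.[Complex r 0 * u])))).
  apply: ler_pM; rewrite ?cmod_ge0//.
    by apply: (le_trans (cutoff_lip _ _)); rewrite ler_wpM2r ?invr_ge0 ?(ltW sg0).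
  apply: quot_le; [|lra|lra|lra].
  by rewrite cmodM u1 mulr1 cmod_real; case/andP: r01 => r0 r1; rewrite ger0_norm.
rewrite [leLHS]mulrA; apply: ler_wpM2r; first by rewrite mulr_ge0 ?cmod_ge0.
rewrite le_eqVlt; apply/orP; left; apply/eqP.
by field; rewrite !gt_eqF.
Qed.

(* By the approximate Cauchy-Riemann equation, moving the ring one step inwards
   amounts to a rotation by 2 pi / N; summation by parts puts the rotation on the
   cutoff. *)
Lemma ring_sum_step (c : R) (Hc : 0 <= c) : (forall eta z, 0 <= eta <= 1 -> cmod z <= 1 ->
    ep <= cmod Theta.[z] -> ep <= cmod Theta.[z * Complex (1 - eta) 0] ->
    ep <= cmod Theta.[z * expi eta] ->
    cmod ((quot (z * Complex (1 - eta) 0) - quot z) -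
          im1 R * (quot (z * expi eta) - quot z)) <= c * eta ^+ 2) ->
  forall N (r : R), let eta := 2 * pi / N%:R in (0 < N)%N ->
  (size f <= N)%N -> (size k <= N)%N -> 6 * eta <= sg ->
  0 <= r <= 1 -> 1 - r * (1 - eta) <= sg / 4 ->
  cmod (ring_sum N (r * (1 - eta)) - ring_sum N r) <=
  N%:R * eta * (12 / (sg ^+ 2 * ep) * (nf * nk) + c * eta).
Proof.
move=> H N r eta N0 sf sk eta6 r01 rq; have [sg0' sg1'] := (sg0, sg1).
have N0' : 0 < N%:R :> R by rewrite ltr0n.
have eta0 : 0 <= eta by rewrite divr_ge0 ?mulr_ge0 ?pi_ge0.
have eta1 : eta <= 1 by lra.
have [r0 r1] := andP r01.
have rsg : 1 - r <= sg / 4.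
  by have : r * (1 - eta) <= r; [rewrite ler_piMr//; lra|lra].
set w := root1 R N.
have w1 a : cmod (w ^+ a) = 1 by rewrite cmodX cmod_root1 expr1n.
have wJ a : conjc (expi eta) * (w ^+ a * w) = w ^+ a.
  by rewrite mulrCA [_ * w]mulrC mul_conjc cmod_root1 expr1n mulr1.
have E1 : ring_sum N (r * (1 - eta)) - ring_sum N r =
  \sum_(a < N) Complex (cutoff (w ^+ a)) 0 *
    ((quot (Complex r 0 * w ^+ a * Complex (1 - eta) 0) - quot (Complex r 0 * w ^+ a)) -
     im1 R * (quot (Complex r 0 * w ^+ a * expi eta) - quot (Complex r 0 * w ^+ a))) +
  im1 R * \sum_(a < N) Complex (cutoff (conjc (expi eta) * w ^+ a) - cutoff (w ^+ a)) 0 *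
    quot (Complex r 0 * w ^+ a).
  have -> : \sum_(a < N) Complex (cutoff (conjc (expi eta) * w ^+ a) - cutoff (w ^+ a)) 0 *
      quot (Complex r 0 * w ^+ a) =
    \sum_(a < N) Complex (cutoff (w ^+ a)) 0 *
      (quot (Complex r 0 * w ^+ a * expi eta) - quot (Complex r 0 * w ^+ a)).
    rewrite (eq_bigr (fun a : 'I_N => Complex (cutoff (conjc (expi eta) * w ^+ a)) 0 *
      quot (Complex r 0 * w ^+ a) - Complex (cutoff (w ^+ a)) 0 * quot (Complex r 0 * w ^+ a))); last first.
      move=> a _; rewrite -mulrBl; congr (_ * _).
      by apply/eqP; rewrite eq_complex /= subr0 !eqxx.
    rewrite sumrB -(sum_rotate (fun z => Complex (cutoff (conjc (expi eta) * z)) 0 *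
      quot (Complex r 0 * z)))// -sumrB.
    by apply: eq_bigr => a _; rewrite wJ mulrA -mulrBr.
  rewrite mulr_sumr -big_split /= /ring_sum -sumrB; apply: eq_bigr => a _.
  rewrite (_ : Complex (r * (1 - eta)) 0 * _ = Complex r 0 * w ^+ a * Complex (1 - eta) 0).
    by ring.
  rewrite mulrAC; congr (_ * _); apply/eqP.
  by rewrite eq_complex /= !mulr0 !mul0r subr0 addr0 !eqxx.
rewrite {}E1; apply: (le_trans (cmodD _ _)); rewrite cmod_im1 mulrDr addrC.
apply: lerD.
  apply: (le_trans (cmod_sum _ _ _)).
  apply: (@le_trans _ _ (\sum_(a < N) 12 * eta / (sg ^+ 2 * ep) *
    (cmod f.[Complex r 0 * w ^+ a] * cmod k.[Complex r 0 * w ^+ a]))).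
    by apply: ler_sum => a _; exact: cutoff_quot_le.
  rewrite -mulr_sumr.
  rewrite (_ : N%:R * eta * _ = 12 * eta / (sg ^+ 2 * ep) * (N%:R * (nf * nk))); last by ring.
  apply: ler_wpM2l.
    by apply: divr_ge0; apply: mulr_ge0 => //; rewrite ?sqr_ge0 ?(ltW ep0).
  exact: sum_fk_le.
apply: (le_trans (cmod_sum _ _ _)).
rewrite (_ : N%:R * eta * (c * eta) = \sum_(a < N) c * eta ^+ 2); last first.
  by rewrite sumr_const card_ord -[RHS]mulr_natl; ring.
apply: ler_sum => a _; rewrite cmodM cmod_real ger0_norm ?cutoff_ge0//.
have ce0 : 0 <= c * eta ^+ 2 by rewrite mulr_ge0 ?sqr_ge0.
(* Where the cutoff vanishes nothing is needed of [Theta]. Elsewhere the three points compared lie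
   within [2 sg + 3 eta + sg / 4 < 4 sg] of [lam], inside the region where [Theta] is bounded
   below. *)
case: (lerP (2 * sg) (cmod (w ^+ a - lam))) => [far|near].
  by rewrite cutoff_far// mul0r.
apply: (@le_trans _ _ (1 * (c * eta ^+ 2))); last by rewrite mul1r.
apply: ler_pM; rewrite ?cutoff_ge0 ?cmod_ge0 ?cutoff_le1//.
have rq01 : 0 <= r * (1 - eta) <= 1.
  have e1 : 0 <= 1 - eta by rewrite subr_ge0.
  by rewrite mulr_ge0// mulr_ile1// gerBl.
have Dr : cmod (Complex r 0 * w ^+ a) = r by rewrite cmodM w1 mulr1 cmod_real ger0_norm.
have /andP[_ B1] := dist_radial (w1 a) r01.
have /andP[_ B2] := dist_radial (w1 a) rq01.
have Dw : cmod (w ^+ a * expi eta - lam) <= cmod (w ^+ a - lam) + 3 * eta.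
  rewrite -(subrK (w ^+ a) (_ * expi eta)) -addrA; apply: (le_trans (cmodD _ _)).
  rewrite [leLHS]addrC lerD2l -[X in _ - X]mulr1 -mulrBr cmodM w1 mul1r.
  exact: expi_sub1_le.
have wa1 : cmod (w ^+ a * expi eta) = 1 by rewrite cmodM w1 cmod_expi mulr1.
have /andP[_ B3] := dist_radial wa1 r01.
apply: H.
- by apply/andP.
- by rewrite Dr.
- by apply: Theta_ge; [rewrite Dr|lra].
- rewrite (_ : _ * _ * _ = Complex (r * (1 - eta)) 0 * w ^+ a).
    apply: Theta_ge; last by lra.
    by rewrite cmodM w1 mulr1 cmod_real ger0_norm; case/andP: rq01.
  rewrite mulrAC; congr (_ * _); apply/eqP.
  by rewrite eq_complex /= !mulr0 !mul0r subr0 addr0 !eqxx.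
- rewrite -mulrA; apply: Theta_ge; last by lra.
  by rewrite cmodM wa1 mulr1 cmod_real ger0_norm.
Qed.

End Contour.

Section ContourShift.
Variable R : realType.
Variables (lam : R[i]) (ep sg : R) (Theta p k : {poly R[i]}).
Hypotheses (lam1 : cmod lam = 1) (ep0 : 0 < ep) (sg0 : 0 < sg) (sg1 : sg <= 1).
Hypothesis Theta_ge : forall z : R[i], cmod z <= 1 -> cmod (z - lam) < 4 * sg ->
  ep <= cmod Theta.[z].
Let f := ('X - lam%:P) * p.
Let nf := Num.sqrt (pn2 f).
Let nk := Num.sqrt (pn2 k).
Notation ring_sum := (ring_sum lam sg Theta p k).

(* On the ring of radius about 1 - sg/4, |z - lam| is bounded below, hence |p| is
   controlled by |f|; finitely many steps of total length sg/4 lead there. *)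
Lemma ring_sum_bound : exists c0 : R, 0 <= c0 /\ forall N,
  let eta := 2 * pi / N%:R in (0 < N)%N -> (size f <= N)%N -> (size k <= N)%N ->
  8 * eta <= sg ->
  cmod (ring_sum N 1) <= N%:R * (19 / (sg * ep) * (nf * nk) + c0 * eta).
Proof.
have [c [c0 Hc]] := quot_cr Theta p k ep0.
exists c; split=> // N eta N0 sf sk eta8.
have N0' : 0 < N%:R :> R by rewrite ltr0n.
have eta0 : 0 < eta by rewrite divr_gt0 ?mulr_gt0 ?pi_gt0.
have St (r : R) : 6 * eta <= sg -> 0 <= r <= 1 -> 1 - r * (1 - eta) <= sg / 4 ->
    cmod (ring_sum N (r * (1 - eta)) - ring_sum N r) <=
    N%:R * eta * (12 / (sg ^+ 2 * ep) * (nf * nk) + c * eta).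
  by move=> *; exact: (ring_sum_step ep0 sg0 sg1 Theta_ge c0 Hc).
move: {Hc} eta eta0 eta8 St => eta eta0 eta8 St.
have [sg0' sg1'] := (sg0, sg1).
have eta1 : eta <= 1 by lra.
have q0 : 0 <= 1 - eta by rewrite subr_ge0.
have qle j : 1 - j%:R * eta <= (1 - eta) ^+ j.
  by have := @bernoulli_le _ (- eta) j; rewrite mulrN lerN2; apply.
pose B := 12 / (sg ^+ 2 * ep) * (nf * nk) + c * eta.
have B0 : 0 <= B.
  apply: addr_ge0; last by rewrite mulr_ge0 ?(ltW eta0).
  apply: mulr_ge0; last by rewrite mulr_ge0 ?sqrtr_ge0.
  by rewrite divr_ge0// mulr_ge0 ?sqr_ge0 ?(ltW ep0).
have shrink j : j%:R * eta <= sg / 4 ->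
    cmod (ring_sum N ((1 - eta) ^+ j) - ring_sum N 1) <= j%:R * (N%:R * eta * B).
  elim: j => [|j IH]; first by move=> _; rewrite expr0 subrr cmod0 mul0r.
  move=> le; have le' : j%:R * eta <= sg / 4.
    by apply: le_trans le; rewrite ler_wpM2r ?(ltW eta0)// ler_nat.
  rewrite -(subrK (ring_sum N ((1 - eta) ^+ j)) (ring_sum N _)) -addrA.
  apply: (le_trans (cmodD _ _)); rewrite -natr1 mulrDl mul1r [leRHS]addrC.
  apply: lerD; last exact: IH.
  rewrite exprSr; apply: St.
  - by apply: le_trans eta8; rewrite ler_wpM2r ?(ltW eta0)// ler_nat.
  - by rewrite exprn_ge0//= exprn_ile1// gerBl ltW.
  - by rewrite -exprSr; have := qle j.+1; lra.
have x0 : 0 <= sg / (4 * eta) by rewrite divr_ge0 ?(ltW sg0)// mulr_ge0// ltW.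
(* [J] is the largest number of steps of total length at most [sg/4]; as [8 eta <= sg], this length
   is at least [sg/4 - eta >= sg/8]. *)
have /andP[J1 J2] := truncn_itv x0; set J := Num.truncn _ in J1 J2.
have JE1 : J%:R * eta <= sg / 4.
  move: J1; rewrite ler_pdivlMr ?mulr_gt0// => J1.
  by rewrite ler_pdivlMr// -mulrA (mulrC eta).
have JE2 : sg / 8 <= J%:R * eta.
  move: J2; rewrite ltr_pdivrMr ?mulr_gt0// -natr1 => J2.
  have -> : J%:R * eta = ((J%:R + 1) * (4 * eta)) / 4 - eta by field.
  by move: J2 eta8; set x := (_ + 1) * _; lra.
set r := (1 - eta) ^+ J.
have r0 : 0 <= r by rewrite exprn_ge0.
have r1 : r <= 1 by rewrite exprn_ile1// gerBl ltW.
have rfar : sg / 16 <= 1 - r.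
  (* An upper bound for [(1 - eta)^J] without exponentials: multiplied by [(1 + eta)^J >= 1 + sg/8]
     it stays at most 1. *)
  have bJ : 1 + J%:R * eta <= (1 + eta) ^+ J by apply: bernoulli_le; lra.
  have prod1 : r * (1 + eta) ^+ J <= 1.
    rewrite -exprMn exprn_ile1//; first by rewrite mulr_ge0// addr_ge0// ltW.
    by have := sqr_ge0 eta; rewrite expr2; lra.
  have : r * (1 + sg / 8) <= 1.
    apply: le_trans prod1; apply: ler_wpM2l => //; apply: le_trans bJ.
    by rewrite lerD2l.
  by nra.
have rnear : 1 - r <= sg / 4 by have := qle J; rewrite -/r; lra.
have end_bound : cmod (ring_sum N r) <= N%:R * (16 / (sg * ep) * (nf * nk)).
  apply: (le_trans (cmod_sum _ _ _)).
  apply: (@le_trans _ _ (\sum_(a < N) 16 / (sg * ep) *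
     (cmod f.[Complex r 0 * root1 R N ^+ a] * cmod k.[Complex r 0 * root1 R N ^+ a]))).
    apply: ler_sum => a _; set u := root1 R N ^+ a.
    have u1 : cmod u = 1 by rewrite cmodX cmod_root1 expr1n.
    have r01 : 0 <= r <= 1 by rewrite r0.
    have ru : cmod (Complex r 0 * u) = r by rewrite cmodM u1 mulr1 cmod_real ger0_norm.
    have R0 : 0 <= 16 / (sg * ep) * (cmod f.[Complex r 0 * u] * cmod k.[Complex r 0 * u]).
      apply: mulr_ge0; last by rewrite mulr_ge0 ?cmod_ge0.
      by apply: divr_ge0 => //; rewrite mulr_ge0 ?(ltW sg0) ?(ltW ep0).
    rewrite cmodM cmod_real ger0_norm ?cutoff_ge0//.
    case: (lerP (2 * sg) (cmod (u - lam))) => [far|near].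
      by rewrite cutoff_far// mul0r.
    have /andP[_ B2] := dist_radial lam u1 r01.
    rewrite -[leRHS]mul1r; apply: ler_pM; rewrite ?cutoff_ge0 ?cmod_ge0 ?cutoff_le1//.
    have -> : 16 / (sg * ep) = (ep * (sg / 16))^-1 by field; rewrite !gt_eqF.
    apply: (quot_le p k ep0 Theta_ge) => //; [by rewrite ru|lra|lra|].
    apply: (le_trans rfar); have := cmod_triB lam (Complex r 0 * u); by rewrite lam1 ru cmodC.
  rewrite -mulr_sumr mulrCA ler_wpM2l//.
    by rewrite divr_ge0// mulr_ge0 ?(ltW sg0) ?(ltW ep0).
  by apply: sum_fk_le => //; rewrite r0.
have := shrink J JE1; rewrite -/r => Hs.
rewrite -(subKr (ring_sum N r) (ring_sum N 1)); apply: (le_trans (cmodB _ _)).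
have := ler_wpM2r (mulr_ge0 (ltW N0') B0) JE1.
have -> : J%:R * eta * (N%:R * B) = J%:R * (N%:R * eta * B) by ring.
move=> Hs2; apply: (le_trans (lerD end_bound (le_trans Hs Hs2))).
have -> : sg / 4 * (N%:R * B) = N%:R * (3 / (sg * ep) * (nf * nk) + sg / 4 * (c * eta)).
  by rewrite /B; field; rewrite !gt_eqF.
rewrite -mulrDr ler_wpM2l ?(ltW N0')// addrA -mulrDl -mulrDl.
(* 16 stems from [|z - lam| >= sg/16] on the last ring, 3 from the total length [sg/4] times the
   rate [12 / sg^2]. *)
have -> : 16 + 3 = 19 :> R by lra.
rewrite lerD2l ler_piMl ?mulr_ge0 ?(ltW eta0)//; lra.
Qed.

End ContourShift.

Lemma nat_bound4 (a b c d : nat) :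
  exists m, [/\ (a <= m)%N, (b <= m.+1)%N, (c <= m.+1)%N & (d <= m.+1)%N].
Proof. by exists (a + b + c + d)%N; split; lia. Qed.

(** * The lower bound for polynomials *)

Section PolyEstimate.
Variable R : realType.
Variables (lam : R[i]) (ep sg K : R).
Hypotheses (lam1 : cmod lam = 1) (ep0 : 0 < ep) (sg0 : 0 < sg) (sg1 : sg <= 1) (K0 : 0 <= K).

(** The reciprocal polynomial [z^(n-1) conj(p(1/conj z))] with [n = size p]; it trades [conj(p)] on
    the circle for a polynomial. *)
Definition conjrev (p : {poly R[i]}) : {poly R[i]} :=
  \poly_(i < size p) conjc p`_((size p).-1 - i).

Lemma conjrev_circle p (z : R[i]) : cmod z = 1 ->
  conjc p.[z] = conjc z ^+ (size p).-1 * (conjrev p).[z].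
Proof.
move=> z1; have zz : conjc z * z = 1 by rewrite mulrC mul_conjc z1 expr1n.
rewrite horner_poly mulr_sumr horner_coef rmorph_sum (reindex_inj rev_ord_inj) /=.
apply: eq_bigr => i _; rewrite rmorphM rmorphXn /= mulrCA.
have le : (i <= (size p).-1)%N by rewrite -ltnS (ltn_predK (ltn_ord i)).
have -> : (size p - i.+1 = (size p).-1 - i)%N.
  by rewrite -{1}(ltn_predK (ltn_ord i)) subSS.
congr (_ * _); rewrite -{2}(subnK le) exprD -mulrA -exprMn zz expr1n mulr1.
by [].
Qed.

(** The inner product of [p] with [z^m Theta], that is, the [m]-th coefficient of the Toeplitz
    operator with symbol [conj(Theta)] applied to [p]. It measures how far [p] is from being
    orthogonal to the multiples of [Theta]. *)
Definition toeplitz (Theta p : {poly R[i]}) (m : nat) : R[i] :=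
  \sum_(j < size p) p`_(j + m) * conjc Theta`_j.

Lemma coef_mul_conjrev (Theta p : {poly R[i]}) (i : nat) : (i < size p)%N ->
  (Theta * conjrev p)`_i = conjc (toeplitz Theta p ((size p).-1 - i)).
Proof.
move=> ip; rewrite coefM /toeplitz rmorph_sum /=.
rewrite [RHS](bigID (fun j : 'I_(size p) => (j < i.+1)%N)) /= [X in _ + X]big1 ?addr0.
  rewrite (big_ord_widen (size p) (fun j => Theta`_j * (conjrev p)`_(i - j)))//.
  apply: eq_bigr => j ji; rewrite rmorphM /= conjcK mulrC coef_poly.
  rewrite (leq_ltn_trans (leq_subr _ _) ip); congr (conjc _`_ _ * _).
  have i1 : (i <= (size p).-1)%N by rewrite -ltnS (ltn_predK ip).
  by rewrite subnBA// addnC addnBA.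
move=> j; rewrite -leqNgt => ij; rewrite nth_default ?mul0r ?rmorph0//.
have i1 : (i <= (size p).-1)%N by rewrite -ltnS (ltn_predK ip).
by lia.
Qed.

(** The summands account for the part of the circle away from [lam], the Toeplitz term, the contour
    term (where [k] has norm at most [(2K + 2) |p|]) and the trivial case in which [p] is dominated
    by the Toeplitz term. *)
Definition estimate_const : R :=
  2 / sg ^+ 2 + ep^-1 + 19 / (sg * ep) * (2 * K + 2) + 1.

(* On the circle, conj(p) Theta = k + conj(z)^(n-1) T where k vanishes at 0 and the
   coefficients of T are the conjugates of those of toeplitz Theta p. *)
Lemma poly_estimate (Theta p : {poly R[i]}) :
  (forall z : R[i], cmod z <= 1 -> cmod (z - lam) < 4 * sg -> ep <= cmod Theta.[z]) ->
  (forall z : R[i], cmod z = 1 -> cmod Theta.[z] <= K) ->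
  Num.sqrt (pn2 p) <= estimate_const *
    (Num.sqrt (pn2 (('X - lam%:P) * p)) +
     Num.sqrt (\sum_(m < size p) cmod (toeplitz Theta p m) ^+ 2)).
Proof.
move=> Theta_ge Theta_le.
set n := size p; set f := ('X - lam%:P) * p.
set P := Num.sqrt (pn2 p); set F := Num.sqrt (pn2 f).
set Q := Num.sqrt (\sum_(m < n) _).
have [P0 [F0 Q0]] : 0 <= P /\ 0 <= F /\ 0 <= Q by rewrite !sqrtr_ge0.
have PE : P ^+ 2 = pn2 p by rewrite sqr_sqrtr// pn2_ge0.
have FE : F ^+ 2 = pn2 f by rewrite sqr_sqrtr// pn2_ge0.
set W := Theta * conjrev p; set T := take_poly n W.
pose k : {poly R[i]} := 'X * drop_poly n W.
have TE : pn2 T = Q ^+ 2.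
  rewrite /Q sqr_sqrtr ?sumr_ge0// => [|i _]; last exact: sqr_ge0.
  rewrite (pn2_wide (size_take_poly n W)) (reindex_inj rev_ord_inj) /=.
  apply: eq_bigr => i _; have ip := ltn_ord i.
  rewrite coef_take_poly /n ifT; last by rewrite -subSn// subSS leq_subr.
  rewrite coef_mul_conjrev ?cmodJ; last by rewrite -subSn// subSS leq_subr.
  by congr (cmod (toeplitz _ _ _) ^+ 2); rewrite -/n; lia.
set k2 := Num.sqrt (pn2 k).
have split_conj (z : R[i]) : cmod z = 1 ->
    Theta.[z] * conjc p.[z] = k.[z] + conjc z ^+ n.-1 * T.[z].
  move=> z1; have zz : conjc z * z = 1 by rewrite mulrC mul_conjc z1 expr1n.
  rewrite conjrev_circle// mulrCA -hornerM -/W -{1}(poly_take_drop n W) hornerD mulrDr addrC.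
  congr (_ + _); rewrite /k !hornerM hornerX hornerXn.
  (* For [n = 0] the exponent [n.-1] is not [n - 1], but then [W] is zero. Otherwise
     [conj(z)^(n-1) z^n = z] on the circle, which is the factor ['X] of [k]. *)
  have [p0|p_n0] := posnP n.
    have -> : W = 0 by rewrite /W /conjrev -/n p0 poly_def big_ord0 mulr0.
    by rewrite drop_poly0r horner0 !(mulr0, mul0r).
  by rewrite -{2}(prednK p_n0) exprS mulrCA (mulrCA _ z) -exprMn zz expr1n mulr1 mulrC.
have k_le (z : R[i]) : cmod z = 1 ->
    cmod k.[z] ^+ 2 <= 2 * (K ^+ 2 * cmod p.[z] ^+ 2) + 2 * cmod T.[z] ^+ 2.
  move=> z1; have -> : k.[z] = Theta.[z] * conjc p.[z] - conjc z ^+ n.-1 * T.[z].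
    by rewrite split_conj// addrK.
  apply: (le_trans (cmodD_sq_le _ _)).
  rewrite cmodN !cmodM cmodX !cmodJ z1 expr1n mul1r lerD2r ler_wpM2l// exprMn.
  by rewrite ler_wpM2r ?sqr_ge0// ler_pXn2r ?nnegrE ?cmod_ge0 ?Theta_le.
(* The mean of [|p|^2] is split by the cutoff. The weight [1 - cutoff] lives at distance more than
   [sg] from [lam] and gives [F^2 / sg^2]; the weight [cutoff] gives the ring sum and a term with
   [T], left to Cauchy-Schwarz. *)
have bound N : (0 < N)%N -> (size p <= N)%N -> (size f <= N)%N -> (size k <= N)%N ->
    (n <= N)%N -> forall c0 : R, 0 <= c0 ->
  cmod (ring_sum lam sg Theta p k N 1) <=
    N%:R * (19 / (sg * ep) * (F * k2) + c0 * (2 * pi / N%:R)) ->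
  P ^+ 2 <= F ^+ 2 / sg ^+ 2 + P * Q / ep + 19 / (sg * ep) * (F * k2) + c0 * (2 * pi / N%:R).
  move=> N0 sp sf sk sn c0 c00 ring_le.
  have N0' : 0 < N%:R :> R by rewrite ltr0n.
  rewrite -(ler_pM2l N0') PE -(poly_parseval sp).
  set u := fun a : 'I_N => root1 R N ^+ a.
  have u1 a : cmod (u a) = 1 by rewrite cmodX cmod_root1 expr1n.
  have -> : \sum_(a < N) cmod p.[root1 R N ^+ a] ^+ 2 =
    \sum_(a < N) (1 - cutoff lam sg (u a)) * cmod p.[u a] ^+ 2 +
    \sum_(a < N) cutoff lam sg (u a) * cmod p.[u a] ^+ 2.
    by rewrite -big_split /=; apply: eq_bigr => a _; rewrite mulrBl mul1r subrK.
  rewrite -!addrA mulrDr; apply: lerD.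
    apply: (@le_trans _ _ (\sum_(a < N) (sg ^+ 2)^-1 * cmod f.[u a] ^+ 2)); last first.
      by rewrite -mulr_sumr poly_parseval// FE mulrCA [_^-1 * _]mulrC.
    apply: ler_sum => a _.
    case: (lerP (cmod (u a - lam)) sg) => [near|far].
      by rewrite cutoff_near// subrr mul0r mulr_ge0 ?sqr_ge0// invr_ge0 sqr_ge0.
    apply: (@le_trans _ _ (1 * cmod p.[u a] ^+ 2)).
      by rewrite ler_wpM2r ?sqr_ge0// gerBl cutoff_ge0.
    rewrite mul1r ler_pdivlMl ?exprn_gt0// /f hornerM hornerXsubC cmodM exprMn.
    by rewrite ler_wpM2r ?sqr_ge0// ler_pXn2r ?nnegrE ?cmod_ge0 ?(ltW sg0)// ltW.
  have E (a : 'I_N) : Complex (cutoff lam sg (u a) * cmod p.[u a] ^+ 2) 0 =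
      Complex (cutoff lam sg (u a)) 0 * quot Theta p k (Complex 1 0 * u a) +
      Complex (cutoff lam sg (u a)) 0 *
        (p.[u a] * (conjc (u a) ^+ n.-1 * T.[u a]) * (Theta.[u a])^-1).
    rewrite (_ : Complex 1 0 = 1)// mul1r -mulrDr /quot.
    case: (lerP (2 * sg) (cmod (u a - lam))) => [far|near].
      by rewrite cutoff_far// mul0r [RHS]mul0r.
    have T0 : Theta.[u a] != 0.
      rewrite -cmod_gt0; apply: (lt_le_trans ep0); apply: Theta_ge; first by rewrite u1.
      by apply: (lt_trans near); rewrite ltr_pM2r// ltr_nat.
    rewrite -mulrDl -mulrDr -split_conj//.
    have -> : p.[u a] * (Theta.[u a] * conjc p.[u a]) / Theta.[u a] = p.[u a] * conjc p.[u a].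
      by field.
    rewrite mul_conjc.
    by apply/eqP; rewrite eq_complex /= !mulr0 !mul0r subr0 addr0 !eqxx.
  have S1_ge0 : 0 <= \sum_(a < N) cutoff lam sg (u a) * cmod p.[u a] ^+ 2.
    by apply: sumr_ge0 => a _; rewrite mulr_ge0 ?cutoff_ge0 ?sqr_ge0.
  rewrite -[leLHS]ger0_norm// -cmod_real.
  have -> : Complex (\sum_(a < N) cutoff lam sg (u a) * cmod p.[u a] ^+ 2) 0 =
      \sum_(a < N) Complex (cutoff lam sg (u a) * cmod p.[u a] ^+ 2) 0 :> R[i].
    exact: (rmorph_sum (real_complex R)).
  rewrite (eq_bigr _ (fun a _ => E a)) big_split /=.
  apply: (le_trans (cmodD _ _)); rewrite [leLHS]addrC mulrDr; apply: lerD; last exact: ring_le.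
  apply: (le_trans (cmod_sum _ _ _)).
  apply: (@le_trans _ _ (\sum_(a < N) ep^-1 * (cmod p.[u a] * cmod T.[u a]))); last first.
    rewrite -mulr_sumr mulrA [leRHS]mulrC; apply: ler_wpM2l; first by rewrite invr_ge0 ltW.
    apply: (le_trans (cauchy_schwarz_sum _ _ _)).
    rewrite (poly_parseval sp) poly_parseval; last exact: leq_trans (size_take_poly _ _) sn.
    rewrite TE -PE !(sqrtrM _ (ltW N0')) !sqrtr_sqr !ger0_norm// mulrACA -expr2.
    by rewrite sqr_sqrtr// ltW.
  apply: ler_sum => a _; rewrite cmodM cmod_real ger0_norm ?cutoff_ge0//.
  have R0 : 0 <= ep^-1 * (cmod p.[u a] * cmod T.[u a]).
    by rewrite mulr_ge0 ?invr_ge0 ?(ltW ep0)// mulr_ge0 ?cmod_ge0.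
  case: (lerP (2 * sg) (cmod (u a - lam))) => [far|near].
    by rewrite cutoff_far// mul0r.
  have T0 : ep <= cmod Theta.[u a].
    apply: Theta_ge; first by rewrite u1.
    by apply: (lt_trans near); rewrite ltr_pM2r// ltr_nat.
  rewrite -[leRHS]mul1r; apply: ler_pM; rewrite ?cutoff_ge0 ?cmod_ge0 ?cutoff_le1//.
  rewrite !cmodM cmodX cmodJ u1 expr1n mul1r cmodV mulrC ler_wpM2r ?mulr_ge0 ?cmod_ge0//.
  by rewrite lef_pV2// posrE (lt_le_trans ep0).
have [c0 [c00 Hring]] := ring_sum_bound p k lam1 ep0 sg0 sg1 Theta_ge.
have k2_le : k2 ^+ 2 <= 2 * (K ^+ 2 * P ^+ 2) + 2 * Q ^+ 2.
  rewrite sqr_sqrtr ?pn2_ge0//.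
  have [m [_ sk sp _]] := nat_bound4 0 (size k) (size p) 0.
  have sn := sp; set N := m.+1 in sk sp sn.
  have N0' : 0 < N%:R :> R by rewrite ltr0n.
  rewrite -(ler_pM2l N0') -(poly_parseval sk).
  rewrite mulrDr mulrCA [_ * (K ^+ 2 * _)]mulrCA [N%:R * (2 * Q ^+ 2)]mulrCA PE -TE.
  rewrite -(poly_parseval sp) -(@poly_parseval _ N T); last first.
    exact: leq_trans (size_take_poly _ _) sn.
  rewrite !mulr_sumr -big_split /=; apply: ler_sum => a _; apply: k_le.
  by rewrite cmodX cmod_root1 expr1n.
(* Letting [N] grow removes the term with [c0], the only constant that depends on the polynomials
   themselves. *)
have main : P ^+ 2 <= F ^+ 2 / sg ^+ 2 + P * Q / ep + 19 / (sg * ep) * (F * k2).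
  apply/ler_addgt0Pr => e e0.
  pose d := Num.min (sg / 8) (e / (c0 + 1)).
  have d0 : 0 < d by rewrite lt_min !divr_gt0// ltr_wpDl.
  have dpi : 0 < d / (2 * pi) by rewrite divr_gt0// mulr_gt0// pi_gt0.
  have [N1 HN1] := inv_nat_small dpi.
  have [m [N1m sp sf sk]] := nat_bound4 N1 (size p) (size f) (size k).
  have := HN1 m N1m; set N := m.+1 => HN; have N0 : (0 < N)%N by [].
  have eta_d : 2 * pi / N%:R < d.
    by move: HN; rewrite ltr_pdivlMr ?mulr_gt0 ?pi_gt0// mulrC.
  have eta8 : 8 * (2 * pi / N%:R) <= sg.
    have : d <= sg / 8 by rewrite ge_min lexx.
    by move: eta_d; set x := 2 * pi / _ => *; lra.
  apply: (le_trans (bound N N0 sp sf sk sp c0 c00 (Hring N N0 sf sk eta8))).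
  rewrite lerD2l; have de : d <= e / (c0 + 1) by rewrite ge_min lexx orbT.
  have c1 : 0 < c0 + 1 by rewrite ltr_wpDl.
  have : (c0 + 1) * (2 * pi / N%:R) <= e.
    by rewrite mulrC -ler_pdivlMr//; apply: le_trans de; exact: ltW.
  have : 0 <= 2 * pi / N%:R :> R by rewrite divr_ge0 ?mulr_ge0 ?pi_ge0.
  by set x := 2 * pi / _ => *; lra.
have i1 : 0 <= 2 / sg ^+ 2 by rewrite divr_ge0// sqr_ge0.
have i2 : 0 <= ep^-1 by rewrite invr_ge0 ltW.
have i3 : 0 <= 19 / (sg * ep) by apply: divr_ge0 => //; rewrite mulr_ge0 ?(ltW sg0) ?(ltW ep0).
have i4 : 0 <= 19 / (sg * ep) * (2 * K + 2) by rewrite mulr_ge0// addr_ge0// mulr_ge0.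
rewrite /estimate_const.
have FQ0 : 0 <= F + Q by rewrite addr_ge0.
(* If [P <= Q] the summand 1 of the constant suffices. Otherwise [Q <= P] bounds [k2] by a multiple
   of [P], every term of [main] has a factor [P], and one divides by it. *)
case: (lerP P Q) => [PQ|/ltW QP].
  apply: (le_trans PQ); apply: (@le_trans _ _ (1 * (F + Q))); first by rewrite mul1r lerDr.
  by apply: ler_wpM2r => //; move: i1 i2 i4; set a := 2 / _; set b := ep^-1; set c := _ * (_ + 2); lra.
have F2P : F <= 2 * P.
  apply: le_of_sqr; first by rewrite mulr_ge0.
  have [m [_ sf sp _]] := nat_bound4 0 (size f) (size p) 0.
  set N := m.+1 in sf sp.
  have N0' : 0 < N%:R :> R by rewrite ltr0n.
  rewrite exprMn FE PE -(ler_pM2l N0') mulrCA -(poly_parseval sf) -(poly_parseval sp) mulr_sumr.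
  apply: ler_sum => a _; rewrite hornerM hornerXsubC cmodM exprMn ler_wpM2r ?sqr_ge0//.
  rewrite ler_pXn2r ?nnegrE ?cmod_ge0//; apply: (le_trans (cmodB _ _)).
  by rewrite lam1 cmodX cmod_root1 expr1n.
have k2P : k2 <= (2 * K + 2) * P.
  apply: le_of_sqr; first by rewrite mulr_ge0// addr_ge0// mulr_ge0.
  apply: (le_trans k2_le).
  have : Q ^+ 2 <= P ^+ 2 by rewrite ler_pXn2r ?nnegrE.
  have := sqr_ge0 P; have := mulr_ge0 (sqr_ge0 K) (sqr_ge0 P).
  have := mulr_ge0 K0 (sqr_ge0 P); rewrite exprMn.
  by move: (P ^+ 2) (Q ^+ 2) => p2 q2 *; nra.
have [P_eq0|P_neq0] := eqVneq P 0.
  rewrite P_eq0 mulr_ge0// -addrA addr_ge0//; first by rewrite addr_ge0.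
  by rewrite addr_ge0.
have Ppos : 0 < P by rewrite lt_def P_neq0.
rewrite -(ler_pM2l Ppos) -expr2; apply: (le_trans main).
have t1 : F ^+ 2 / sg ^+ 2 <= 2 / sg ^+ 2 * (P * F).
  have : 0 <= (sg ^+ 2)^-1 by rewrite invr_ge0 sqr_ge0.
  move=> s0; rewrite (_ : 2 / sg ^+ 2 * (P * F) = 2 * P * F / sg ^+ 2); last by ring.
  by apply: ler_wpM2r => //; rewrite expr2; exact: ler_wpM2r.
have t3 : 19 / (sg * ep) * (F * k2) <= 19 / (sg * ep) * (2 * K + 2) * (P * F).
  rewrite -[leRHS]mulrA; apply: ler_wpM2l => //.
  by rewrite mulrA [leRHS]mulrC; apply: ler_wpM2l.
have PF : 0 <= P * F by rewrite mulr_ge0.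
have PQ : 0 <= P * Q by rewrite mulr_ge0.
move: t1 t3 (mulr_ge0 i1 PQ) (mulr_ge0 i2 PF) (mulr_ge0 i4 PQ).
set a := 2 / _; set b := ep^-1; set c := _ * (2 * K + 2).
rewrite (_ : P * ((a + b + c + 1) * (F + Q)) = a * (P * F) + a * (P * Q) + b * (P * F) +
  P * Q * b + c * (P * F) + c * (P * Q) + P * F + P * Q); last by ring.
by lra.
Qed.

End PolyEstimate.

(** * Boundedness below on the model space *)

Section PowerSeries.
Variable R : realType.
Notation C := (Cplx R).
Implicit Types (f g : taylor R) (z : R[i]).

(** Comparison with a geometric series; the explicit tail makes the approximation by partial sums
    uniform on smaller discs. *)
Lemma eval_bounded_cvg f (B : R) z : (forall n, cmod (f n) <= B) -> cmod z < 1 ->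
  (series (fun n => f n * z ^+ n : C) n) @[n --> \oo] --> eval f z /\
  forall D, cmod (eval f z - \sum_(i < D) f i * z ^+ i) <= B * cmod z ^+ D / (1 - cmod z).
Proof.
move=> fB z1; have z0 := cmod_ge0 z.
have B0 : 0 <= B := le_trans (cmod_ge0 _) (fB 0%N).
have z1' : 0 < 1 - cmod z by rewrite subr_gt0.
have part D m : cmod (\sum_(D <= i < D + m) f i * z ^+ i) <= B * cmod z ^+ D / (1 - cmod z).
  apply: (le_trans (cmod_sum _ _ _)).
  apply: (@le_trans _ _ (B * cmod z ^+ D * \sum_(i < m) cmod z ^+ i)).
    rewrite -{1}[D]add0n big_addn addKn big_mkord mulr_sumr; apply: ler_sum => i _.
    rewrite cmodM cmodX addnC exprD -mulrA; apply: ler_pM; rewrite ?cmod_ge0//.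
    by rewrite mulr_ge0 ?exprn_ge0.
  rewrite ler_wpM2l// ?mulr_ge0 ?exprn_ge0// -[leRHS]mul1r ler_pdivlMr// mulrC.
  by rewrite -opprB mulNr -subrX1 opprB gerBl exprn_ge0.
have cv : cvgn (series (fun n => f n * z ^+ n : C)).
  apply: cplx_cauchy_cvg => e e0.
  have : B * cmod z ^+ n / (1 - cmod z) @[n --> \oo] --> (0 : R).
    rewrite -[X in _ --> X](mul0r (1 - cmod z)^-1) -(mulr0 B).
    by apply: cvgM; [apply: cvgM; [exact: cvg_cst|apply: cvg_expr; rewrite ger0_norm]|exact: cvg_cst].
  move=> /cvgr0Pnorm_lt/(_ _ e0)[N _ HN]; exists N.
  have tail m n : (N <= m)%N -> (m <= n)%N ->
      cmod (series (fun n => f n * z ^+ n : C) n - series (fun n => f n * z ^+ n : C) m) < e.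
    move=> Nm mn; rewrite sub_series_geq// -(subnKC mn).
    by apply: (le_lt_trans (part _ _)); apply: le_lt_trans (HN m Nm); rewrite ler_norm.
  move=> m n Nm Nn; case: (leqP m n) => [mn|/ltnW nm]; last exact: tail.
  by rewrite cmodC; exact: tail.
split=> // D; have H : (fun n => series (fun n => f n * z ^+ n : C) (n + D)%N - \sum_(i < D) f i * z ^+ i : C)
    @ \oo --> (eval f z - \sum_(i < D) f i * z ^+ i : C).
  by apply: cvgB; [move: cv; rewrite /eval => cv; rewrite (cvg_shiftn D)|exact: cvg_cst].
apply: (cvg_le_bound (cvg_cmod H)) => n.
have -> : \sum_(i < D) f i * z ^+ i = series (fun n => f n * z ^+ n : C) D.
  by rewrite /series /= big_mkord.
by rewrite sub_series_geq ?leq_addl// addnC; exact: part.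
Qed.

Lemma eval_cvg f z : H2 f -> cmod z < 1 ->
  (series (fun n => f n * z ^+ n : C) n) @[n --> \oo] --> eval f z.
Proof. by move=> Hf z1; have [] := eval_bounded_cvg (fun n => coef_le n Hf) z1. Qed.

Lemma eval_tail f z D : H2 f -> cmod z < 1 ->
  cmod (eval f z - \sum_(i < D) f i * z ^+ i) <= l2norm f * cmod z ^+ D / (1 - cmod z).
Proof. by move=> Hf z1; have [_] := eval_bounded_cvg (fun n => coef_le n Hf) z1. Qed.

Definition trunc n f : taylor R := fun i => if (i < n)%N then f i else 0.

Lemma psq_trunc n f m : psq (trunc n f) m = psq f (minn n m).
Proof.
rewrite !psqE; elim: m => [|m IH]; first by rewrite minn0 !big_ord0.
rewrite big_ord_recr /= IH /trunc; case: ltnP => [mn|nm].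
  by rewrite (minn_idPr mn) big_ord_recr.
by rewrite (minn_idPl (leqW nm)) cmod0 expr0n addr0.
Qed.

Lemma trunc_H2 n f : H2 (trunc n f) /\ l2norm (trunc n f) = Num.sqrt (psq f n).
Proof.
apply: l2norm_unique; first exact: sqrtr_ge0.
rewrite sqr_sqrtr ?psq_ge0//; apply: cvg_near_cst; exists n => // m /= nm.
by rewrite psq_trunc (minn_idPl nm).
Qed.

Lemma psq_sub_trunc n f m : (n <= m)%N -> psq (f - trunc n f) m = psq f m - psq f n.
Proof.
elim: m => [|m IH]; first by rewrite leqn0 => /eqP ->; rewrite !psqE !big_ord0 subrr.
have S g : psq g m.+1 = psq g m + cmod (g m) ^+ 2 by rewrite !psqE big_ord_recr.
rewrite leq_eqVlt => /orP[/eqP nm|nm].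
  rewrite -nm subrr psqE big1// => i _.
  have -> : (f - trunc n f) i = 0 by rewrite [LHS](_ : _ = f i - trunc n f i)// /trunc ltn_ord subrr.
  by rewrite cmod0 expr0n.
rewrite !S IH// addrAC; congr (_ + cmod _ ^+ 2 - _).
by rewrite [LHS](_ : _ = f m - trunc n f m)// /trunc ltnNge -ltnS nm subr0.
Qed.

Lemma trunc_cvg f : H2 f -> l2norm (trunc n f - f) @[n --> \oo] --> (0 : R).
Proof.
move=> Hf; have E n : l2norm (trunc n f - f) = Num.sqrt (l2norm f ^+ 2 - psq f n).
  have Ht := (trunc_H2 n f).1; rewrite l2normBC//.
  apply: (l2norm_unique (sqrtr_ge0 _) _).2; rewrite sqr_sqrtr ?subr_ge0 ?psq_le//.
  have H : psq f m - psq f n @[m --> \oo] --> l2norm f ^+ 2 - psq f n.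
    by apply: cvgB; [exact: psq_cvg|exact: cvg_cst].
  apply: cvg_trans H; apply: near_eq_cvg; exists n => // m /= nm.
  by rewrite psq_sub_trunc.
have H : l2norm f ^+ 2 - psq f n @[n --> \oo] --> (0 : R).
  rewrite -(subrr (l2norm f ^+ 2)).
  by apply: cvgB; [exact: cvg_cst|exact: psq_cvg].
under eq_fun do rewrite E.
rewrite -(@sqrtr0 R); apply: continuous_cvg => //; exact: sqrt_continuous.
Qed.

Lemma l2dot_trunc n f g : l2dot (trunc n f) g = \sum_(i < n) f i * conjc (g i).
Proof.
apply: l2dot_unique; apply: cvg_near_cst; exists n => // m /= nm.
rewrite /series /= (big_cat_nat _ nm)//= [X in _ + X]big_nat_cond [X in _ + X]big1 ?addr0.
  by rewrite big_mkord; apply: eq_bigr => i _; rewrite /trunc ltn_ord.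
by move=> i /andP[/andP[ni _] _]; rewrite /trunc ltnNge ni mul0r.
Qed.

End PowerSeries.

(** * Orthonormal sequences: Bessel and Riesz-Fischer *)

Section Orthonormal.
Variable R : realType.
Notation C := (Cplx R).
Variable e : nat -> taylor R.
Hypothesis eH2 : forall m, H2 (e m).
Hypothesis eON : forall i j, l2dot (e i) (e j) = (i == j)%:R.

Fixpoint comb (c : nat -> C) n : taylor R :=
  if n is m.+1 then comb c m + (c m : R[i]) *: e m else 0.

Lemma comb_H2 c n : H2 (comb c n).
Proof.
elim: n => [|n IH] /=; first by case: (H2_0 R).
by apply: (H2D _ _).1 => //; exact: (H2Z _ _).1.
Qed.

Lemma comb_dot c n k : (n <= k)%N -> l2dot (comb c n) (e k) = 0.
Proof.
elim: n => [|n IH] nk /=; first by rewrite l2dot0l.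
rewrite l2dotDl ?l2dotZl//; [|exact: comb_H2|exact: (H2Z _ _).1].
by rewrite IH ?(ltnW nk)// eON ltn_eqF// mulr0 addr0.
Qed.

Lemma e_norm n : l2norm (e n) = 1.
Proof.
have := l2dot_norm (@eH2 n); rewrite eON eqxx => -[/esym/eqP].
by rewrite sqrf_eq1 => /orP[/eqP//|/eqP n1]; have := l2norm_ge0 (e n); rewrite n1 oppr_ge0 ler10.
Qed.

Lemma comb_norm c n : l2norm (comb c n) ^+ 2 = psq c n.
Proof.
elim: n => [|n IH] /=; first by rewrite (H2_0 R).2 expr0n psqE big_ord0.
have [HZ nZ] := H2Z (c n) (@eH2 n).
rewrite (l2normD_sq (@comb_H2 c n) HZ) l2dotZr//; last exact: comb_H2.
rewrite comb_dot// mulr0 mulr0 addr0 IH nZ !psqE big_ord_recr /=.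
by rewrite e_norm mulr1.
Qed.

Lemma comb_orth c u n : H2 u -> (forall m, c m = l2dot u (e m)) ->
  l2norm (u - comb c n) ^+ 2 = l2norm u ^+ 2 - psq c n.
Proof.
move=> Hu cE; elim: n => [|n IH] /=; first by rewrite !subr0 psqE big_ord0 subr0.
have [HZ nZ] := H2Z (c n) (@eH2 n).
have Hc := @comb_H2 c n; have Huc := (H2B Hu Hc).1.
rewrite opprD addrA (l2normD_sq Huc (H2N HZ).1) IH (H2N HZ).2 nZ.
rewrite l2dotNr// l2dotZr// l2dotBl// comb_dot// subr0 -cE e_norm mulr1.
have -> : complex.Re (- (conjc (c n) * c n)) = - cmod (c n) ^+ 2.
  by rewrite cmod_sqE; case: (c n) => x y /=; ring.
by rewrite !psqE big_ord_recr /=; ring.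
Qed.

Lemma bessel u n : H2 u -> psq (fun m => l2dot u (e m)) n <= l2norm u ^+ 2.
Proof.
move=> Hu; rewrite -subr_ge0 -(@comb_orth (fun m => l2dot u (e m)) u n Hu)//.
exact: sqr_ge0.
Qed.

Lemma combB c d n : comb c n - comb d n = comb (c - d) n.
Proof.
elim: n => [|n IH] /=; first by rewrite subr0.
by rewrite opprD addrACA IH -scalerBl.
Qed.

Lemma comb_trunc c n m : (n <= m)%N -> comb (trunc n c) m = comb c n.
Proof.
elim: m => [|m IH]; first by rewrite leqn0 => /eqP ->.
rewrite leq_eqVlt => /orP[/eqP ->|nm] /=; last first.
  by rewrite IH// /trunc ltnNge -ltnS nm scale0r addr0.
have -> : trunc m.+1 c m = c m by rewrite /trunc ltnSn.
congr (_ + _).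
have H k : (k <= m)%N -> comb (trunc m.+1 c) k = comb c k.
  by elim: k => [//|k IHk] km /=; rewrite IHk ?(ltnW km)// /trunc ltnS (ltnW km).
exact: H.
Qed.

(** The difference of two partial combinations is the combination of a section of [c], so its
    squared norm is a difference of partial square sums. *)
Lemma riesz_fischer c : H2 c -> exists F, [/\ H2 F,
  l2norm (comb c n - F) @[n --> \oo] --> (0 : R) & l2norm F = l2norm c].
Proof.
move=> Hc; have [F HF cF] : exists2 F, H2 F & l2norm (comb c n - F) @[n --> \oo] --> (0 : R).
  apply: l2_complete => [n|eps eps0]; first exact: comb_H2.
  have eps2 : 0 < eps ^+ 2 by rewrite exprn_gt0.
  have /cvgrPdist_lt/(_ _ eps2)[N _ HN] := psq_cvg Hc.
  exists N => m n; wlog nm : m n / (n <= m)%N.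
    move=> H Nm Nn; case: (leqP n m) => [nm|/ltnW mn]; first exact: H.
    by rewrite (l2normBC (@comb_H2 c m) (@comb_H2 c n)); exact: H.
  move=> Nm Nn; rewrite -(ltr_pXn2r (_ : (0 < 2)%N)) ?nnegrE ?l2norm_ge0 ?(ltW eps0)//.
  rewrite -(comb_trunc c nm) combB comb_norm psq_sub_trunc//.
  apply: le_lt_trans (HN n Nn); apply: le_trans (ler_norm _).
  by rewrite lerD2r psq_le.
exists F; split=> //.
have H1 := l2_cvg_norm (@comb_H2 c) HF cF.
have H2' : psq c n @[n --> \oo] --> l2norm F ^+ 2.
  under eq_fun do rewrite -comb_norm expr2.
  by rewrite expr2; exact: cvgM.
by have [_ ->] := l2norm_unique (l2norm_ge0 F) H2'.
Qed.

End Orthonormal.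

Lemma sum_nat_eq0 (V : nmodType) (a b : nat) (F : nat -> V) :
  (forall i, (a <= i)%N -> (i < b)%N -> F i = 0) -> \sum_(a <= i < b) F i = 0.
Proof. by move=> H; rewrite big_nat_cond big1// => i /andP[/andP[? ?] _]; exact: H. Qed.

(** * Dilations, truncations and their Toeplitz coefficients *)

Section Dilations.
Variable R : realType.
Notation C := (Cplx R).
Implicit Types (f g theta : taylor R).

Definition shiftn m f : taylor R := iter m (@Defs.shift R) f.

Lemma shiftnE m f i : shiftn m f i = if (m <= i)%N then f (i - m)%N else 0.
Proof.
rewrite /shiftn; elim: m i => [|m IH] [|i] //=.
Qed.

Lemma shiftn_H2 m f : H2 f -> H2 (shiftn m f).
Proof. by move=> Hf; elim: m => [|m IH] //; have [] := shift_H2 IH. Qed.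

Lemma cvg_sum_ord n (u : nat -> nat -> C) (l : nat -> C) :
  (forall i, u k i @[k --> \oo] --> l i) ->
  (\sum_(i < n) u k i : C) @[k --> \oo] --> (\sum_(i < n) l i : C).
Proof.
move=> H; elim: n => [|n IH].
  by under eq_fun do rewrite big_ord0; rewrite big_ord0; exact: cvg_cst.
have -> : (fun k => \sum_(i < n.+1) u k i : C) = (fun k => (\sum_(i < n) u k i : C) + u k n).
  by apply/funext => k; rewrite big_ord_recr.
by rewrite big_ord_recr /=; exact: (cvgD IH (H n)).
Qed.

(** The function [f(rz)]; for [r < 1] its Taylor polynomials converge uniformly on the closed
    disc. *)
Definition dilate (r : R) f : taylor R := fun i => f i * Complex r 0 ^+ i.

Definition tpoly n g : {poly R[i]} := \poly_(i < n) g i.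

Lemma tpolyE n g i : (tpoly n g)`_i = trunc n g i.
Proof. by rewrite coef_poly. Qed.

(** Only coefficients of [theta] below [n] meet those of [trunc n g], so the degree [D] needed for a
    good approximation of [theta] leaves no trace in the product. *)
Lemma toeplitz_tpoly n D g theta m : (n <= D)%N ->
  toeplitz (tpoly D theta) (tpoly n g) m = l2dot (trunc n g) (shiftn m theta).
Proof.
move=> nD; rewrite l2dot_trunc /toeplitz.
have -> : \sum_(j < size (tpoly n g)) (tpoly n g)`_(j + m) * conjc (tpoly D theta)`_j =
    \sum_(0 <= j < n) trunc n g (j + m)%N * conjc (theta j).
  have sn : (size (tpoly n g) <= n)%N by exact: size_poly.
  rewrite big_mkord (big_ord_widen n (fun j => (tpoly n g)`_(j + m) * conjc (tpoly D theta)`_j))//.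
  rewrite big_mkcond; apply: eq_bigr => j _ /=.
  case: ltnP => [_|le]; last by rewrite -tpolyE nth_default ?mul0r// (leq_trans le) ?leq_addr.
  by rewrite !tpolyE /trunc (leq_trans (ltn_ord j) nD).
rewrite -(big_mkord xpredT (fun i => g i * conjc (shiftn m theta i))).
case: (leqP m n) => [mn|nm]; last first.
  rewrite !sum_nat_eq0// => i _ i_n.
    by rewrite shiftnE ifF ?conjc0 ?mulr0//; lia.
  by rewrite /trunc ltnNge (leq_trans (ltnW nm)) ?leq_addl// mul0r.
rewrite (big_cat_nat _ (leq_subr m n))//= [X in _ + X]sum_nat_eq0 ?addr0; last first.
  by move=> j nj _; rewrite /trunc ltnNge (_ : (n <= j + m)%N) ?mul0r//; lia.
rewrite [RHS](big_cat_nat _ mn)//= [X in _ = X + _]sum_nat_eq0 ?add0r; last first.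
  by move=> i _ im; rewrite shiftnE ifF ?conjc0 ?mulr0//; lia.
rewrite -[X in _ = \sum_(X <= _ < _) _]add0n big_addn; apply: eq_big_nat => j /= jn.
by rewrite shiftnE leq_addl addnK /trunc ifT//; lia.
Qed.

Lemma psq_tpoly n g : pn2 (tpoly n g) = psq g n.
Proof.
rewrite (pn2_wide (size_poly n g)) psqE; apply: eq_bigr => j _.
by rewrite tpolyE /trunc ltn_ord.
Qed.

Lemma pn2_mul_Xsub n g (lam : R[i]) :
  pn2 (('X - lam%:P) * tpoly n g) = l2norm (shift (trunc n g) - lam *: trunc n g) ^+ 2.
Proof.
have cE i : (('X - lam%:P) * tpoly n g)`_i = (shift (trunc n g) - lam *: trunc n g) i.
  rewrite mulrBl coefB coefXM coefCM !tpolyE.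
  by case: i => [|i] /=; rewrite ?tpolyE.
set P := _ * _ in cE *; set f := _ - _ in cE *.
apply/esym; rewrite (l2norm_unique (sqrtr_ge0 (pn2 P)) _).2 ?sqr_sqrtr ?pn2_ge0//.
apply: cvg_near_cst; exists (size P) => // m /= sm.
by rewrite (pn2_wide sm) psqE; apply: eq_bigr => j _; rewrite cE.
Qed.

End Dilations.

Lemma estimate_const_ge0 (R : realType) (ep sg K : R) : 0 < ep -> 0 < sg -> 0 <= K ->
  0 <= estimate_const ep sg K.
Proof.
move=> ep0 sg0 K0; rewrite /estimate_const; apply: addr_ge0 => //; apply: addr_ge0.
  by apply: addr_ge0; [rewrite divr_ge0// sqr_ge0|rewrite invr_ge0 ltW].
apply: mulr_ge0; last by rewrite addr_ge0// mulr_ge0.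
by apply: divr_ge0 => //; rewrite mulr_ge0 ?(ltW ep0) ?(ltW sg0).
Qed.

Section ModelBound.
Variable R : realType.
Notation C := (Cplx R).
Variable theta : taylor R.
Hypothesis Htheta : H2 theta.
Variables (K ep rho : R) (lam : R[i]).
Hypotheses (lam1 : cmod lam = 1) (ep0 : 0 < ep) (rho0 : 0 < rho).
Hypothesis theta_le : forall z, disc z -> cmod (eval theta z) <= K.
Hypothesis theta_ge : forall z, disc z -> cmod (z - lam) < rho -> ep <= cmod (eval theta z).

Lemma dilate_approx (r d : R) n : 0 <= r < 1 -> 0 < d -> exists D, (n <= D)%N /\
  forall z : R[i], cmod z <= 1 ->
    cmod ((tpoly D (dilate r theta)).[z] - eval theta (Complex r 0 * z)) <= d.
Proof.
move=> /andP[r0 r1] d0.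
have : l2norm theta * r ^+ D / (1 - r) @[D --> \oo] --> (0 : R).
  rewrite -[X in _ --> X](mul0r (1 - r)^-1) -(mulr0 (l2norm theta)).
  by apply: cvgM; [apply: cvgM; [exact: cvg_cst|apply: cvg_expr; rewrite ger0_norm]|exact: cvg_cst].
move=> /cvgr0Pnorm_lt/(_ _ d0)[N _ HN].
exists (N + n)%N; split; first exact: leq_addl.
move=> z z1; have rz : cmod (Complex r 0 * z) <= r.
  by rewrite cmodM cmod_real ger0_norm// ler_piMr.
have rz1 : cmod (Complex r 0 * z) < 1 := le_lt_trans rz r1.
rewrite cmodC horner_poly.
have -> : \sum_(i < N + n) dilate r theta i * z ^+ i =
    \sum_(i < N + n) theta i * (Complex r 0 * z) ^+ i.
  by apply: eq_bigr => i _; rewrite /dilate exprMn mulrA.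
apply: (le_trans (eval_tail _ Htheta rz1)).
apply: le_trans (ltW (HN (N + n)%N (leq_addr _ _))); apply: le_trans (ler_norm _).
rewrite -!mulrA ler_wpM2l ?l2norm_ge0//; apply: ler_pM.
- by rewrite exprn_ge0 ?cmod_ge0.
- by rewrite invr_ge0 subr_ge0 ltW.
- by rewrite lerXn2r ?nnegrE ?cmod_ge0.
- by rewrite lef_pV2 ?posrE ?subr_gt0// lerD2l lerN2.
Qed.

(** Points within [4 sg <= rho / 2] of [lam] stay within [rho] of it after a dilation with
    [1 - r < rho / 2]. The [ep / 2] and [K + 1] in the constant leave room for replacing the dilated
    [theta] by a polynomial. *)
Let sg := Num.min 1 (rho / 8).
Let Cst := estimate_const (ep / 2) sg (K + 1).

Lemma sg_gt0 : 0 < sg.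
Proof. by rewrite /sg lt_min ltr01 divr_gt0. Qed.

Lemma K_ge0 : 0 <= K.
Proof.
apply: le_trans (cmod_ge0 (eval theta 0)) (theta_le _).
by rewrite /disc /= expr0n /= addr0 sqrtr0.
Qed.

Lemma estimate_dilate (r : R) g n : 0 <= r < 1 -> 1 - r < rho / 2 ->
  Num.sqrt (psq g n) <= Cst * (l2norm (shift (trunc n g) - lam *: trunc n g) +
    Num.sqrt (psq (fun m => l2dot (trunc n g) (shiftn m (dilate r theta))) n)).
Proof.
move=> r01 rrho; have [r0 r1] := andP r01.
have d0 : 0 < Num.min 1 (ep / 2) by rewrite lt_min ltr01 divr_gt0.
have [D [nD HD]] := dilate_approx n r01 d0.
set Theta := tpoly D (dilate r theta) in HD.
have rz_disc (z : R[i]) : cmod z <= 1 -> disc (Complex r 0 * z : C).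
  by move=> z1; rewrite /disc /= [X in X < _]cmodM cmod_real ger0_norm//;
    apply: le_lt_trans r1; rewrite ler_piMr.
have Theta_ge (z : R[i]) : cmod z <= 1 -> cmod (z - lam) < 4 * sg -> ep / 2 <= cmod Theta.[z].
  move=> z1 zl; have := HD z z1; rewrite le_min => /andP[_ H].
  have dz : cmod (Complex r 0 * z - z) <= 1 - r.
    rewrite -[X in _ - X]mul1r -mulrBl cmodM (_ : Complex r 0 - 1 = - Complex (1 - r) 0).
      by rewrite cmodN cmod_real ger0_norm ?subr_ge0 ?(ltW r1)// ler_piMr// subr_ge0 ltW.
    by apply/eqP; rewrite eq_complex /=; apply/andP; split; apply/eqP; ring.
  have near : cmod (Complex r 0 * z - lam) < rho.
    have := cmodD (Complex r 0 * z - z) (z - lam).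
    rewrite addrA subrK => tri; apply: (le_lt_trans tri).
    have : sg <= rho / 8 by rewrite /sg ge_min lexx orbT.
    by move: zl dz rrho; set x := cmod _; set y := cmod _; lra.
  have := theta_ge (rz_disc z z1) near.
  have := cmod_triB (eval theta (Complex r 0 * z)) Theta.[z]; rewrite cmodC.
  by move: H; set x := cmod _; set y := cmod _; set w := cmod _; lra.
have Theta_le (z : R[i]) : cmod z = 1 -> cmod Theta.[z] <= K + 1.
  move=> z1; have z1' : cmod z <= 1 by rewrite z1.
  have := HD z z1'; rewrite le_min => /andP[H _].
  have := theta_le (rz_disc z z1').
  have := cmod_triB Theta.[z] (eval theta (Complex r 0 * z)).
  by move: H; set x := cmod _; set y := cmod _; set w := cmod _; lra.
have ep2 : 0 < ep / 2 by rewrite divr_gt0.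
have sg1 : sg <= 1 by rewrite /sg ge_min lexx.
have K1 : 0 <= K + 1 by rewrite addr_ge0 ?K_ge0.
have := poly_estimate lam1 ep2 sg_gt0 sg1 K1 (tpoly n g) Theta_ge Theta_le.
rewrite psq_tpoly pn2_mul_Xsub sqrtr_sqr ger0_norm ?l2norm_ge0//.
move=> H; apply: (le_trans H); apply: ler_wpM2l.
  by apply: estimate_const_ge0 => //; exact: sg_gt0.
rewrite lerD2l; apply: ler_wsqrtr.
rewrite psqE (big_ord_widen n (fun m => cmod (toeplitz Theta (tpoly n g) m) ^+ 2)) ?size_poly//.
rewrite big_mkcond; apply: ler_sum => m _; case: ifP => _; last exact: sqr_ge0.
by rewrite toeplitz_tpoly.
Qed.

Lemma cvg_exprC (u : nat -> C) (l : C) n : u k @[k --> \oo] --> l ->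
  (u k ^+ n : C) @[k --> \oo] --> (l ^+ n : C).
Proof.
move=> H; elim: n => [|n IH].
  by under eq_fun do rewrite expr0; rewrite expr0; exact: cvg_cst.
have -> : (fun k => u k ^+ n.+1 : C) = (fun k => u k * (u k ^+ n : C)).
  by apply/funext => k; rewrite exprS.
by rewrite exprS; exact: (cvgM H IH).
Qed.

(** The constant is independent of [r], and for fixed [n] the right-hand side involves finitely many
    coefficients of [theta], so [r] may tend to 1. *)
Lemma estimate_trunc g n :
  Num.sqrt (psq g n) <= Cst * (l2norm (shift (trunc n g) - lam *: trunc n g) +
    Num.sqrt (psq (fun m => l2dot (trunc n g) (shiftn m theta)) n)).
Proof.
have rho2 : 0 < rho / 2 by rewrite divr_gt0.
have [N HN] := inv_nat_small rho2.
(* The offset [N] ensures [1 - r k < rho / 2] for every [k]. *)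
pose r k : R := 1 - (k + N).+1%:R^-1.
have r01 k : 0 <= r k < 1.
  by rewrite /r subr_ge0 invf_le1 ?ltr0n// ler1n /= gtrBl invr_gt0 ltr0n.
have rr k : 1 - r k < rho / 2.
  by rewrite /r opprB addrC subrK; apply: HN; exact: leq_addl.
have rcv : (Complex (r k) 0 : C) @[k --> \oo] --> (1 : C).
  apply/cvg_cmodP => e e0; have [N' HN'] := inv_nat_small e0.
  exists N' => // k /= N'k.
  suff : cmod (Complex (r k) 0 - 1 : R[i]) < e by [].
  have -> : Complex (r k) 0 - 1 = Complex (- (k + N).+1%:R^-1) 0 :> R[i].
    by apply/eqP; rewrite eq_complex /r /=; apply/andP; split; apply/eqP; ring.
  rewrite cmod_real normrN ger0_norm ?invr_ge0//; apply: HN'.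
  exact: leq_trans (leq_addr _ _).
have dcv i : (dilate (r k) theta i : C) @[k --> \oo] --> (theta i : C).
  rewrite /dilate -[X in _ --> X]mulr1 -(expr1n C i).
  by apply: cvgM; [exact: cvg_cst|exact: cvg_exprC].
have scv m i : (shiftn m (dilate (r k) theta) i : C) @[k --> \oo] --> (shiftn m theta i : C).
  under eq_fun do rewrite shiftnE; rewrite shiftnE.
  by case: leqP => _; [exact: dcv|exact: cvg_cst].
have qcv m : (l2dot (trunc n g) (shiftn m (dilate (r k) theta)) : C) @[k --> \oo] -->
    (l2dot (trunc n g) (shiftn m theta) : C).
  under eq_fun do rewrite l2dot_trunc; rewrite l2dot_trunc.
  apply: (@cvg_sum_ord R n (fun k i => g i * conjc (shiftn m (dilate (r k) theta) i))
    (fun i => g i * conjc (shiftn m theta i))) => i.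
  exact: (cvgM (cvg_cst (g i : C)) (cvg_conjc (scv m i))).
have H : Cst * (l2norm (shift (trunc n g) - lam *: trunc n g) +
    Num.sqrt (psq (fun m => l2dot (trunc n g) (shiftn m (dilate (r k) theta))) n))
    @[k --> \oo] --> Cst * (l2norm (shift (trunc n g) - lam *: trunc n g) +
    Num.sqrt (psq (fun m => l2dot (trunc n g) (shiftn m theta)) n)).
  apply: cvgM; first exact: cvg_cst.
  apply: cvgD; first exact: cvg_cst.
  apply: continuous_cvg; first exact: sqrt_continuous.
  exact: psq_cvg_coef.
rewrite -(cvg_lim _ H)//; apply: limr_ge; first by apply/cvg_ex; eexists; exact: H.
by apply: nearW => k; exact: estimate_dilate.
Qed.

Hypothesis orth : forall i j, l2dot (shiftn i theta) (shiftn j theta) = (i == j)%:R.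

Lemma shift_sub_bound f : H2 f -> H2 (shift f - lam *: f) /\
  l2norm (shift f - lam *: f) <= (1 + cmod lam) * l2norm f.
Proof.
move=> Hf; have [Hs ns] := shift_H2 Hf; have [Hz nz] := H2Z lam Hf.
have [Hb nb] := H2B Hs Hz; split=> //; apply: (le_trans nb).
by rewrite ns nz mulrDl mul1r.
Qed.

Lemma shift_sub_D f1 f2 : shift (f1 + f2) - lam *: (f1 + f2) =
  (shift f1 - lam *: f1) + (shift f2 - lam *: f2).
Proof. by rewrite shiftD scalerDr opprD addrACA. Qed.

Lemma bounded_below_model g : H2 g -> (forall m, l2dot g (shiftn m theta) = 0) ->
  l2norm g <= Cst * l2norm (shift g - lam *: g).
Proof.
move=> Hg g0; set f := shift g - _.
have [Hf _] := shift_sub_bound Hg.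
have C0 : 0 <= Cst.
  apply: estimate_const_ge0; [by rewrite divr_gt0|exact: sg_gt0|by rewrite addr_ge0 ?K_ge0].
(* Truncation error: 2 from applying [z - lam] with [|lam| = 1], 1 from the pairings with
   [z^m theta] (Bessel, as they vanish on [g]), both times [Cst], and 1 from the triangle
   inequality. *)
have step n : l2norm g <= Cst * l2norm f + (3 * Cst + 1) * l2norm (trunc n g - g).
  have [Ht nt] := trunc_H2 n g; have Hd := (H2B Ht Hg).1.
  have b1 : l2norm (shift (trunc n g) - lam *: trunc n g) <= l2norm f + 2 * l2norm (trunc n g - g).
    have -> : shift (trunc n g) - lam *: trunc n g = f + (shift (trunc n g - g) - lam *: (trunc n g - g)).
      by rewrite -shift_sub_D [g + _]addrC subrK.
    have [Hs' ns'] := shift_sub_bound Hd.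
    rewrite lam1 -[1 + 1]/(2 : R) in ns'.
    by apply: (le_trans (H2D Hf Hs').2); rewrite lerD2l.
  have b2 : Num.sqrt (psq (fun m => l2dot (trunc n g) (shiftn m theta)) n) <= l2norm (trunc n g - g).
    apply: le_of_sqr; first exact: l2norm_ge0.
    rewrite sqr_sqrtr ?psq_ge0//.
    have -> : (fun m => l2dot (trunc n g) (shiftn m theta)) =
        (fun m => l2dot (trunc n g - g) (shiftn m theta)).
      by apply/funext => m; rewrite l2dotBl ?g0 ?subr0//; exact: shiftn_H2.
    by apply: bessel => //; move=> m; exact: shiftn_H2.
  have := estimate_trunc g n; rewrite -nt => H.
  have := H2D Ht (H2N Hd).1; rewrite (H2N Hd).2 opprB addrC subrK => -[_ tri].
  apply: (le_trans tri); apply: (le_trans (lerD (le_trans H (ler_wpM2l C0 (lerD b1 b2))) (lexx _))).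
  by rewrite le_eqVlt; apply/orP; left; apply/eqP; ring.
have cv : Cst * l2norm f + (3 * Cst + 1) * l2norm (trunc n g - g) @[n --> \oo] -->
    Cst * l2norm f + (3 * Cst + 1) * 0.
  by apply: cvgD; [exact: cvg_cst|apply: cvgM; [exact: cvg_cst|exact: trunc_cvg]].
rewrite -[leRHS]addr0 -[X in _ + X](mulr0 (3 * Cst + 1)) -(cvg_lim _ cv)//.
apply: limr_ge; first by apply/cvg_ex; eexists; exact: cv.
by apply: nearW => n; exact: step.
Qed.

End ModelBound.

(** * The shifts of an inner function are orthonormal *)

Lemma conjcM (R : realType) (z w : R[i]) : conjc (z * w) = conjc z * conjc w.
Proof. exact: rmorphM. Qed.

Lemma Re_sum_ord (R : realType) n (F : nat -> R[i]) :
  complex.Re (\sum_(i < n) F i) = \sum_(i < n) complex.Re (F i).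
Proof. by rewrite -(big_mkord xpredT F) Re_sum big_mkord. Qed.

(** * Parseval for trigonometric polynomials *)

Section MeanZero.
Variable R : realType.
Notation C := (Cplx R).
Notation mu := (@lebesgue_measure R).

(** Mean zero over a period, expressed by a primitive with equal values at both ends: sums are then
    handled by differentiation, and the integral appears only once. *)
Definition mean0 (f : R -> R) := continuous f /\
  exists G : R -> R, (forall t : R, is_derive t 1 G (f t)) /\ G (2 * pi) = G 0.

Lemma mean0_0 : mean0 (fun=> 0).
Proof.
split; first by move=> x; exact: cvg_cst.
by exists (cst 0); split => // t; exact: is_derive_cst.
Qed.

Lemma mean0D f g : mean0 f -> mean0 g -> mean0 (fun t => f t + g t).
Proof.
move=> [cf [F [dF pF]]] [cg [G [dG pG]]]; split.
  by move=> x; exact: (cvgD (cf x) (cg x)).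
exists (F + G); split; last by rewrite /GRing.add /= pF pG.
by move=> t; exact: is_deriveD.
Qed.

Lemma mean0_sum n (f : nat -> R -> R) : (forall i, (i < n)%N -> mean0 (f i)) ->
  mean0 (fun t => \sum_(i < n) f i t).
Proof.
elim: n => [|n IH] H.
  by under eq_fun do rewrite big_ord0; exact: mean0_0.
under eq_fun do rewrite big_ord_recr /=.
by apply: mean0D; [apply: IH => i /ltnW|]; exact: H.
Qed.

Lemma mean0_cos_sin (a b : R) d : (0 < d)%N ->
  mean0 (fun t => a * cos (d%:R * t) + b * sin (d%:R * t)).
Proof.
move=> d0; have d0' : d%:R != 0 :> R by rewrite pnatr_eq0 -lt0n.
have dlin (t : R) : is_derive t 1 (fun s : R => d%:R * s) d%:R.
  have -> : (fun s : R => d%:R * s) = (d%:R *: id) by [].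
  by apply: is_derive_eq; rewrite [LHS]mulr1.
have dsin (t : R) : is_derive t 1 (fun s : R => sin (d%:R * s)) (cos (d%:R * t) * d%:R).
  exact: (is_derive1_comp _ (dlin t)).
have dcos (t : R) : is_derive t 1 (fun s : R => cos (d%:R * s)) (- sin (d%:R * t) * d%:R).
  exact: (is_derive1_comp _ (dlin t)).
have csin : continuous (fun s : R => sin (d%:R * s)).
  by move=> t; apply: differentiable_continuous; apply/derivable1_diffP; case: (dsin t).
have ccos : continuous (fun s : R => cos (d%:R * s)).
  by move=> t; apply: differentiable_continuous; apply/derivable1_diffP; case: (dcos t).
split.
  move=> t; apply: cvgD; apply: cvgM; [exact: cvg_cst|exact: ccos|exact: cvg_cst|exact: csin].
exists ((a / d%:R) *: (fun s : R => sin (d%:R * s)) + (- b / d%:R) *: (fun s : R => cos (d%:R * s))).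
split.
  move=> t; apply: is_derive_eq; rewrite /GRing.scale /=.
  by field.
have e1 : expi (d%:R * (2 * pi)) = 1 :> R[i].
  rewrite mulr_natl -expiX (_ : expi (2 * pi) = 1) ?expr1n//.
  by rewrite /expi mulr_natl cos2pi sin2pi.
case: e1 => ce se.
rewrite /GRing.add /GRing.scale /= ce se mulr0 cos0 sin0.
by [].
Qed.

Definition csum (c : taylor R) m (t : R) : R[i] := \sum_(n < m) c n * expi t ^+ n.

(** What remains after removing the diagonal are cross terms of nonzero frequency [m - n]. *)
Lemma mean0_csum c m : mean0 (fun t => cmod (csum c m t) ^+ 2 - psq c m).
Proof.
elim: m => [|m IH].
  rewrite (_ : (fun t => _) = fun=> 0); first exact: mean0_0.
  by apply/funext => t; rewrite /csum psqE !big_ord0 cmod0 expr0n subrr.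
pose term n t : R := 2 * complex.Re (c n * expi t ^+ n * conjc (c m * expi t ^+ m)).
have H : mean0 (fun t => (cmod (csum c m t) ^+ 2 - psq c m) + \sum_(n < m) term n t).
  apply: mean0D => //; apply: mean0_sum => n nm.
  pose z := c n * conjc (c m).
  rewrite (_ : term n = fun t => (2 * complex.Re z) * cos ((m - n)%:R * t) +
      (2 * complex.Im z) * sin ((m - n)%:R * t)).
    by apply: mean0_cos_sin; rewrite subn_gt0.
  apply/funext => t; rewrite /term.
  have -> : c n * expi t ^+ n * conjc (c m * expi t ^+ m) = z * conjc (expi ((m - n)%:R * t)).
    rewrite conjcM mulrACA; congr (_ * _).
    have -> : expi ((m - n)%:R * t) = expi t ^+ (m - n) :> R[i].
      by rewrite expiX mulr_natl.
    rewrite -{1}(subnK (ltnW nm)) exprD conjcM mulrCA.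
    by rewrite mul_conjc cmodX cmod_expi !expr1n mulr1.
  by rewrite RecM /=; ring.
congr mean0 : H; apply/funext => t.
have -> : csum c m.+1 t = csum c m t + c m * expi t ^+ m by rewrite /csum big_ord_recr.
have -> : psq c m.+1 = psq c m + cmod (c m) ^+ 2 by rewrite !psqE big_ord_recr.
rewrite cmodD_sq cmodM cmodX cmod_expi expr1n mulr1 /term -mulr_sumr.
rewrite [X in 2 * complex.Re (X * _)]/csum mulr_suml.
have -> : complex.Re (\sum_(i < m) c i * expi t ^+ i * conjc (c m * expi t ^+ m)) =
    \sum_(i < m) complex.Re (c i * expi t ^+ i * conjc (c m * expi t ^+ m)).
  exact: (Re_sum_ord m (fun i => c i * expi t ^+ i * conjc (c m * expi t ^+ m))).
by ring.
Qed.

Lemma integral_csum c m :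
  (\int[mu]_(t in `[0%R, (2 * pi)%R]) (cmod (csum c m t) ^+ 2)%:E = (2 * pi * psq c m)%:E)%E.
Proof.
have [cf [G [dG pG]]] := mean0_csum c m.
have pi2 : 0 < 2 * pi :> R by rewrite mulr_gt0// pi_gt0.
pose F : R -> R := G + psq c m *: id.
have dF (t : R) : is_derive t 1 F (cmod (csum c m t) ^+ 2).
  by apply: is_derive_eq; rewrite [psq c m *: 1]mulr1 subrK.
have cF : continuous F.
  by move=> t; apply: differentiable_continuous; apply/derivable1_diffP; case: (dF t).
rewrite (@continuous_FTC2 _ _ F)//.
- have F0 : F 0 = G 0 by rewrite [LHS](_ : _ = G 0 + psq c m * 0)// mulr0 addr0.
  have F2 : F (2 * pi) = G 0 + psq c m * (2 * pi) by rewrite -pG.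
  by rewrite F0 F2 -EFinB addrAC subrr add0r mulrC.
- apply: continuous_subspaceT => t.
  have -> : (fun t => cmod (csum c m t) ^+ 2) = (fun t => (cmod (csum c m t) ^+ 2 - psq c m) + psq c m).
    by apply/funext => s; rewrite subrK.
  by exact: (cvgD (cf t) (cvg_cst _)).
- split; first by move=> t _; case: (dF t).
  + by apply: cvg_at_right_filter; exact: cF.
  + by apply: cvg_at_left_filter; exact: cF.
- by move=> t _; rewrite derive1E; case: (dF t).
Qed.

End MeanZero.

(** * Quadratic means over circles of radius less than 1 *)

Section CircleIntegral.
Variable R : realType.
Notation C := (Cplx R).
Notation mu := (@lebesgue_measure R).
Let D : set R := `[0, (2 * pi)]%classic.

Let mD : measurable (D : set (measurableTypeR R)).
Proof. exact: measurable_itv. Qed.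

Lemma bounded_convergence (f_ : nat -> R -> R) (f : R -> R) (B : R) :
  (forall n, measurable_fun D (f_ n)) -> measurable_fun D f ->
  {ae mu, forall t, f_ n t @[n --> \oo] --> f t} ->
  (forall n t, `|f_ n t| <= B) ->
  (\int[mu]_(t in D) (f_ n t)%:E)%E @[n --> \oo] --> (\int[mu]_(t in D) (f t)%:E)%E.
Proof.
move=> mf_ mf cf bf.
have m1 n : measurable_fun D (EFin \o f_ n).
  exact/measurable_EFinP.
have m2 : measurable_fun D (EFin \o f) by exact/measurable_EFinP.
have c1 : {ae mu, forall t, D t -> (EFin \o f_ n) t @[n --> \oo] --> (EFin \o f) t}.
  apply: (@filterS _ _ (ae_filter_ringOfSetsType mu)) cf => t ct _.
  by apply: cvg_EFin; [exact: nearW|exact: ct].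
have ib : mu.-integrable D (EFin \o cst B).
  have := @continuous_compact_integrable R (cst B) D (@segment_compact R _ _).
  by apply; apply: continuous_subspaceT => x; exact: cvg_cst.
have b1 : {ae mu, forall t n, D t -> (`|(EFin \o f_ n) t| <= (EFin \o cst B) t)%E}.
  by apply: aeW => t n _; rewrite /= lee_fin.
by have [_ _] := dominated_convergence mD m1 m2 c1 ib b1.
Qed.

Lemma csum_continuous (c : taylor R) m : continuous (fun t => cmod (csum c m t) ^+ 2).
Proof.
have [cf _] := mean0_csum c m => t.
have -> : (fun t => cmod (csum c m t) ^+ 2) = (fun t => (cmod (csum c m t) ^+ 2 - psq c m) + psq c m).
  by apply/funext => s; rewrite subrK.
exact: (cvgD (cf t) (cvg_cst _)).
Qed.

Lemma csum_measurable (c : taylor R) m :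
  measurable_fun D (fun t => cmod (csum c m t) ^+ 2).
Proof.
apply: measurable_funTS.
by apply: continuous_measurable_fun; exact: csum_continuous.
Qed.

Section Dilate.
Variables (f : taylor R) (r : R).
Hypotheses (Hf : H2 f) (r01 : 0 <= r < 1).

Let rexpi (t : R) : cmod (Complex r 0 * expi t) = r.
Proof. by rewrite cmodM cmod_real cmod_expi mulr1 ger0_norm//; case/andP: r01. Qed.

Let r1 : r < 1. Proof. by case/andP: r01. Qed.

Lemma dilate_H2 : H2 (dilate r f) /\ l2norm (dilate r f) <= l2norm f.
Proof.
apply: H2_bounded => [|n]; first exact: l2norm_ge0.
apply: le_trans (psq_le n Hf); rewrite !psqE; apply: ler_sum => i _.
rewrite ler_pXn2r ?nnegrE ?cmod_ge0// /dilate cmodM cmodX cmod_real.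
have /andP[r0 _] := r01; rewrite ger0_norm// ler_piMr ?cmod_ge0//.
by rewrite exprn_ile1// ltW.
Qed.

Lemma csum_dilate m t : csum (dilate r f) m t = \sum_(i < m) f i * (Complex r 0 * expi t) ^+ i.
Proof. by apply: eq_bigr => i _; rewrite /dilate exprMn mulrA. Qed.

Let B := l2norm f / (1 - r).

Lemma eval_circle_le t : cmod (eval f (Complex r 0 * expi t)) <= B.
Proof.
have z1 : cmod (Complex r 0 * expi t) < 1 by rewrite rexpi.
have := eval_tail 0 Hf z1; rewrite big_ord0 expr0 mulr1 rexpi.
by rewrite subr0.
Qed.

Lemma csum_le m t : cmod (csum (dilate r f) m t) <= 2 * B.
Proof.
have z1 : cmod (Complex r 0 * expi t) < 1 by rewrite rexpi.
have := eval_tail m Hf z1; rewrite -csum_dilate rexpi.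
have := cmod_triB (csum (dilate r f) m t) (eval f (Complex r 0 * expi t)).
have := eval_circle_le t; rewrite cmodC.
have : l2norm f * r ^+ m / (1 - r) <= B.
  rewrite /B ler_wpM2r ?invr_ge0 ?subr_ge0 ?(ltW r1)// ler_piMr ?l2norm_ge0//.
  by case/andP: r01 => r0 _; rewrite exprn_ile1// ltW.
by set x := cmod _; set y := cmod _; set w := cmod _; lra.
Qed.

Lemma csum_cvg t : cmod (csum (dilate r f) m t) ^+ 2 @[m --> \oo] -->
  cmod (eval f (Complex r 0 * expi t)) ^+ 2.
Proof.
have z1 : cmod (Complex r 0 * expi t) < 1 by rewrite rexpi.
have H : cmod (csum (dilate r f) m t) @[m --> \oo] --> cmod (eval f (Complex r 0 * expi t)).
  suff -> : (fun m => cmod (csum (dilate r f) m t)) =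
      (fun m => cmod (series (fun n => f n * (Complex r 0 * expi t) ^+ n : C) m)).
    exact: cvg_cmod (eval_cvg Hf z1).
  by apply/funext => m; rewrite csum_dilate /series /= big_mkord.
by under eq_fun do rewrite expr2; rewrite expr2; exact: (cvgM H H).
Qed.

Lemma eval_measurable : measurable_fun D
  (fun t => cmod (eval f (Complex r 0 * expi t)) ^+ 2).
Proof.
apply/measurable_EFinP; apply: (@emeasurable_fun_cvg _ (measurableTypeR R) R D
  (fun m t => (cmod (csum (dilate r f) m t) ^+ 2)%:E)) => [m|t _].
  by apply/measurable_EFinP; exact: csum_measurable.
by apply: cvg_EFin; [exact: nearW|exact: csum_cvg].
Qed.

(** The partial sums of the dilated series converge boundedly on the circle, and for them the
    identity is [integral_csum]. *)
Lemma integral_eval :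
  (\int[mu]_(t in D) (cmod (eval f (Complex r 0 * expi t)) ^+ 2)%:E =
   (2 * pi * l2norm (dilate r f) ^+ 2)%:E)%E.
Proof.
have H1 := @bounded_convergence (fun m t => cmod (csum (dilate r f) m t) ^+ 2)
  (fun t => cmod (eval f (Complex r 0 * expi t)) ^+ 2) ((2 * B) ^+ 2)
  (csum_measurable _) eval_measurable.
have ae_cvg : {ae mu, forall t, cmod (csum (dilate r f) m t) ^+ 2 @[m --> \oo] -->
    cmod (eval f (Complex r 0 * expi t)) ^+ 2} by apply: aeW => t; exact: csum_cvg.
have {}H1 := H1 ae_cvg.
have bnd n t : `|cmod (csum (dilate r f) n t) ^+ 2| <= (2 * B) ^+ 2.
  rewrite ger0_norm ?sqr_ge0// ler_pXn2r ?nnegrE ?cmod_ge0 ?csum_le//.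
  exact: le_trans (cmod_ge0 _) (csum_le 0 t).
have {}H1 := H1 bnd.
have H2' : (\int[mu]_(t in D) (cmod (csum (dilate r f) m t) ^+ 2)%:E)%E @[m --> \oo] -->
    (2 * pi * l2norm (dilate r f) ^+ 2)%:E.
  under eq_fun do rewrite integral_csum.
  apply: cvg_EFin; first exact: nearW.
  apply: cvgM; first exact: cvg_cst.
  by apply: psq_cvg; case: dilate_H2.
exact: (cvg_unique _ H1 H2').
Qed.

End Dilate.
End CircleIntegral.

Lemma cvg_sqr (R : realType) (u : nat -> R) (l : R) :
  u n @[n --> \oo] --> l -> u n ^+ 2 @[n --> \oo] --> l ^+ 2.
Proof. by move=> ul; rewrite expr2; under eq_fun do rewrite expr2; exact: cvgM. Qed.

Section InnerShifts.
Variable R : realType.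
Notation C := (Cplx R).
Notation mu := (@lebesgue_measure R).

Lemma eval_unique (f : taylor R) (z : C) (l : C) :
  (series (fun n => f n * z ^+ n : C) n) @[n --> \oo] --> l -> eval f z = l.
Proof. by move=> H; rewrite /Defs.eval; exact: cvg_lim. Qed.

Lemma eval_shift (f : taylor R) (z : R[i]) : H2 f -> cmod z < 1 ->
  eval (shift f) z = z * eval f z.
Proof.
move=> Hf z1; apply: eval_unique; rewrite -cvg_shiftS.
have -> : (fun n => series (fun n => shift f n * z ^+ n : C) n.+1) =
    (fun n => (z : C) * series (fun n => f n * z ^+ n : C) n).
  apply/funext => n; rewrite /series /= big_nat_recl//= mul0r add0r mulr_sumr.
  by apply: eq_bigr => i _; rewrite exprS mulrCA.
exact: (cvgM (cvg_cst (z : C)) (eval_cvg Hf z1)).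
Qed.

Lemma eval_shiftn k (f : taylor R) (z : R[i]) : H2 f -> cmod z < 1 ->
  eval (shiftn k f) z = z ^+ k * eval f z.
Proof.
move=> Hf z1; elim: k => [|k IH]; first by rewrite expr0 mul1r.
rewrite [LHS](_ : _ = eval (shift (shiftn k f)) z)// eval_shift//; last exact: shiftn_H2.
by rewrite IH exprS mulrA.
Qed.

Lemma eval_addZ (f g : taylor R) (a z : R[i]) : H2 f -> H2 g -> cmod z < 1 ->
  eval (f + a *: g) z = eval f z + a * eval g z.
Proof.
move=> Hf Hg z1; apply: eval_unique.
have -> : (fun n => series (fun n => (f + a *: g) n * z ^+ n : C) n) =
    (fun n => series (fun n => f n * z ^+ n : C) n + (a : C) * series (fun n => g n * z ^+ n : C) n).
  apply/funext => n; rewrite /series /= mulr_sumr -big_split; apply: eq_bigr => i _ /=.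
  by rewrite mulrA -mulrDl.
exact: (cvgD (eval_cvg Hf z1) (cvgM (cvg_cst (a : C)) (eval_cvg Hg z1))).
Qed.

Variable theta : taylor R.
Hypothesis inner_theta : inner theta.

Let Htheta : H2 theta. Proof. by case: inner_theta. Qed.

(* Since |theta| = 1 a.e. on the circle, both sides are the mean of |1 + a z^k|^2. *)
Lemma inner_combination_norm (a : R[i]) k : (0 < k)%N ->
  l2norm (theta + a *: shiftn k theta) ^+ 2 = 1 + cmod a ^+ 2.
Proof.
move=> k0; set phi := theta + _; have [_ [K HK] Hae] := inner_theta.
have Hk : H2 (shiftn k theta) := shiftn_H2 Htheta.
have Hphi : H2 phi by apply: (H2D _ _).1 => //; exact: (H2Z _ _).1.
pose r n : R := 1 - n.+1%:R^-1.
have r01 n : 0 <= r n < 1.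
  by rewrite /r subr_ge0 invf_le1 ?ltr0n// ler1n /= gtrBl invr_gt0 ltr0n.
have rcv : r n @[n --> \oo] --> (1 : R).
  rewrite -[X in _ --> X]subr0; apply: cvgB; first exact: cvg_cst.
  exact: cvg_harmonic.
have rexpi n t : cmod (Complex (r n) 0 * expi t) < 1.
  by rewrite cmodM cmod_real cmod_expi mulr1 ger0_norm; case/andP: (r01 n).
have phiE n t : eval phi (Complex (r n) 0 * expi t) =
    eval theta (Complex (r n) 0 * expi t) * (1 + a * (Complex (r n) 0 * expi t) ^+ k).
  by rewrite eval_addZ// eval_shiftn//; ring.
(* The polynomial [1 + a z^k] as a coefficient sequence, so that [integral_csum] computes its
   mean. *)
pose q : taylor R := fun i => if i == 0%N then 1 else if i == k then a else 0.
have qE t : csum q k.+1 t = 1 + a * expi t ^+ k.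
  rewrite /csum big_ord_recr /= /q eqxx (gtn_eqF k0).
  case: k k0 {Hk phi Hphi phiE q} => // k _.
  rewrite big_ord_recl /= expr0 mulr1 big1 ?addr0// => i _.
  by rewrite /bump /= ?add1n ?eqSS (ltn_eqF (ltn_ord i)) mul0r.
have psq_q : psq q k.+1 = 1 + cmod a ^+ 2.
  rewrite psqE big_ord_recr /= /q eqxx (gtn_eqF k0).
  case: k k0 {Hk phi Hphi phiE q qE} => // k _.
  rewrite big_ord_recl cmod1 expr1n big1 ?addr0// => i _.
  by rewrite /bump /= ?add1n ?eqSS (ltn_eqF (ltn_ord i)) cmod0 expr0n.
have zcv t : (Complex (r n) 0 * expi t : C) @[n --> \oo] --> (expi t : C).
  rewrite -[X in _ --> X]mul1r; apply: cvgM; last exact: cvg_cst.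
  by apply: cvg_ReIm => //=; exact: cvg_cst.
have ae_cvg : {ae mu, forall t, cmod (eval phi (Complex (r n) 0 * expi t)) ^+ 2 @[n --> \oo] -->
    cmod (csum q k.+1 t) ^+ 2}.
  apply: (@filterS _ _ (ae_filter_ringOfSetsType mu)) Hae => t /cvg_at_leftP Ht.
  have H1 : cmod (eval theta (Complex (r n) 0 * expi t)) @[n --> \oo] --> (1 : R).
    by apply: Ht; split=> // n; case/andP: (r01 n).
  have H2' : cmod (1 + a * (Complex (r n) 0 * expi t) ^+ k) @[n --> \oo] -->
      cmod (1 + a * expi t ^+ k).
    have H2a := cvg_exprC (n := k) (zcv t).
    exact: (cvg_cmod (cvgD (cvg_cst (1 : C)) (cvgM (cvg_cst (a : C)) H2a))).
  have H3 : cmod (eval theta (Complex (r n) 0 * expi t)) *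
      cmod (1 + a * (Complex (r n) 0 * expi t) ^+ k) @[n --> \oo] --> cmod (1 + a * expi t ^+ k).
    by rewrite -[X in _ --> X]mul1r; exact: cvgM.
  rewrite qE.
  have -> : (fun n => cmod (eval phi (Complex (r n) 0 * expi t)) ^+ 2) =
    (fun n => (cmod (eval theta (Complex (r n) 0 * expi t)) *
               cmod (1 + a * (Complex (r n) 0 * expi t) ^+ k)) ^+ 2).
    by apply/funext => n; rewrite phiE cmodM.
  exact: (cvg_sqr H3).
have K0 : 0 <= K.
  apply: le_trans (cmod_ge0 (eval theta 0)) (HK _ _).
  by rewrite /disc /= expr0n /= addr0 sqrtr0.
have bnd n t : `|cmod (eval phi (Complex (r n) 0 * expi t)) ^+ 2| <= (K * (1 + cmod a)) ^+ 2.
  rewrite ger0_norm ?sqr_ge0// phiE cmodM ler_pXn2r ?nnegrE ?mulr_ge0 ?addr_ge0 ?cmod_ge0//.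
  apply: ler_pM; rewrite ?cmod_ge0//; first by apply: HK; exact: rexpi.
  apply: (le_trans (cmodD _ _)); rewrite cmod1 lerD2l cmodM cmodX ler_piMr ?cmod_ge0//.
  by rewrite exprn_ile1 ?cmod_ge0// ltW.
(* The bound [K] for [theta] on the disc supplies the dominating constant, so the means over the
   circles of radius [r n] pass to the boundary. *)
have IC := bounded_convergence (fun n => eval_measurable Hphi (r01 n))
  (csum_measurable q k.+1) ae_cvg bnd.
rewrite integral_csum psq_q in IC.
have {}IC : (2 * pi * l2norm (dilate (r n) phi) ^+ 2) @[n --> \oo] --> 2 * pi * (1 + cmod a ^+ 2).
  have E : (fun n => (\int[mu]_(t in `[0%R, (2 * pi)%R])
      (cmod (eval phi (Complex (r n) 0 * expi t)) ^+ 2)%:E)%E) =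
      (fun n => (2 * pi * l2norm (dilate (r n) phi) ^+ 2)%:E).
    by apply/funext => n; exact: (integral_eval Hphi (r01 n)).
  by move: IC; rewrite E => /fine_cvgP[].
have pi2 : 2 * pi != 0 :> R by rewrite mulf_neq0 ?gt_eqF ?pi_gt0.
have dil : l2norm (dilate (r n) phi) ^+ 2 @[n --> \oo] --> 1 + cmod a ^+ 2.
  have -> : (fun n => l2norm (dilate (r n) phi) ^+ 2) =
      (fun n => (2 * pi)^-1 * (2 * pi * l2norm (dilate (r n) phi) ^+ 2)).
    by apply/funext => n; rewrite mulKf.
  by rewrite -[X in _ --> X](mulKf pi2); exact: (cvgM (cvg_cst _) IC).
(* The dilations have norms tending to the claimed value. They do not exceed the norm of [phi],
   which is one inequality; the other holds for each partial square sum, where finitely many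
   coefficients converge. *)
apply/eqP; rewrite eq_le; apply/andP; split.
  apply: (cvg_le_bound (psq_cvg Hphi)) => m.
  have coef i : (dilate (r n) phi i : C) @[n --> \oo] --> (phi i : C).
    have rC : (Complex (r n) 0 : C) @[n --> \oo] --> (1 : C).
      by apply: cvg_ReIm => //=; exact: cvg_cst.
    rewrite /dilate -[X in _ --> X]mulr1 -(expr1n C i).
    exact: (cvgM (cvg_cst (phi i : C)) (cvg_exprC (n := i) rC)).
  have H : psq (dilate (r n) phi) m - l2norm (dilate (r n) phi) ^+ 2 @[n --> \oo] -->
      psq phi m - (1 + cmod a ^+ 2) by exact: (cvgB (psq_cvg_coef (n := m) coef) dil).
  rewrite -subr_le0; apply: (cvg_le_bound H) => n.
  by rewrite subr_le0; apply: psq_le; case: (dilate_H2 Hphi (r01 n)).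
apply: (cvg_le_bound dil) => n.
by rewrite ler_pXn2r ?nnegrE ?l2norm_ge0//; case: (dilate_H2 Hphi (r01 n)).
Qed.

Lemma inner_norm : l2norm theta = 1.
Proof.
have := @inner_combination_norm 0 1 isT.
rewrite scale0r addr0 cmod0 expr0n addr0 => /eqP; rewrite sqrf_eq1 => /orP[/eqP//|/eqP n1].
by have := l2norm_ge0 theta; rewrite n1 oppr_ge0 ler10.
Qed.

(** Expanding the norm of [theta + a z^k theta] leaves [Re (conj(a) x) = 0] for the inner product
    [x]; [a = 1] and [a = i] give both parts. *)
Lemma inner_dot_shiftn k : (0 < k)%N -> l2dot theta (shiftn k theta) = 0.
Proof.
move=> k0; have Hk : H2 (shiftn k theta) := shiftn_H2 Htheta.
have nk : l2norm (shiftn k theta) = 1.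
  rewrite -inner_norm; elim: (k) => // j IH.
  by have [_ nj] := shift_H2 (shiftn_H2 (m := j) Htheta); rewrite -IH -nj.
have key a : complex.Re (conjc a * l2dot theta (shiftn k theta)) = 0.
  have := inner_combination_norm a k0; have [HZ nZ] := H2Z a Hk.
  rewrite (l2normD_sq Htheta HZ) inner_norm nZ nk mulr1 expr1n l2dotZr// => /eqP.
  by rewrite -subr_eq0 addrC addKr mulf_eq0 pnatr_eq0 => /eqP.
have := key 1; have := key (Complex 0 1).
case: (l2dot _ _) => x y /=; rewrite oppr0 !mul0r !mul1r mulN1r subr0 sub0r opprK.
by move=> -> ->.
Qed.

Lemma l2dot_shift2 (f g : taylor R) : l2dot (shift f) (shift g) = l2dot f g.
Proof. by rewrite l2dot_shift. Qed.

Lemma inner_orthonormal i j : l2dot (shiftn i theta) (shiftn j theta) = (i == j)%:R.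
Proof.
wlog ij : i j / (i <= j)%N.
  move=> H; case: (leqP i j) => [|/ltnW ji]; first exact: H.
  rewrite l2dotC ?H ?(eq_sym i)//; [by case: eqP; rewrite ?conjc1 ?conjc0| |]; exact: shiftn_H2.
elim: i j ij => [|i IH] [|j] //= ij; last by rewrite /shiftn /= l2dot_shift2; exact: IH.
  by rewrite l2dot_norm// inner_norm expr1n.
by rewrite -[LHS]/(l2dot theta (shiftn j.+1 theta)) inner_dot_shiftn.
Qed.

End InnerShifts.

(** * Model spaces and their kernels *)

Section ModelSpace.
Variable R : realType.
Notation C := (Cplx R).
Implicit Types f g : taylor R.

Variable theta : taylor R.
Hypothesis inner_theta : inner theta.

Lemma inner_H2 : H2 theta. Proof. by case: inner_theta. Qed.

Notation e := (fun m => shiftn m theta).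

Lemma e_H2 m : H2 (shiftn m theta).
Proof. by apply: shiftn_H2; exact: inner_H2. Qed.

Let eON := inner_orthonormal inner_theta.

Let combH f n : H2 (comb e f n).
Proof. by apply: comb_H2; exact: e_H2. Qed.

Lemma combE (d : nat -> taylor R) (c : nat -> C) n i :
  comb d c n i = \sum_(m < n) c m * d m i.
Proof.
elim: n => [|n IH]; first by rewrite big_ord0.
by rewrite big_ord_recr /= -IH.
Qed.

Lemma pmul_shiftn f i : pmul theta f i = \sum_(m < i.+1) f m * shiftn m theta i.
Proof.
rewrite /pmul (reindex_inj rev_ord_inj) /=; apply: eq_bigr => m _.
have mi : (m <= i)%N by rewrite -ltnS.
by rewrite shiftnE mi subSS subKn// mulrC.
Qed.

Lemma comb_pmul f n i : (i < n)%N -> comb e f n i = pmul theta f i.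
Proof.
move=> i_n; rewrite combE pmul_shiftn.
rewrite -!(big_mkord xpredT (fun m => f m * shiftn m theta i)).
rewrite (big_cat_nat _ i_n)//= [X in _ + X]sum_nat_eq0 ?addr0// => m im _.
by rewrite shiftnE leqNgt im mulr0.
Qed.

(** The product is the orthonormal expansion with coefficients [f m] in the [z^m theta]; each Taylor
    coefficient of the partial combinations is eventually constant, so it agrees with the
    Riesz-Fischer limit. *)
Lemma pmul_inner f : H2 f -> [/\ H2 (pmul theta f),
  l2norm (comb e f n - pmul theta f) @[n --> \oo] --> (0 : R) &
  l2norm (pmul theta f) = l2norm f].
Proof.
move=> Hf; have [F [HF cF nF]] := riesz_fischer e_H2 eON Hf.
suff -> : pmul theta f = F by [].
apply/funext => i; have H := l2_cvg_coef (i := i) (@combH f) HF cF.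
have H' : (comb e f n i : C) @[n --> \oo] --> (pmul theta f i : C).
  by apply: cvg_near_cst; exists i.+1 => // n /= i_n; rewrite comb_pmul.
exact: (cvg_unique _ H' H).
Qed.

Lemma comb_dotl (c : nat -> C) n g : H2 g ->
  l2dot (comb e c n) g = \sum_(m < n) c m * l2dot (shiftn m theta) g.
Proof.
move=> Hg; elim: n => [|n IH]; first by rewrite big_ord0 l2dot0l.
have He := @e_H2 n; have Hc := @combH c n.
by rewrite big_ord_recr /= -IH (l2dotDl Hc (H2Z (c n) He).1 Hg) (l2dotZl _ He Hg).
Qed.

Lemma pmul_inner_dot f g : H2 f -> H2 g ->
  (\sum_(m < n) f m * l2dot (shiftn m theta) g : C) @[n --> \oo] --> l2dot (pmul theta f) g.
Proof.
move=> Hf Hg; have [HF cF _] := pmul_inner Hf.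
have := l2_cvg_dotl (@combH f) HF Hg cF.
by under eq_fun do rewrite comb_dotl//.
Qed.

Lemma pmul_inner_coef f m : H2 f -> l2dot (pmul theta f) (shiftn m theta) = f m.
Proof.
move=> Hf; have H := pmul_inner_dot Hf (@e_H2 m).
have H' : (\sum_(j < n) f j * l2dot (shiftn j theta) (shiftn m theta) : C)
    @[n --> \oo] --> (f m : C).
  apply: cvg_near_cst; exists m.+1 => // n /= mn.
  rewrite (bigD1 (Ordinal mn))//= big1 ?addr0 => [|j jm]; first by rewrite eON eqxx mulr1.
  by rewrite eON (_ : (_ == _) = false) ?mulr0//; apply/negbTE; rewrite -val_eqE in jm.
exact: (cvg_unique _ H H').
Qed.

(** The products of [theta] with monomials suffice as test functions, since [theta f] is the norm
    limit of their combinations. *)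
Lemma model_spaceP g :
  model_space theta g <-> H2 g /\ forall m, l2dot g (shiftn m theta) = 0.
Proof.
split=> [[Hg H]|[Hg H]]; split=> //.
  move=> m; pose d : taylor R := fun i => if i == m then 1 else 0.
  have Hd : H2 d.
    have -> : d = trunc m.+1 d.
      by apply/funext => i; rewrite /trunc /d ltnS; case: eqP => [->|]; rewrite ?leqnn//; case: ifP.
    exact: (trunc_H2 _ _).1.
  rewrite -(H d Hd); congr l2dot; apply/funext => i; rewrite pmul_shiftn.
  case: (leqP m i) => [mi|im].
    rewrite -ltnS in mi; rewrite (bigD1 (Ordinal mi))//= big1 ?addr0 => [|j jm].
      by rewrite /d eqxx mul1r.
    by rewrite /d ifF ?mul0r//; apply/negbTE; rewrite -val_eqE in jm.
  rewrite shiftnE leqNgt im big1// => j _; rewrite /d ifF ?mul0r//.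
  by apply/negbTE; rewrite neq_ltn (leq_ltn_trans _ im)// -ltnS.
move=> f Hf; have [HF _ _] := pmul_inner Hf.
have := pmul_inner_dot Hf Hg.
have -> : (fun n => \sum_(m < n) f m * l2dot (shiftn m theta) g : C) = cst 0.
  apply/funext => n; rewrite big1// => m _.
  by rewrite (l2dotC Hg (@e_H2 m)) H conjc0 mulr0.
move=> H0; have := cvg_unique _ H0 (cvg_cst _) => Z.
by rewrite (l2dotC HF Hg) Z// conjc0.
Qed.

Hypothesis theta0 : theta 0%N = 0.

Definition one : taylor R := fun i => if i == 0%N then 1 else 0.

Lemma one_H2 : H2 one.
Proof.
have -> : one = trunc 1 one by apply/funext => -[|i].
exact: (trunc_H2 _ _).1.
Qed.

Lemma l2dot_one f : l2dot one f = conjc (f 0%N).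
Proof.
have -> : one = trunc 1 one by apply/funext => -[|i].
by rewrite l2dot_trunc big_ord_recl big_ord0 addr0 mul1r.
Qed.

Lemma shiftn_inner0 m : shiftn m theta 0%N = 0.
Proof. by rewrite shiftnE; case: m => [|m] //=; rewrite theta0. Qed.

Lemma one_model : model_space theta one.
Proof.
apply/model_spaceP; split; first exact: one_H2.
by move=> m; rewrite l2dot_one shiftn_inner0 conjc0.
Qed.

Lemma model_bshift g : model_space theta g -> model_space theta (bshift g).
Proof.
move=> /model_spaceP[Hg g0]; apply/model_spaceP; split; first exact: (bshift_H2 Hg).1.
move=> m; have Hb := (bshift_H2 Hg).1.
rewrite (l2dotC (@e_H2 m) Hb) -l2dot_shift (l2dotC Hg (@e_H2 m.+1)).
by rewrite g0 conjc0 conjc0.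
Qed.

Lemma bshift_inner : [/\ model_space theta (bshift theta), l2norm (bshift theta) = 1 &
  shift (bshift theta) = theta].
Proof.
have sb : shift (bshift theta) = theta by apply/funext => -[|i] //=; rewrite theta0.
have [Hb _] := bshift_H2 inner_H2.
split=> //; last by have [_ <-] := shift_H2 Hb; rewrite sb; exact: inner_norm.
apply/model_spaceP; split=> // m.
rewrite (l2dotC (@e_H2 m) Hb) -l2dot_shift.
by rewrite -[X in l2dot X _]/(shiftn m.+1 theta) (eON m.+1 0) conjc0.
Qed.

(** Orthogonality of [z g] to [z^(m+1) theta] is inherited from [g]; the one new condition is
    against [theta], and it moves to [S^* theta] by adjunction. *)
Lemma model_shift g : model_space theta g -> l2dot g (bshift theta) = 0 ->
  model_space theta (shift g).
Proof.
move=> /model_spaceP[Hg g0] gb; apply/model_spaceP; split; first exact: (shift_H2 Hg).1.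
case=> [|m]; first by rewrite l2dot_shift.
by rewrite l2dot_shift -[RHS](g0 m); congr l2dot; apply/funext => i.
Qed.

Lemma model_subspace (a : R[i]) f g : model_space theta f -> model_space theta g ->
  model_space theta (a *: f + g).
Proof.
move=> /model_spaceP[Hf f0] /model_spaceP[Hg g0]; apply/model_spaceP.
have HZ := (H2Z a Hf).1; split; first exact: (H2D HZ Hg).1.
by move=> m; rewrite l2dotDl ?l2dotZl ?f0 ?g0 ?mulr0 ?addr0//; exact: e_H2.
Qed.

End ModelSpace.

(** * Reproducing kernels of the model space *)

Section Kernels.
Variable R : realType.
Notation C := (Cplx R).
Variable theta : taylor R.
Hypotheses (inner_theta : inner theta) (theta0 : theta 0%N = 0).
Variable w : R[i].
Hypothesis w1 : cmod w < 1.

Let w2 : 0 <= cmod w ^+ 2 < 1.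
Proof. by rewrite sqr_ge0 -[X in _ < X](expr1n _ 2) ltrXn2r ?nnegrE ?cmod_ge0. Qed.

Let w2' : 0 < 1 - cmod w ^+ 2. Proof. by rewrite subr_gt0; case/andP: w2. Qed.

(** The reproducing kernel [1 / (1 - conj(w) z)] of H^2. *)
Definition szego : taylor R := fun n => conjc w ^+ n.

Lemma szego_H2 : H2 szego /\ l2norm szego ^+ 2 = (1 - cmod w ^+ 2)^-1.
Proof.
have H : psq szego n @[n --> \oo] --> Num.sqrt ((1 - cmod w ^+ 2)^-1) ^+ 2.
  rewrite sqr_sqrtr ?invr_ge0 ?(ltW w2')//.
  have -> : psq szego = series (geometric 1 (cmod w ^+ 2)).
    apply/funext => n; rewrite /psq /series /=; apply: eq_bigr => i _.
    by rewrite /szego cmodX cmodJ -!exprM mulnC mul1r.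
  rewrite -[X in _ --> X]mul1r; apply: cvg_geometric_series.
  by case/andP: w2 => ? ?; rewrite ger0_norm.
have [Hs ->] := l2norm_unique (sqrtr_ge0 _) H.
by rewrite sqr_sqrtr ?invr_ge0 ?(ltW w2').
Qed.

Let Hs : H2 szego. Proof. by case: szego_H2. Qed.
Let Ht : H2 theta. Proof. exact: inner_H2. Qed.

Lemma l2dot_szego f : H2 f -> l2dot f szego = eval f w.
Proof.
move=> Hf; apply: l2dot_unique.
have -> : (fun n => f n * conjc (szego n) : C) = (fun n => f n * w ^+ n : C).
  by apply/funext => n; rewrite /szego rmorphXn /= conjcK.
exact: eval_cvg.
Qed.

Definition model_kernel : taylor R :=
  szego - conjc (eval theta w) *: pmul theta szego.

Let HF : H2 (pmul theta szego). Proof. by have [] := pmul_inner inner_theta Hs. Qed.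

Let HZ : H2 (conjc (eval theta w) *: pmul theta szego).
Proof. exact: (H2Z _ HF).1. Qed.

Lemma model_kernelP : model_space theta model_kernel.
Proof.
apply/(model_spaceP inner_theta); split; first exact: (H2B Hs HZ).1.
move=> m; have He : H2 (shiftn m theta) := shiftn_H2 Ht.
rewrite (l2dotBl Hs HZ He) (l2dotZl _ HF He) pmul_inner_coef//.
rewrite (l2dotC He Hs) l2dot_szego// eval_shiftn// conjcM /szego.
by rewrite rmorphXn /= mulrC subrr.
Qed.

(** This is the value of [theta szego] at [w], obtained by summing the expansion in the [z^m theta]
    term by term. *)
Lemma l2dot_pmul_szego : l2dot (pmul theta szego) szego =
  eval theta w * Complex (1 - cmod w ^+ 2)^-1 0.
Proof.
have H := pmul_inner_dot inner_theta Hs Hs.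
apply: cvg_unique H _ => //.
have -> : (fun n => \sum_(m < n) szego m * l2dot (shiftn m theta) szego : C) =
    (fun n => eval theta w * (Complex (psq szego n) 0 : C)).
  apply/funext => n.
  have -> : Complex (psq szego n) 0 = \sum_(m < n) Complex (cmod (szego m) ^+ 2) 0 :> R[i].
    by rewrite psqE; exact: (rmorph_sum (real_complex R)).
  rewrite mulr_sumr; apply: eq_bigr => m _.
  rewrite l2dot_szego ?eval_shiftn//; last exact: shiftn_H2.
  rewrite -mul_conjc /szego rmorphXn /= conjcK.
  by ring.
apply: cvgM; first exact: cvg_cst.
have := psq_cvg Hs; rewrite szego_H2.2 => P.
by apply: cvg_ReIm => //=; exact: cvg_cst.
Qed.

Lemma model_kernel_norm :
  l2norm model_kernel ^+ 2 = (1 - cmod (eval theta w) ^+ 2) / (1 - cmod w ^+ 2).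
Proof.
have [_ _ nF] := pmul_inner inner_theta Hs.
rewrite /model_kernel (l2normD_sq Hs (H2N HZ).1) (H2N HZ).2 (H2Z _ HF).2 nF.
rewrite (l2dotNr Hs HZ) (l2dotZr _ Hs HF) conjcK (l2dotC HF Hs) l2dot_pmul_szego.
rewrite exprMn szego_H2.2 cmodJ.
have -> : complex.Re (- (eval theta w * conjc (eval theta w * Complex (1 - cmod w ^+ 2)^-1 0))) =
    - (cmod (eval theta w) ^+ 2 * (1 - cmod w ^+ 2)^-1).
  rewrite conjcM mulrA mul_conjc.
  by rewrite (cmod_sqE (eval theta w)) /=; ring.
by ring.
Qed.

Lemma model_kernel0 : model_kernel 0%N = 1.
Proof.
rewrite [LHS](_ : _ = szego 0%N - conjc (eval theta w) * pmul theta szego 0%N)//.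
by rewrite /pmul big_ord_recl big_ord0 theta0 mul0r addr0 mulr0 subr0.
Qed.

(** [S^*] multiplies the Szego kernel by [conj(w)], and [S^*(theta f) = theta S^* f + f(0) S^*
    theta]. So the kernel is almost an eigenvector of [S^*] when [theta(w)] is small. *)
Lemma bshift_model_kernel : bshift model_kernel - conjc w *: model_kernel =
  - (conjc (eval theta w) *: bshift theta).
Proof.
apply/funext => n.
rewrite [LHS](_ : _ = (szego n.+1 - conjc (eval theta w) * pmul theta szego n.+1) -
   conjc w * (szego n - conjc (eval theta w) * pmul theta szego n))//.
rewrite [RHS](_ : _ = - (conjc (eval theta w) * theta n.+1))//.
have -> : pmul theta szego n.+1 = conjc w * pmul theta szego n + theta n.+1.
  rewrite /pmul big_ord_recr /= subnn mulr1 mulr_sumr; congr (_ + _).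
  apply: eq_bigr => k _; have kn : (k <= n)%N by rewrite -ltnS.
  by rewrite /szego subSn// exprS mulrCA.
by rewrite /szego exprS; ring.
Qed.

End Kernels.

(** * The compressed shift *)

Lemma subr_swap (W : zmodType) (w b f c : W) : w - (f - c) = (w + b - f) - (b - c).
Proof.
rewrite !opprB [RHS]addrC [RHS]addrA [w + b]addrC [c - b + _]addrA subrK.
by rewrite [c + w]addrC addrA.
Qed.

(** * One-dimensional subspaces and perturbations *)

Section OneDimensional.
Variable R : realType.

Lemma findim_of_functional (V : set (taylor R)) (phi : taylor R -> R[i]) :
  (forall (a : R[i]) f g, V f -> V g -> V (a *: f + g) /\ phi (a *: f + g) = a * phi f + phi g) ->
  (forall f, V f -> phi f = 0 -> f = 0) ->
  exists b, forall f, V f -> exists c : R[i], f = c *: b.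
Proof.
move=> lin inj; have [[f1 [V1 p1]]|H] := pselect (exists f, V f /\ phi f != 0).
  exists f1 => f Vf; exists (phi f / phi f1).
  have [VD pD] := lin (- (phi f / phi f1)) f1 f V1 Vf.
  have := inj _ VD; rewrite pD mulNr divfK// addNr => /(_ erefl) /eqP.
  by rewrite scaleNr addrC subr_eq0 => /eqP.
exists 0 => f Vf; exists 0; rewrite scaler0; apply: inj => //.
by apply/eqP; apply: contrapT => /negP pf; apply: H; exists f.
Qed.

Lemma findim_line (V : set (taylor R)) : (exists b, forall f, V f -> exists c : R[i], f = c *: b) ->
  findim V.
Proof.
move=> [b Hb]; exists 1%N, (fun=> b) => f /Hb[c ->].
by exists (fun=> c); rewrite big_ord_recl big_ord0 addr0.
Qed.

(** With [v] replaced by its component [v'] orthogonal to [W], the coefficient along the line is a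
    bounded functional, so both components of a convergent sequence converge. *)
Lemma closed_add_line (W : set (taylor R)) (v : taylor R) : closed_subspace W -> H2 v ->
  l2closed [set u | exists w (c : R[i]), W w /\ u = w + c *: v].
Proof.
move=> HW Hv; have [WH2 _ _ Wcl] := HW.
have [p Wp pv] := projection HW Hv; have Hp := WH2 _ Wp.
set v' := v - p in pv; have Hv' : H2 v' := (H2B Hv Hp).1.
have vE (c : R[i]) w : w + c *: v = (w + c *: p) + c *: v'.
  by rewrite /v' scalerBr -addrA [c *: p + _]addrC subrK.
move=> u f Hu Hf uf.
have [x Hx] := choice Hu; have [c Hc] := choice Hx.
pose w k := x k + c k *: p.
have Ww k : W (w k).
  by apply: (subspaceD HW); [case: (Hc k)|apply: (subspaceZ HW)].
have uE k : u k = w k + c k *: v' by rewrite (Hc k).2 vE.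
have Hw k : H2 (w k) := WH2 _ (Ww k).
have HZ k : H2 (c k *: v') := (H2Z (c k) Hv').1.
have Huk k : H2 (u k) by rewrite uE; exact: (H2D (Hw k) (HZ k)).1.
pose n2 : R[i] := Complex (l2norm v' ^+ 2) 0.
have dotE k : l2dot (u k) v' = c k * n2.
  rewrite uE (l2dotDl (Hw k) (HZ k) Hv') (l2dotZl _ Hv' Hv') (l2dot_norm Hv').
  by rewrite (l2dotC Hv' (Hw k)) pv// conjc0 add0r.
pose c0 := l2dot f v' / n2.
have close k : l2norm (c k *: v' - c0 *: v') <= l2norm (u k - f).
  (* If [v] lies in [W] then [v' = 0], and the value of [c0], a division by zero, is immaterial. *)
  have [v0|vn0] := eqVneq (l2norm v') 0.
    by rewrite (l2norm_eq0 Hv' v0) !scaler0 subrr (H2_0 R).2 l2norm_ge0.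
  have vpos : 0 < l2norm v' by rewrite lt_def vn0 l2norm_ge0.
  have n2n0 : n2 != 0.
    by rewrite /n2 eq_complex /= eqxx andbT sqrf_eq0.
  rewrite -scalerBl (H2Z _ Hv').2.
  have -> : c k - c0 = l2dot (u k - f) v' / n2.
    by rewrite (l2dotBl (Huk k) Hf Hv') dotE /c0 mulrBl mulfK.
  rewrite cmodM cmodV /n2 cmod_real ger0_norm ?sqr_ge0//.
  have CS := cauchy_schwarz (H2B (Huk k) Hf).1 Hv'.
  rewrite expr2 invfM mulrA divfK// ler_pdivrMr//.
have wcv : l2norm (w k - (f - c0 *: v')) @[k --> \oo] --> (0 : R).
  apply: (@squeeze_cvgr _ _ _ _ (cst 0) (fun k => l2norm (u k - f) + l2norm (u k - f))).
  - apply: nearW => k; rewrite l2norm_ge0 /=.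
    have -> : w k - (f - c0 *: v') = (u k - f) - (c k *: v' - c0 *: v').
      by rewrite uE -subr_swap.
    have HB : H2 (c k *: v' - c0 *: v') by apply: (H2B _ _).1; [exact: HZ|exact: (H2Z _ Hv').1].
    by apply: (le_trans (H2B (H2B (Huk k) Hf).1 HB).2); rewrite lerD2l.
  - exact: cvg_cst.
  - by rewrite -[X in _ --> X]addr0; exact: cvgD.
have Wf : W (f - c0 *: v').
  by apply: Wcl wcv => //; exact: (H2B Hf (H2Z _ Hv').1).1.
exists (f - c0 *: v' - c0 *: p), c0; split.
  by apply: (subspaceB HW) => //; exact: (subspaceZ HW).
by rewrite vE subrK subrK.
Qed.

End OneDimensional.

(** * Fredholmness of the compressed shift *)

Section CompressedShift.
Variable R : realType.
Notation C := (Cplx R).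
Variables (M : set (taylor R)) (h theta : taylor R) (lam : R[i]).
Hypothesis nearly : nearly_bshift_invariant M.
Hypothesis hittM : hitt M h theta.

Let MS : closed_subspace M := nearly.1.

Let MH2 f : M f -> H2 f.
Proof. by case: MS => + _ _ _; apply. Qed.

Let inner_theta : inner theta. Proof. by case: hittM => -[]. Qed.
Let theta0 : theta 0%N = 0. Proof. by case: hittM => -[]. Qed.

Lemma mult_model g : model_space theta g -> M (pmul h g).
Proof. by case: hittM => _ _ _ _ <- Kg; exists g. Qed.

Lemma mult_norm g : model_space theta g -> l2norm (pmul h g) = l2norm g.
Proof. by case: hittM => _ _ _ + _; apply. Qed.

Lemma mult_onto f : M f -> exists2 g, model_space theta g & f = pmul h g.
Proof. by case: hittM => _ _ _ _ <- [g Kg <-]; exists g. Qed.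

Lemma pmul_lin (a : R[i]) f g : pmul h (a *: f + g) = a *: pmul h f + pmul h g.
Proof.
apply/funext => n; rewrite [RHS](_ : _ = a * pmul h f n + pmul h g n)//.
rewrite /pmul mulr_sumr -big_split; apply: eq_bigr => k _ /=.
by rewrite mulrCA -mulrDr.
Qed.

Lemma pmul_shift f : pmul h (shift f) = shift (pmul h f).
Proof.
apply/funext => -[|n]; first by rewrite /pmul big_ord_recl big_ord0 mulr0 addr0.
rewrite /pmul big_ord_recr subnn /= mulr0 addr0; apply: eq_bigr => k _.
by rewrite subSn// -ltnS.
Qed.

Lemma pmul_bshift f : f 0%N = 0 -> pmul h (bshift f) = bshift (pmul h f).
Proof.
move=> f0; have {2}-> : f = shift (bshift f) by apply/funext => -[|n].
by rewrite pmul_shift.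
Qed.

Let KH2 g : model_space theta g -> H2 g. Proof. by case. Qed.

(** Polarization of [mult_norm]: norms of sums give the real part, and replacing [f] by [i f] gives
    the imaginary part. *)
Lemma mult_dot f g : model_space theta f -> model_space theta g ->
  l2dot (pmul h f) (pmul h g) = l2dot f g.
Proof.
move=> Kf Kg.
have Re_eq f' g' : model_space theta f' -> model_space theta g' ->
    complex.Re (l2dot (pmul h f') (pmul h g')) = complex.Re (l2dot f' g').
  move=> Kf' Kg'; have K1 : model_space theta (f' + g').
    by rewrite -[f']scale1r; exact: model_subspace.
  have := mult_norm K1; rewrite -{1}[f']scale1r pmul_lin scale1r => /(congr1 (fun x => x ^+ 2)).
  rewrite (l2normD_sq (MH2 (mult_model Kf')) (MH2 (mult_model Kg'))).
  by rewrite (l2normD_sq (KH2 Kf') (KH2 Kg')) !mult_norm// => /addrI/mulfI; apply.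
have Kif : model_space theta (Complex 0 1 *: f).
  rewrite -[_ *: f]addr0; apply: model_subspace => //.
  by rewrite -(subrr f) addrC -scaleN1r; exact: model_subspace.
have Eif : pmul h (Complex 0 1 *: f) = Complex 0 1 *: pmul h f.
  rewrite -[_ *: f]addr0 pmul_lin; suff -> : pmul h 0 = 0 by rewrite addr0.
  by apply/funext => n; rewrite /pmul big1// => i _; rewrite mulr0.
have := Re_eq f g Kf Kg; have := Re_eq _ g Kif Kg.
rewrite Eif (l2dotZl _ (KH2 Kf) (KH2 Kg)) (l2dotZl _ (MH2 (mult_model Kf)) (MH2 (mult_model Kg))).
case: (l2dot _ _) => a b; case: (l2dot f g) => c d /=.
by rewrite !mul0r !mul1r !sub0r => /oppr_inj -> ->.
Qed.

Definition opT f : taylor R := compressed_shift M f - lam *: f.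

Lemma opT_M f : M f -> M (opT f).
Proof.
move=> Mf; have [Mp _] := orthproj_spec MS (shift_H2 (MH2 Mf)).1.
by apply: (subspaceB MS) => //; exact: (subspaceZ MS).
Qed.

Lemma opT_dot f g : M f -> M g -> l2dot (opT f) g = l2dot (shift f - lam *: f) g.
Proof.
move=> Mf Mg; have Hs := (shift_H2 (MH2 Mf)).1.
have [Mp p0] := orthproj_spec MS Hs.
have HZ := (H2Z lam (MH2 Mf)).1; have Hg := MH2 Mg.
rewrite (l2dotBl (MH2 Mp) HZ Hg) (l2dotBl Hs HZ Hg); congr (_ - _).
by have := p0 _ Mg; rewrite (l2dotBl Hs (MH2 Mp) Hg) => /eqP; rewrite subr_eq0 => /eqP.
Qed.

Lemma M_separates f g : M f -> M g -> (forall k, M k -> l2dot f k = l2dot g k) -> f = g.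
Proof.
move=> Mf Mg H; apply/eqP; rewrite -subr_eq0; apply/eqP.
have MD : M (f - g) by exact: (subspaceB MS).
apply: l2norm_eq0_dot; first exact: MH2.
by rewrite (l2dotBl (MH2 Mf) (MH2 Mg) (MH2 MD)) H// subrr.
Qed.

Lemma opT_lin (a : R[i]) f g : M f -> M g -> opT (a *: f + g) = a *: opT f + opT g.
Proof.
move=> Mf Mg; have MD : M (a *: f + g) by exact: (subspaceZD MS).
have [Tf Tg] := (opT_M Mf, opT_M Mg).
apply: M_separates; [exact: opT_M|exact: (subspaceZD MS)|move=> k Mk].
have [Hk Hf Hg] : [/\ H2 k, H2 f & H2 g] by split; exact: MH2.
rewrite opT_dot// shift_sub_D (_ : shift (a *: f) - lam *: (a *: f) = a *: (shift f - lam *: f)); last first.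
  by rewrite shiftZ scalerBr !scalerA mulrC.
have HS f' : H2 f' -> H2 (shift f' - lam *: f').
  by move=> Hf'; apply: (H2B _ _).1; [exact: (shift_H2 _).1|exact: (H2Z _ _).1].
have HaS := (H2Z a (HS _ Hf)).1; have HaT := (H2Z a (MH2 Tf)).1.
rewrite (l2dotDl HaS (HS _ Hg) Hk) (l2dotZl _ (HS _ Hf) Hk).
by rewrite (l2dotDl HaT (MH2 Tg) Hk) (l2dotZl _ (MH2 Tf) Hk) !opT_dot.
Qed.

Lemma opT_shift f : M f -> M (shift f) -> opT f = shift f - lam *: f.
Proof.
move=> Mf Ms; apply: M_separates; first exact: opT_M.
  by apply: (subspaceB MS) => //; exact: (subspaceZ MS).
by move=> k Mk; rewrite opT_dot.
Qed.

(** The unit vector of [M] whose orthogonal complement in [M] is carried into [M] by the shift. *)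
Let e0 := pmul h (bshift theta).

Let Kb : model_space theta (bshift theta).
Proof. by have [] := bshift_inner inner_theta theta0. Qed.

Lemma Me0 : M e0. Proof. exact: mult_model. Qed.

Lemma norm_e0 : l2dot e0 e0 = 1.
Proof.
rewrite mult_dot// (l2dot_norm (KH2 Kb)).
by have [_ -> _] := bshift_inner inner_theta theta0; rewrite expr1n.
Qed.

Definition shiftable : set (taylor R) := [set f | M f /\ l2dot f e0 = 0].

Lemma shiftableP f : shiftable f -> exists g, [/\ model_space theta g, model_space theta (shift g),
  f = pmul h g & M (shift f)].
Proof.
move=> [Mf f0]; have [g Kg fE] := mult_onto Mf.
have Ks : model_space theta (shift g).
  by apply: model_shift => //; rewrite -mult_dot// -fE.
by exists g; split=> //; rewrite fE -pmul_shift; exact: mult_model.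
Qed.

Lemma shiftable_split f : M f -> shiftable (f - l2dot f e0 *: e0).
Proof.
move=> Mf; have MZ : M (l2dot f e0 *: e0) by apply: (subspaceZ MS); exact: Me0.
split; first exact: (subspaceB MS).
by rewrite (l2dotBl (MH2 Mf) (MH2 MZ) (MH2 Me0)) (l2dotZl _ (MH2 Me0) (MH2 Me0)) norm_e0 mulr1 subrr.
Qed.

Lemma shift_eigen0 f : shift f = lam *: f -> f = 0.
Proof.
move=> H; have c0 : lam * f 0%N = 0 by rewrite -[LHS](congr1 (fun u => u 0%N) H).
have cS n : lam * f n.+1 = f n by rewrite -[LHS](congr1 (fun u => u n.+1) H).
have [l0|l0] := eqVneq lam 0.
  by apply/funext => n; rewrite -cS l0 mul0r.
apply/funext => n; elim: n => [|n IH].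
  by move/eqP: c0; rewrite mulf_eq0 (negbTE l0) => /eqP.
by have /eqP := cS n; rewrite IH mulf_eq0 (negbTE l0) => /eqP.
Qed.

(** On a kernel element orthogonal to [e0] the operator is multiplication by [z - lam], so pairing
    with [e0] is injective on the kernel. *)
Lemma ker_findim : findim [set f | M f /\ opT f = 0].
Proof.
apply: findim_line; apply: (@findim_of_functional _ _ (fun f => l2dot f e0)).
  move=> a f g [Mf Tf] [Mg Tg]; split.
    by split; [exact: (subspaceZD MS)|rewrite opT_lin// Tf Tg scaler0 addr0].
  rewrite (l2dotDl (H2Z a (MH2 Mf)).1 (MH2 Mg) (MH2 Me0)).
  by rewrite (l2dotZl _ (MH2 Mf) (MH2 Me0)).
move=> f [Mf Tf] f0; have [g [_ _ _ Ms]] := shiftableP (conj Mf f0).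
by apply: shift_eigen0; move: Tf; rewrite opT_shift// => /eqP; rewrite subr_eq0 => /eqP.
Qed.

Definition coker : set (taylor R) := [set g | M g /\ forall f, M f -> l2dot (opT f) g = 0].

(** This identifies the adjoint of [opT] at the elements of [M] vanishing at 0: near invariance
    keeps [bshift r] in [M]. *)
Lemma opT_dot_vanishing f r : M f -> M r -> r 0%N = 0 ->
  l2dot (opT f) r = l2dot f (bshift r - conjc lam *: r).
Proof.
move=> Mf Mr r0; have [Hf Hr] := (MH2 Mf, MH2 Mr).
rewrite opT_dot// (l2dotBl (shift_H2 Hf).1 (H2Z lam Hf).1 Hr) l2dot_shift (l2dotZl _ Hf Hr).
by rewrite (l2dotBr Hf (bshift_H2 Hr).1 (H2Z _ Hr).1) (l2dotZr _ Hf Hr) conjcK.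
Qed.

(** By near invariance [S^* g - conj(lam) g] is itself an element of [M] to test with, hence
    orthogonal to itself and zero; the coefficients of [g] then vanish one after the other. *)
Lemma coker_inj g : coker g -> g 0%N = 0 -> g = 0.
Proof.
move=> [Mg H] g0; pose f := bshift g - conjc lam *: g.
have Mf : M f.
  by apply: (subspaceB MS); [exact: nearly.2|exact: (subspaceZ MS)].
have := H f Mf; rewrite opT_dot_vanishing// -/f => /(l2norm_eq0_dot (MH2 Mf)) f0.
apply/funext => n; elim: n => [//|n IH].
have : f n = 0 by rewrite f0.
rewrite [LHS](_ : _ = g n.+1 - conjc lam * g n)// IH mulr0 subr0.
by [].
Qed.

Lemma coker_line : exists b, forall g, coker g -> exists c : R[i], g = c *: b.
Proof.
apply: (@findim_of_functional _ _ (fun f => f 0%N)); last exact: coker_inj.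
move=> a f g [Mf Tf] [Mg Tg]; split=> //; split; first exact: (subspaceZD MS).
move=> k Mk; have Hk := MH2 (opT_M Mk).
rewrite (l2dotDr Hk (H2Z a (MH2 Mf)).1 (MH2 Mg)) (l2dotZr _ Hk (MH2 Mf)).
by rewrite Tf// Tg// mulr0 addr0.
Qed.

Lemma coker_findim : findim coker.
Proof. exact: findim_line coker_line. Qed.

(** On a space of dimension at most one, the injective functional [g 0] is bounded below. *)
Lemma coker_bound : exists2 c : R, 0 <= c & forall g, coker g -> l2norm g <= c * cmod (g 0%N).
Proof.
have [[g1 [G1 g10]]|H] := pselect (exists g, coker g /\ g 0%N != 0).
  have [b Hb] := coker_line; have [c1 g1E] := Hb _ G1.
  have Hg1 : H2 g1 := MH2 G1.1.
  have c1n0 : c1 != 0.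
    by apply: contra_neq g10 => c10; rewrite g1E c10 scale0r.
  exists (l2norm g1 / cmod (g1 0%N)); first by rewrite divr_ge0 ?l2norm_ge0 ?cmod_ge0.
  move=> g Gg; have [c gE] := Hb _ Gg.
  have E : g = (c / c1) *: g1 by rewrite g1E scalerA divfK.
  rewrite E (H2Z _ Hg1).2 [in leRHS](_ : ((c / c1) *: g1) 0%N = c / c1 * g1 0%N)// cmodM.
  have Eq (x y z : R) : x != 0 -> z * y <= y / x * (z * x).
    by move=> x0; rewrite le_eqVlt; apply/orP; left; apply/eqP; field.
  rewrite !cmodM; suff H0 : cmod (g1 0%N) != 0 by exact: (Eq _ _ _ H0).
  by rewrite cmod_eq0.
exists 0 => // g Gg; rewrite (coker_inj Gg) ?(H2_0 R).2 ?mul0r//.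
by apply/eqP; apply: contrapT => /negP g0; apply: H; exists g.
Qed.

Let HD f : H2 f -> H2 (shift f - lam *: f).
Proof. by move=> Hf; exact: (@shift_sub_bound R lam _ Hf).1. Qed.

Lemma shift_sub_lin (a : R[i]) f g :
  shift (a *: f + g) - lam *: (a *: f + g) =
  a *: (shift f - lam *: f) + (shift g - lam *: g).
Proof. by rewrite shift_sub_D shiftZ [a *: (_ - _)]scalerBr !scalerA mulrC. Qed.

Lemma shift_sub_B f g :
  shift (f - g) - lam *: (f - g) = (shift f - lam *: f) - (shift g - lam *: g).
Proof. by rewrite [f - g]addrC -[- g]scaleN1r shift_sub_lin scaleN1r addrC. Qed.

Lemma shiftable_lin (a : R[i]) f g : shiftable f -> shiftable g -> shiftable (a *: f + g).
Proof.
move=> [Mf f0] [Mg g0]; split; first exact: (subspaceZD MS).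
rewrite (l2dotDl (H2Z a (MH2 Mf)).1 (MH2 Mg) (MH2 Me0)).
by rewrite (l2dotZl _ (MH2 Mf) (MH2 Me0)) f0 g0 mulr0 addr0.
Qed.

Section BoundedBelow.
Variable c0 : R.
Hypothesis model_bound : forall g, model_space theta g ->
  l2norm g <= c0 * l2norm (shift g - lam *: g).

Lemma shiftable_bound x : shiftable x -> l2norm x <= `|c0| * l2norm (shift x - lam *: x).
Proof.
move=> Sx; have [g [Kg Ks xE _]] := shiftableP Sx.
have KD : model_space theta (shift g - lam *: g).
  by rewrite addrC -scaleNr; exact: model_subspace.
have -> : shift x - lam *: x = pmul h (shift g - lam *: g).
  by rewrite [shift x - _]addrC [shift g - _]addrC -!scaleNr pmul_lin pmul_shift xE.
rewrite xE !mult_norm//; apply: le_trans (model_bound Kg) _.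
by rewrite ler_wpM2r ?l2norm_ge0// ler_norm.
Qed.

Lemma shiftable_image_closed :
  closed_subspace [set u | exists2 x, shiftable x & u = shift x - lam *: x].
Proof.
have SH2 x : shiftable x -> H2 x by move=> [/MH2].
have S0 : shiftable 0 by split; [exact: (subspace0 MS)|exact: l2dot0l].
split=> [_ [x /SH2 Hx ->]||a _ _ [x Sx ->] [y Sy ->]|u f uW Hf uf]; first exact: HD.
- by exists 0 => //; apply/funext => -[|n]; rewrite scaler0 subr0.
- by exists (a *: x + y); [exact: shiftable_lin|rewrite shift_sub_lin].
have /choice[x xP] : forall k, exists x, shiftable x /\ u k = shift x - lam *: x.
  by move=> k; have [y Sy uE] := uW k; exists y.
have Sx k : shiftable (x k) := (xP k).1.
have uE k : u k = shift (x k) - lam *: x k := (xP k).2.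
have Hx k : H2 (x k) := SH2 _ (Sx k).
have Hu k : H2 (u k) by rewrite uE; exact: HD.
have [x' Hx' xx'] : exists2 x', H2 x' & l2norm (x k - x') @[k --> \oo] --> (0 : R).
  apply: l2_complete => // e e0'.
  have c1 : 0 < `|c0| + 1 by rewrite ltr_wpDl.
  have [N HN] := l2_cvg_cauchy Hu Hf uf (divr_gt0 e0' c1).
  exists N => m n Nm Nn.
  have Sd : shiftable (x m - x n).
    by rewrite addrC -scaleN1r; exact: shiftable_lin.
  have := HN m n Nm Nn; rewrite ltr_pdivlMr// mulrC; apply: le_lt_trans.
  rewrite !uE -shift_sub_B; apply: le_trans (shiftable_bound Sd) _.
  by rewrite ler_wpM2r ?l2norm_ge0// lerDl.
have Sx' : shiftable x'.
  split; first by apply: (subspace_closed MS) Hx' xx' => k; case: (Sx k).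
  have := l2_cvg_dotl Hx Hx' (MH2 Me0) xx'.
  rewrite (_ : (fun k => _) = cst (0 : C)); last by apply/funext => k; rewrite (Sx k).2.
  by move=> /cvg_lim <- //; exact: lim_cst.
exists x' => //; apply/funext => i.
have u1 := l2_cvg_coef (i := i) Hu Hf uf.
suff u2 : l2norm (u k - (shift x' - lam *: x')) @[k --> \oo] --> (0 : R).
  have := l2_cvg_coef (i := i) Hu (HD Hx') u2.
  exact: (cvg_unique _ u1).
apply: (@squeeze_cvgr _ _ _ _ (fun=> 0) (fun k => (1 + cmod lam) * l2norm (x k - x'))).
- near=> k; rewrite l2norm_ge0 uE -shift_sub_B.
  exact: (@shift_sub_bound R lam _ (H2B (Hx k) Hx').1).2.
- exact: cvg_cst.
by rewrite -[X in _ --> X](mulr0 (1 + cmod lam)); apply: cvgM xx'; exact: cvg_cst.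
Unshelve. all: by end_near. Qed.

(** [M] is the hyperplane [shiftable] plus the line of [e0], so the range is a closed subspace plus
    a line. *)
Lemma closed_range : l2closed (opT @` M).
Proof.
have := closed_add_line shiftable_image_closed (MH2 (opT_M Me0)).
congr l2closed; apply/seteqP; split=> [_ [_ [c [[x Sx ->] ->]]]|_ [f Mf <-]].
  have [Mx _] := Sx; exists (c *: e0 + x).
    by apply: (subspaceZD MS) => //; exact: Me0.
  have [_ [_ _ _ Ms]] := shiftableP Sx.
  by rewrite (opT_lin _ Me0 Mx) (opT_shift Mx Ms) [RHS]addrC.
exists (opT (f - l2dot f e0 *: e0)), (l2dot f e0); split.
  have Sf := shiftable_split Mf; exists (f - l2dot f e0 *: e0) => //.
  by have [[Mf' _] [_ [_ _ _ Ms]]] := (Sf, shiftableP Sf); exact: opT_shift.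
have [Mf' _] := shiftable_split Mf.
by rewrite [RHS]addrC -(opT_lin _ Me0 Mf') [_ + (f - _)]addrC subrK.
Qed.

End BoundedBelow.

Section ClosedRange.
Hypothesis range_closed : l2closed (opT @` M).

Lemma range_subspace : closed_subspace (opT @` M).
Proof.
split=> //.
- by move=> _ [f Mf <-]; apply: MH2; exact: opT_M.
- exists 0; first exact: (subspace0 MS).
  have [M0 S0] : M 0 /\ M (shift 0).
    suff -> : shift 0 = 0 :> taylor R by split; exact: (subspace0 MS).
    by apply/funext => -[|n].
  by rewrite opT_shift//; apply/funext => -[|n]; rewrite scaler0 subr0.
- move=> a _ _ [f Mf <-] [g Mg <-]; exists (a *: f + g); first exact: (subspaceZD MS).
  exact: opT_lin.
Qed.

(* The bound on the functional makes the family of such r weakly bounded on the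
   range, which is a Hilbert space. *)
Lemma range_functional_bound : exists2 b : R, 0 <= b & forall r d, 0 <= d ->
  (opT @` M) r -> (forall f, M f -> cmod (l2dot (opT f) r) <= d * l2norm f) ->
  l2norm r <= b * d.
Proof.
pose P := [set r | (opT @` M) r /\ forall f, M f -> cmod (l2dot (opT f) r) <= l2norm f].
have [b Hb] : exists b, forall r, P r -> l2norm r <= b.
  apply: (uniform_boundedness range_subspace) => [r []//|_ [f Mf <-]].
  by exists (l2norm f) => r [_]; exact.
have RH2 := let: And4 H _ _ _ := range_subspace in H.
(* For [d = 0] the vector [r], being in the range, is orthogonal to itself; otherwise [r / d]
   belongs to [P]. *)
exists `|b| => // r d; rewrite le_eqVlt => /orP[/eqP <- [f Mf rE] H|d0 Rr H].
  have r0 : r = 0.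
    apply: l2norm_eq0_dot; first by rewrite -rE; apply: MH2; exact: opT_M.
    apply/eqP; rewrite -cmod_eq0 eq_le cmod_ge0 andbT.
    by have := H f Mf; rewrite rE mul0r.
  by rewrite r0 (H2_0 R).2 mulr0.
have Hr := RH2 _ Rr.
have cE : cmod (Complex d^-1 0) = d^-1 by rewrite cmod_real ger0_norm// invr_ge0 ltW.
have : P (Complex d^-1 0 *: r).
  split=> [|f Mf]; first exact: (subspaceZ range_subspace).
  rewrite l2dotZr//; last by apply: MH2; exact: opT_M.
  by rewrite cmodM cmodJ cE mulrC ler_pdivrMr// mulrC; exact: H.
move=> /Hb; rewrite (H2Z _ Hr).2 cE mulrC ler_pdivrMr// => H'.
by apply: (le_trans H'); rewrite ler_wpM2r ?(ltW d0)// ler_norm.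
Qed.

(** Split [r] into its projection [r1] on the range and a cokernel part. The pairings of [r1] with
    the range are those of [r], hence controlled by [S^* r - conj(lam) r]; the cokernel part is
    controlled by its value at 0, which is [- r1(0)] because [r(0) = 0]. *)
Lemma bounded_below_of_closed_range : exists2 c : R, 0 <= c &
  forall r, M r -> r 0%N = 0 -> l2norm r <= c * l2norm (bshift r - conjc lam *: r).
Proof.
have [b b0 Hb] := range_functional_bound; have [c c0 Hc] := coker_bound.
exists ((1 + c) * b); first by apply: mulr_ge0 => //; rewrite addr_ge0.
move=> r Mr r0; have Hr := MH2 Mr; set s := bshift r - _.
have Hs : H2 s by apply: (H2B (bshift_H2 Hr).1 _).1; exact: (H2Z _ Hr).1.
have [r1 Rr1 rp] := projection range_subspace Hr.
have Mr1 : M r1 by case: Rr1 => f Mf <-; exact: opT_M.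
have Hr1 := MH2 Mr1; have Mr2 : M (r - r1) by exact: (subspaceB MS).
have r2T f : M f -> l2dot (opT f) (r - r1) = 0.
  move=> Mf; rewrite (l2dotC (MH2 Mr2) (MH2 (opT_M Mf))) rp ?conjc0//; exists f.
have n1 : l2norm r1 <= b * l2norm s.
  apply: Hb => //; first exact: l2norm_ge0.
  move=> f Mf; have HT := MH2 (opT_M Mf).
  have -> : l2dot (opT f) r1 = l2dot (opT f) r.
    by apply/esym/eqP; rewrite -subr_eq0 -(l2dotBr HT Hr Hr1) r2T.
  by rewrite opT_dot_vanishing// mulrC; apply: cauchy_schwarz => //; exact: MH2.
have n2 : l2norm (r - r1) <= c * l2norm r1.
  apply: le_trans (Hc _ (conj Mr2 r2T)) _; apply: ler_wpM2l => //.
  rewrite [(r - r1) 0%N](_ : _ = - r1 0%N) ?cmodN; first exact: coef_le.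
  by rewrite -[LHS]/(r 0%N - r1 0%N) r0 sub0r.
have := (H2D Hr1 (MH2 Mr2)).2; rewrite addrC subrK => n3.
apply: (le_trans n3); rewrite -mulrA mulrDl mul1r; apply: lerD => //.
by apply: (le_trans n2); exact: ler_wpM2l.
Qed.

Lemma one_norm : l2norm (one R) = 1.
Proof.
have := l2dot_norm (@one_H2 R); rewrite l2dot_one conjc1 => -[/esym/eqP].
by rewrite sqrf_eq1 => /orP[/eqP//|/eqP E]; have := l2norm_ge0 (one R); rewrite E ler0N1.
Qed.

(* The test functions are h (k_w - 1) with k_w the model kernel at w. *)
Lemma inner_bounded_below : cmod lam = 1 -> exists ep rho : R, [/\ 0 < ep, 0 < rho &
  forall w, disc w -> cmod (w - lam) < rho -> ep <= cmod (eval theta w)].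
Proof.
move=> lam1; have [c c0 Hc] := bounded_below_of_closed_range.
(* If [|theta(w)| < 1/2], the lower bound forces [|k_w| <= b] as soon as [c rho <= 1/2]. On the
   other hand [(1 - |w|^2) |k_w|^2 = 1 - |theta(w)|^2] exceeds [1/2], whereas
   [1 - |w|^2 <= 2 rho = 1 / (2 b^2)]. *)
pose b := 2 + 4 * c; have b0 : 2 <= b by rewrite lerDl mulr_ge0.
pose rho : R := (4 * b ^+ 2)^-1.
have rho0 : 0 < rho by rewrite invr_gt0 mulr_gt0// exprn_gt0// (lt_le_trans _ b0).
exists (1 / 2), rho; split=> // w w1 wl; rewrite leNgt; apply/negP => tw.
set k := model_kernel theta w.
have Kk : model_space theta k := model_kernelP inner_theta w1.
have Kone := one_model inner_theta theta0.
have Kg : model_space theta (k - one R).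
  by rewrite addrC -scaleN1r; exact: model_subspace.
have g0 : (k - one R) 0%N = 0.
  by rewrite -[LHS]/(k 0%N - 1) [k 0%N]model_kernel0 ?subrr.
have r0 : pmul h (k - one R) 0%N = 0.
  by rewrite /pmul big_ord_recl big_ord0 g0 mulr0 addr0.
have := Hc _ (mult_model Kg) r0; rewrite mult_norm//.
have -> : bshift (pmul h (k - one R)) - conjc lam *: pmul h (k - one R) =
    pmul h (bshift k - conjc lam *: (k - one R)).
  have E f g : pmul h (f - conjc lam *: g) = pmul h f - conjc lam *: pmul h g.
    by rewrite [LHS](congr1 _ (addrC _ _)) -scaleNr pmul_lin scaleNr; apply: addrC.
  rewrite E -pmul_bshift//; congr (_ - _); congr pmul; apply/funext => n.
  by rewrite /bshift -[LHS]/(k n.+1 - 0) subr0.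
have Kb' : model_space theta (bshift k) := model_bshift inner_theta Kk.
(* Here the large vector [k] keeps only the small factor [w - lam]; the other two terms have bounded
   norm. *)
have -> : bshift k - conjc lam *: (k - one R) = (conjc (w - lam) *: k + conjc lam *: one R)
   - conjc (eval theta w) *: bshift theta.
  rewrite -(bshift_model_kernel theta w) -/k; apply/funext => n.
  rewrite -[LHS]/(bshift k n - conjc lam * (k n - one R n)).
  rewrite -[RHS]/((conjc (w - lam) * k n + conjc lam * one R n) +
    (bshift k n - conjc w * k n)).
  have -> : conjc (w - lam) = conjc w - conjc lam by exact: rmorphB.
  have E (x y z u v : R[i]) : y - u * (x - z) = ((v - u) * x + u * z) + (y - v * x) by ring.
  exact: E.
rewrite mult_norm; last first.
  rewrite addrC -scaleNr; apply: model_subspace => //; apply: model_subspace => //.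
  rewrite -[_ *: _]addr0; apply: model_subspace => //; split; first exact: (H2_0 R).1.
  by move=> ? _; exact: l2dot0l.
have Hk := KH2 Kk; have H1 := @one_H2 R; have Hb' := KH2 Kb.
have HZk := H2Z (conjc (w - lam)) Hk; have HZ1 := H2Z (conjc lam) H1.
have HZb := H2Z (conjc (eval theta w)) Hb'.
have [_ nb _] := bshift_inner inner_theta theta0.
have n1 := (H2B (H2D HZk.1 HZ1.1).1 HZb.1).2.
have n2 := (H2D HZk.1 HZ1.1).2; have n3 := l2norm_triB Hk H1.
rewrite HZb.2 nb mulr1 cmodJ in n1; rewrite HZk.2 HZ1.2 !cmodJ lam1 one_norm mul1r in n2.
rewrite one_norm in n3 => n4.
have n5 : (1 - cmod w ^+ 2) * l2norm k ^+ 2 = 1 - cmod (eval theta w) ^+ 2.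
  rewrite model_kernel_norm// mulrC divfK// subr_eq0 eq_sym; apply/eqP => E.
  by have : cmod w < 1 := w1; have := cmod_ge0 w; nra.
have w2 : 1 - rho < cmod w.
  have := cmod_triB lam w; rewrite lam1 cmodC => H.
  by have := lt_le_trans wl (lexx _); lra.
have : cmod w < 1 := w1; have t0 := cmod_ge0 (eval theta w); have k0 := l2norm_ge0 k.
have n6 : l2norm k - 1 <= c * (cmod (w - lam) * l2norm k + 1 + cmod (eval theta w)).
  apply: (le_trans n3); apply: (le_trans n4); apply: ler_wpM2l => //.
  by apply: (le_trans n1); rewrite lerD2r.
have rhoE : rho * (4 * b ^+ 2) = 1.
  by rewrite mulVf// lt0r_neq0// mulr_gt0// exprn_gt0// (lt_le_trans _ b0).
move: n5 w2 tw t0 k0 n6 wl (cmod_ge0 (w - lam)) rhoE rho0 b0 c0; rewrite /b.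
move: rho (cmod w) (cmod (eval theta w)) (l2norm k) (cmod (w - lam)).
clear; move=> rho x t n d n5 w2 t1 t0 n0 n6 dr d0 rhoE rho0 b0 c0 x1.
have crho : c * rho * 2 <= 1 by nra.
have n7 : n <= 2 + 4 * c.
  have : c * (d * n) <= c * (rho * n) by apply: ler_wpM2l => //; apply: ler_wpM2r => //; apply: ltW.
  have : c * rho * n * 2 <= n by nra.
  have : c * t * 2 <= c by nra.
  by lra.
have x2 : 1 - x ^+ 2 <= 2 * rho by nra.
have n8 : n ^+ 2 <= (2 + 4 * c) ^+ 2 by nra.
have : (1 - x ^+ 2) * n ^+ 2 <= 2 * rho * n ^+ 2 by rewrite ler_wpM2r ?sqr_ge0.
have : 2 * rho * n ^+ 2 <= 2 * rho * (2 + 4 * c) ^+ 2 by rewrite ler_wpM2l// mulr_ge0// ltW.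
have t2 : t ^+ 2 < 1 / 2 by nra.
by lra.
Qed.

End ClosedRange.

Lemma fredholm_closed_range :
  fredholm M (fun f => compressed_shift M f - lam *: f) <-> l2closed (opT @` M).
Proof.
split=> [[]//|cl]; split=> //; [exact: coker_findim|exact: ker_findim].
Qed.

(** The right-hand side is the common form to which both descriptions of the spectrum of [theta] are
    reduced on the circle. *)
Lemma not_fredholmP : ess_spectrum M (compressed_shift M) lam <->
  cmod lam = 1 /\ forall ep rho : R, 0 < ep -> 0 < rho ->
    exists w, [/\ disc w, cmod (w - lam) < rho & cmod (eval theta w) < ep].
Proof.
rewrite /ess_spectrum /= fredholm_closed_range; split=> [nF|[lam1 H] F]; last first.
  have [ep [rho [ep0 rho0 Hw]]] := inner_bounded_below F lam1.
  have [w [w1 wl]] := H _ _ ep0 rho0.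
  by rewrite ltNge Hw.
have [lam1|lam1] := eqVneq (cmod lam) 1; last first.
  (* Off the circle the isometry of the shift gives [|z g - lam g| >= |1 - |lam|| |g|]. *)
  exfalso; apply: nF; apply: (@closed_range (`|1 - cmod lam|^-1)) => g Kg.
  have Hg := KH2 Kg; have [Hs ns] := shift_H2 Hg; have [Hz nz] := H2Z lam Hg.
  rewrite ler_pdivlMl ?normr_gt0 ?subr_eq0 1?eq_sym//.
  have [n1 n2] := (l2norm_triB Hs Hz, l2norm_triB Hz Hs).
  rewrite [l2norm (lam *: g - _)]l2normBC// ns nz in n1 n2.
  rewrite -[X in _ * X](ger0_norm (l2norm_ge0 g)) -normrM ler_norml mulrBl mul1r n1 andbT.
  by rewrite lerNl opprB.
split=> // ep rho ep0 rho0; apply: contrapT => H; apply: nF.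
have [K HK] : exists K : R, forall z, disc z -> cmod (eval theta z) <= K.
  by case: inner_theta.
have theta_ge z : disc z -> cmod (z - lam) < rho -> ep <= cmod (eval theta z).
  by move=> z1 zl; rewrite leNgt; apply/negP => zt; apply: H; exists z.
apply: (@closed_range (estimate_const (ep / 2) (Num.min 1 (rho / 8)) (K + 1))) => g Kg.
have [Hg g0] := (model_spaceP inner_theta g).1 Kg.
apply: (bounded_below_model (inner_H2 inner_theta)) => //.
by move=> i j; exact: inner_orthonormal.
Qed.

End CompressedShift.

(** * Boundary behaviour of inner functions *)

Section Liminf.
Variable R : realType.

Lemma nbhs_cmodP (lam : Cplx R) (V : set (Cplx R)) :
  nbhs lam V <-> exists2 e : R, 0 < e & forall z, cmod (z - lam) < e -> V z.
Proof.
split=> [/nbhs_ballP[e /gt0_Complex[-> e0] HV]|[e e0 HV]].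
  by eexists; [exact: e0|move=> z zl; apply: HV; rewrite /ball /= cmod_inj_ball cmodC].
apply/nbhs_ballP; exists (Complex e 0); first by rewrite /= Complex_gt0.
by move=> z; rewrite /ball /= cmod_inj_ball cmodC; exact: HV.
Qed.

Lemma liminf_spectrumP (theta : taylor R) (lam : Cplx R) : cmod lam = 1 ->
  liminf_spectrum theta lam <-> forall ep rho : R, 0 < ep -> 0 < rho ->
    exists w, [/\ disc w, cmod (w - lam) < rho & cmod (eval theta w) < ep].
Proof.
move=> lam1; rewrite /liminf_spectrum /= lam1 lexx limf_einfE.
split=> [[_ H] ep rho ep0 rho0|H].
  apply: contrapT => nH; have : (ep%:E <= 0 :> \bar R)%E; last by rewrite lee_fin leNgt ep0.
  rewrite -H; apply: le_ereal_sup_tmp; exists (ereal_inf ((fun z : Cplx R => (cmod (eval theta z))%:E) @`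
      [set z | disc z /\ cmod (z - lam) < rho])).
    exists [set z | disc z /\ cmod (z - lam) < rho] => //.
    by rewrite /within; apply/nbhs_cmodP; exists rho.
  apply: le_ereal_inf_tmp => _ [z [z1 zl] <-]; rewrite lee_fin leNgt; apply/negP => zt.
  by apply: nH; exists z.
split=> //; apply/eqP; rewrite eq_le; apply/andP; split.
  apply: ge_ereal_sup => _ [V FV <-]; apply/lee_addgt0Pr => ep ep0; rewrite add0e.
  have /nbhs_cmodP[rho rho0 HV] := FV.
  have [w [w1 wl wt]] := H _ _ ep0 rho0.
  apply: ge_ereal_inf; exists (cmod (eval theta w))%:E; last by rewrite lee_fin ltW.
  by exists w => //; exact: HV.
apply: le_ereal_sup_tmp; exists (ereal_inf ((fun z : Cplx R => (cmod (eval theta z))%:E) @` setT)).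
  by exists setT => //; exact: filterT.
by apply: le_ereal_inf_tmp => _ [z _ <-]; rewrite lee_fin cmod_ge0.
Qed.

End Liminf.

(** * Singular measures with a linear bound on intervals *)

Section NullSet.
Variable R : realType.
Local Open Scope ereal_scope.

(** [mu] lives on the Lebesgue null set [A], which open intervals of arbitrarily small total length
    cover; the linear bound makes their total [mu]-mass in [G] small. *)
Lemma null_of_interval_bound (mu : {measure set (measurableTypeR R) -> \bar R})
    (G A : set (measurableTypeR R)) (c d : R) :
  measurable G -> measurable A -> (0 <= c)%R -> (0 < d)%R ->
  (forall a b : R, (a < b)%R -> (b - a < d)%R -> mu (`]a, b[%classic `&` G) <= (c * (b - a))%:E) ->
  @lebesgue_measure R A = 0 -> mu (~` A) = 0 -> mu G = 0.
Proof.
move=> mG mA c0 d0 H A0 A0'.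
suff AG0 : mu (A `&` G) <= 0.
  apply/eqP; rewrite eq_le measure_ge0 andbT.
  have -> : G = (A `&` G) `|` (~` A `&` G).
    by rewrite -setIUl setUv setTI.
  apply: le_trans (measureU2 _ _ _) _; [exact: measurableI|apply: measurableI => //; exact: measurableC|].
  rewrite -[X in _ <= X]adde0; apply: leeD => //; rewrite -A0'.
  by apply: le_measure; rewrite ?inE;
    [apply: measurableI => //; exact: measurableC|exact: measurableC|exact: subIsetl].
have small (e : R) : (0 < e)%R -> (e <= d)%R -> mu (A `&` G) <= (c * e)%:E.
  move=> e0 ed; have : (wlength idfun)^*%mu A < e%:E.
    by rewrite [ltLHS](_ : _ = lebesgue_measure A)// A0 lte_fin.
  rewrite outer_measure_open_itv_cover => /ereal_inf_lt[_ [F [FI AF] <-] Fe].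
  have lE (a b : R) : wlength idfun `]a, b[%classic = if (a < b)%R then (b - a)%:E else 0.
    by rewrite wlength_itv /= lte_fin EFinB.
  have l0 k : 0 <= wlength idfun (F k).
    have [[a b] ->] := FI k; rewrite lE/=; case: ifP => // ab.
    by rewrite lee_fin subr_ge0 ltW.
  have mF k : measurable (F k : set (measurableTypeR R)).
    by have [[a b] ->] := FI k; exact: measurable_itv.
  have Hk k : mu (F k `&` G) <= c%:E * wlength idfun (F k).
    (* Each interval is shorter than the whole cover, hence than [e <= d], so the hypothesis applies
       to it. *)
    have lk : wlength idfun (F k) < e%:E.
      apply: le_lt_trans Fe; rewrite (nneseriesD1 (fun i _ => l0 i) (n := k))//.
      by rewrite leeDl; last by apply: nneseries_ge0 => i _ _; exact: l0.
    move: lk; have [[a b] ->] := FI k; rewrite lE /=; case: ifPn => [ab|].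
      by rewrite lte_fin => be; rewrite -EFinM; apply: H => //; exact: lt_le_trans ed.
    rewrite -leNgt => ba _; rewrite mule0 (_ : `]a, b[%classic = set0) ?set0I ?measure0//.
    by rewrite set_itv_ge// bnd_simp -leNgt.
  apply: (@le_trans _ _ (\sum_(k <oo) mu (F k `&` G))).
    apply: measure_sigma_subadditive => //.
    - by move=> k; exact: measurableI.
    - exact: measurableI.
    - by rewrite -setI_bigcupl; exact: setSI.
  apply: (@le_trans _ _ (\sum_(k <oo) (c%:E * wlength idfun (F k)))).
    by apply: lee_nneseries => // k _.
  by rewrite nneseriesZl// EFinM lee_wpmul2l// ltW.
apply/lee_addgt0Pr => e e0; rewrite add0e.
have c1 : (0 < c + 1)%R by rewrite ltr_wpDl.
have m0 : (0 < Num.min d (e / (c + 1)))%R by rewrite lt_min d0 divr_gt0.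
have md : (Num.min d (e / (c + 1)) <= d)%R by rewrite ge_min lexx.
apply: (le_trans (small _ m0 md)).
rewrite lee_fin; apply: (@le_trans _ _ (c * (e / (c + 1)))%R).
  by rewrite ler_wpM2l// ge_min lexx orbT.
by rewrite mulrCA ger_pMr// ler_pdivrMr// mul1r lerDl.
Qed.
End NullSet.

(** * Blaschke products *)

Section Blaschke.
Variable R : realType.
Notation C := (Cplx R).

Lemma prod_ge_sub (I : Type) (r : seq I) (x : I -> R) :
  (forall i, 0 <= x i <= 1) -> 1 - \sum_(i <- r) x i <= \prod_(i <- r) (1 - x i) <= 1.
Proof.
move=> H; elim: r => [|i r IH]; first by rewrite !big_nil subr0 lexx.
rewrite !big_cons; have p0 : 0 <= \prod_(j <- r) (1 - x j).
  by apply: prodr_ge0 => j _; have := H j; rewrite subr_ge0 => /andP[].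
have : 0 <= \sum_(j <- r) x j by apply: sumr_ge0 => j _; have /andP[] := H j.
move: p0 IH => + + s0; move: s0 (H i); move: (\prod_(j <- r) _) (\sum_(j <- r) _) (x i).
by move=> p s y s0 /andP[? ?] p0 /andP[? ?]; apply/andP; split; nra.
Qed.

Lemma one_sub_conjc_ge (c z : R[i]) : cmod c < 1 -> 1 - cmod z <= cmod (1 - conjc c * z).
Proof.
move=> c1; have := cmod_triB 1 (conjc c * z); rewrite cmod1 cmodM cmodJ.
by apply: le_trans; rewrite lerD2l lerN2 ler_piMl ?cmod_ge0// ltW.
Qed.

(** The pseudohyperbolic identity [|1 - conj(c) z|^2 - |c - z|^2 = (1 - |c|^2) (1 - |z|^2)]. *)
Lemma blaschke_factor_sq (c z : R[i]) : cmod c < 1 -> cmod z < 1 ->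
  1 - cmod (blaschke_factor c z) ^+ 2 =
  (1 - cmod c ^+ 2) * (1 - cmod z ^+ 2) / cmod (1 - conjc c * z) ^+ 2.
Proof.
move=> c1 z1; rewrite /blaschke_factor; case: eqVneq => [->|c0].
  by rewrite conjc0 mul0r subr0 cmod0 cmod1 !expr1n expr0n /= subr0 mul1r divr1.
have d0 : cmod (1 - conjc c * z) != 0.
  by rewrite gt_eqF// (lt_le_trans _ (one_sub_conjc_ge z c1))// subr_gt0.
have -> : cmod (Complex (cmod c) 0 / c * ((c - z) / (1 - conjc c * z))) ^+ 2 =
    cmod (c - z) ^+ 2 / cmod (1 - conjc c * z) ^+ 2.
  rewrite !cmodM !cmodV cmod_real ger0_norm ?cmod_ge0//.
  by rewrite divff ?mul1r ?expr_div_n// cmod_eq0.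
have -> : (1 - cmod c ^+ 2) * (1 - cmod z ^+ 2) = cmod (1 - conjc c * z) ^+ 2 - cmod (c - z) ^+ 2.
  rewrite !cmod_sqE !(RecB, ImcB, RecM, ImcM) /=.
  by case: c z {c1 z1 c0 d0} => [a b] [x y] /=; ring.
by rewrite mulrBl divff// expf_eq0.
Qed.

Lemma blaschke_factor_le1 (c z : R[i]) : cmod c < 1 -> cmod z < 1 -> cmod (blaschke_factor c z) <= 1.
Proof.
move=> c1 z1; have := blaschke_factor_sq c1 z1.
have : 0 <= (1 - cmod c ^+ 2) * (1 - cmod z ^+ 2) / cmod (1 - conjc c * z) ^+ 2.
  apply: divr_ge0; last exact: sqr_ge0.
  by have c0 := cmod_ge0 c; have z0 := cmod_ge0 z; apply: mulr_ge0; nra.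
by have := cmod_ge0 (blaschke_factor c z); nra.
Qed.

(** For [c <> 0] the difference is [(1 - |c|) (c + |c| z) / (c (1 - conj(c) z))]; the unimodular
    normalization of the factor is what produces [1 - |c|]. *)
Lemma one_sub_blaschke_factor (c z : R[i]) : cmod c < 1 -> cmod z < 1 ->
  cmod (1 - blaschke_factor c z) <= (1 - cmod c) * (2 / (1 - cmod z)).
Proof.
move=> c1 z1; have z1' : 0 < 1 - cmod z by rewrite subr_gt0.
rewrite /blaschke_factor; case: eqVneq => [->|c0].
  rewrite cmod0 subr0 mul1r ler_pdivlMr//.
  by have := cmodB 1 z; rewrite cmod1; have := cmod_ge0 z; have := cmod_ge0 (1 - z); nra.
have dge := one_sub_conjc_ge z c1; have dgt := lt_le_trans z1' dge.
have d0 : 1 - conjc c * z != 0 by rewrite -cmod_gt0.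
have cp : 0 < cmod c by rewrite cmod_gt0.
have -> : 1 - Complex (cmod c) 0 / c * ((c - z) / (1 - conjc c * z)) =
    Complex (1 - cmod c) 0 * (c + Complex (cmod c) 0 * z) / (c * (1 - conjc c * z)).
  have E : c * conjc c = Complex (cmod c) 0 * Complex (cmod c) 0.
    by rewrite mul_conjc; apply/eqP; rewrite eq_complex /=; apply/andP; split; apply/eqP; ring.
  have -> : Complex (1 - cmod c) 0 = 1 - Complex (cmod c) 0.
    by apply/eqP; rewrite eq_complex /=; apply/andP; split; apply/eqP; ring.
  move: E c0 d0; move: (Complex (cmod c) 0) (conjc c) => r c' E c0 d0.
  have -> : 1 - r / c * ((c - z) / (1 - c' * z)) = (c * (1 - c' * z) - r * (c - z)) / (c * (1 - c' * z)).
    by field; rewrite d0 c0.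
  by congr (_ / _); rewrite mulrBr mulr1 mulrA E; ring.
have c1' : 0 <= 1 - cmod c by rewrite subr_ge0 ltW.
rewrite !cmodM cmodV cmodM cmod_real ger0_norm//.
rewrite -mulrA; apply: ler_wpM2l => //.
have : cmod (c + Complex (cmod c) 0 * z) <= cmod c * 2.
  apply: (le_trans (cmodD _ _)); rewrite cmodM cmod_real ger0_norm ?cmod_ge0//.
  by nra.
move=> H; rewrite ler_pdivrMr ?mulr_gt0//; apply: (le_trans H).
by rewrite mulrCA ler_wpM2l ?cmod_ge0// -mulrA ler_peMr// mulrC ler_pdivlMr ?mul1r.
Qed.

End Blaschke.

Section BlaschkeProduct.
Variable R : realType.
Notation C := (Cplx R).
Variable a : nat -> option C.
Hypothesis Ha : blaschke_zeros a.

Let fac (o : option C) (z : C) : C := if o is Some c then blaschke_factor c z else 1.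
Let w k : R := if a k is Some c then 1 - cmod c else 0.

Let w0 k : 0 <= w k.
Proof.
rewrite /w; case E: (a k) => [c|//]; rewrite subr_ge0 ltW//.
by have [+ _] := Ha; move=> /(_ _ _ E).
Qed.

Let wS n : \sum_(k < n) w k <= limn (series w).
Proof.
have [_ wc] := Ha; rewrite -(big_mkord xpredT) -[leLHS]/(series w n).
apply: nondecreasing_cvgn_le => //.
by apply/nondecreasing_seqP => m; rewrite /series /= big_nat_recr//= lerDl.
Qed.

(** The partial products have modulus at most 1, so their increments are dominated by the summable
    [1 - |c|] and the telescoping series converges absolutely. *)
Lemma blaschke_cvg (z : C) : cmod z < 1 ->
  (\prod_(k < n) fac (a k) z : C) @[n --> \oo] --> blaschke a z.
Proof.
move=> z1; pose u n : C := \prod_(k < n) fac (a k) z.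
have u1 n : cmod (u n) <= 1.
  elim: n => [|n IH]; rewrite /u ?big_ord0 ?cmod1// big_ord_recr/= cmodM.
  rewrite mulr_ile1 ?cmod_ge0// /fac; case E: (a n) => [c|]; last by rewrite cmod1.
  by apply: blaschke_factor_le1 => //; have [+ _] := Ha; move=> /(_ _ _ E).
have ud n : cmod (u n.+1 - u n) <= 2 / (1 - cmod z) * w n.
  have -> : u n.+1 - u n = - (u n * (1 - fac (a n) z)).
    by rewrite /u big_ord_recr /=; ring.
  rewrite cmodN cmodM; apply: (@le_trans _ _ (cmod (1 - fac (a n) z))).
    by rewrite ler_piMl ?cmod_ge0.
  rewrite /fac /w; case E: (a n) => [c|]; last by rewrite subrr cmod0 mulr0.
  rewrite mulrC; apply: one_sub_blaschke_factor => //.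
  by have [+ _] := Ha; move=> /(_ _ _ E).
have K0 : 0 <= 2 / (1 - cmod z) by rewrite divr_ge0// subr_ge0 ltW.
have dc : cvgn (series (fun n => u n.+1 - u n : C)).
  apply: abs_cvg_series; apply: (@series_le_cvg _ _ (fun n => 2 / (1 - cmod z) * w n)) => [n|n|n|].
  - exact: cmod_ge0.
  - exact: mulr_ge0.
  - exact: ud.
  - by have [_ wc] := Ha; exact: is_cvg_seriesZ.
suff /cvg_ex[l ul] : cvgn (u : nat -> C) by rewrite /blaschke (cvg_lim _ ul).
have -> : u = (fun n => series (fun n => u n.+1 - u n : C) n + 1 : C).
  apply/funext => n; rewrite [LHS](eq_sum_telescope (u : nat -> C) n) addrC.
  by congr (_ + _); rewrite /u big_ord0.
have /cvg_ex[l dl] := dc; apply/cvg_ex; exists (l + 1).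
exact: (cvgD dl (cvg_cst _)).
Qed.

Lemma blaschke_le1 (z : C) : cmod z < 1 -> cmod (blaschke a z) <= 1.
Proof.
move=> z1; apply: (cvg_le_bound (cvg_cmod (blaschke_cvg z1))) => n.
elim: n => [|n IH]; first by rewrite big_ord0 cmod1.
rewrite big_ord_recr/= cmodM mulr_ile1 ?cmod_ge0// /fac; case E: (a n) => [c|]; last by rewrite cmod1.
by apply: blaschke_factor_le1 => //; have [+ _] := Ha; move=> /(_ _ _ E).
Qed.

Lemma blaschke_zero (c : C) n : a n = Some c -> blaschke a c = 0.
Proof.
move=> ac; have c1 : cmod c < 1 by have [+ _] := Ha; move=> /(_ _ _ ac).
have p0 : (\prod_(k < m) fac (a k) c : C) @[m --> \oo] --> (0 : C).
  apply/cvg_cmodP => e e0; near=> m.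
  have nm : (n < m)%N by near: m; exact: nbhs_infty_gt.
  rewrite (bigD1 (Ordinal nm)) //= ac /fac /blaschke_factor subr0 cmodM.
  by case: eqVneq => [->|_]; rewrite ?subrr ?mul0r ?mulr0 ?cmod0 ?mul0r.
exact: (cvg_unique _ (blaschke_cvg c1) p0).
Unshelve. all: by end_near. Qed.

(** With the zeros away from [lam], the sum of [1 - |b_c(z)|^2] is at most a multiple of
    [1 - |z| <= |z - lam|], and the product is at least 1 minus this sum. *)
Lemma blaschke_ge (lam : C) (rho : R) : cmod lam = 1 -> 0 < rho ->
  (forall n c, a n = Some c -> rho <= cmod (c - lam)) ->
  exists2 d : R, 0 < d & forall z, cmod z < 1 -> cmod (z - lam) < d ->
    1 / 2 <= cmod (blaschke a z) ^+ 2.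
Proof.
move=> lam1 rho0 Hrho; pose S := limn (series w).
have S0 : 0 <= S by have := wS 0; rewrite big_ord0.
(* One factor 4 comes from [|1 - conj(c) z| >= rho / 2], the other from
   [(1 + |c|) (1 + |z|) <= 4]. *)
pose K := 16 / rho ^+ 2; have K0 : 0 < K by rewrite divr_gt0// exprn_gt0.
have KS : 0 < 2 * K * (S + 1) by apply: mulr_gt0; [exact: mulr_gt0|rewrite ltr_wpDl].
exists (Num.min (rho / 2) (2 * K * (S + 1))^-1).
  by rewrite lt_min divr_gt0//= invr_gt0.
move=> z z1; rewrite lt_min => /andP[zl1 zl2].
pose x (o : option C) : R := 1 - cmod (fac o z) ^+ 2.
have xb k : 0 <= x (a k) <= 1 /\ x (a k) <= K * (1 - cmod z) * w k.
  rewrite /x /w /fac; case E: (a k) => [c|]; last by rewrite cmod1 expr1n subrr mulr0 lexx ler01.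
  have c1 : cmod c < 1 by have [+ _] := Ha; move=> /(_ _ _ E).
  have b1 := blaschke_factor_le1 c1 z1; have b0 := cmod_ge0 (blaschke_factor c z).
  split; first by apply/andP; split; nra.
  rewrite blaschke_factor_sq//.
  have dge : rho / 2 <= cmod (1 - conjc c * z).
    have -> : 1 - conjc c * z = conjc (lam - c) * lam - conjc c * (z - lam).
      have -> : conjc (lam - c) = conjc lam - conjc c by exact: rmorphB.
      have E1 : conjc lam * lam = 1 by rewrite mulrC mul_conjc lam1 expr1n.
      by rewrite mulrBl E1; ring.
    have := cmod_triB (conjc (lam - c) * lam) (conjc c * (z - lam)).
    rewrite !cmodM !cmodJ lam1 mulr1 [cmod (lam - c)]cmodC; apply: le_trans.
    have : cmod c * cmod (z - lam) <= cmod (z - lam) by rewrite ler_piMl ?cmod_ge0// ltW.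
    by have := Hrho _ _ E; move: zl1; lra.
  have d0 : 0 < cmod (1 - conjc c * z) by apply: lt_le_trans dge; rewrite divr_gt0.
  rewrite ler_pdivrMr ?exprn_gt0// /K.
  have D2 : rho ^+ 2 / 4 <= cmod (1 - conjc c * z) ^+ 2.
    have -> : rho ^+ 2 / 4 = (rho / 2) ^+ 2 by field.
    by apply: lerXn2r => //; rewrite nnegrE ?cmod_ge0// divr_ge0 ?(ltW rho0).
  apply: (@le_trans _ _ (16 / rho ^+ 2 * (1 - cmod z) * (1 - cmod c) * (rho ^+ 2 / 4))); last first.
    apply: ler_wpM2l => //; apply: mulr_ge0; last by rewrite subr_ge0 ltW.
    by apply: mulr_ge0; [rewrite divr_ge0// exprn_ge0// ltW|rewrite subr_ge0 ltW].
  have -> : 16 / rho ^+ 2 * (1 - cmod z) * (1 - cmod c) * (rho ^+ 2 / 4) = 4 * ((1 - cmod z) * (1 - cmod c)).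
    by field; rewrite lt0r_neq0.
  have := cmod_ge0 c; have := cmod_ge0 z; move: c1 z1; move: (cmod c) (cmod z).
  clear; move=> c z c1 z1 z0 c0.
  have -> : (1 - c ^+ 2) * (1 - z ^+ 2) = ((1 - z) * (1 - c)) * ((1 + z) * (1 + c)) by ring.
  by rewrite mulrC ler_wpM2r ?mulr_ge0 ?subr_ge0 ?(ltW c1) ?(ltW z1)//; nra.
have H := cvg_sqr (cvg_cmod (blaschke_cvg z1)).
rewrite -(cvg_lim _ H)//; apply: limr_ge; first by apply/cvg_ex; eexists; exact: H.
apply: nearW => n.
have -> : cmod (\prod_(k < n) fac (a k) z) ^+ 2 = \prod_(k < n) (1 - x (a k)).
  elim: n => [|n IH]; first by rewrite !big_ord0 cmod1 expr1n.
  by rewrite !big_ord_recr /= cmodM exprMn IH /x subKr.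
have xk (k : 'I_n) : 0 <= x (a k) <= 1 := (xb k).1.
have /andP[+ _] := prod_ge_sub (index_enum 'I_n) xk; apply: le_trans.
have s1 : \sum_(k < n) x (a k) <= K * (1 - cmod z) * S.
  apply: (@le_trans _ _ (\sum_(k < n) (K * (1 - cmod z) * w k))).
    by apply: ler_sum => k _; exact: (xb k).2.
  by rewrite -mulr_sumr ler_wpM2l// mulr_ge0 ?subr_ge0 ?ltW.
have zl : 1 - cmod z <= cmod (z - lam) by have := cmod_triB lam z; rewrite lam1 cmodC.
have e1 : (1 - cmod z) * (2 * K * (S + 1)) <= 1.
  rewrite -ler_pdivlMr// mul1r; apply: (le_trans zl); exact: ltW.
have z1' : 0 <= 1 - cmod z by rewrite subr_ge0 ltW.
have : K * (1 - cmod z) * S * 2 <= 1.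
  apply: le_trans e1; rewrite (_ : K * (1 - cmod z) * S * 2 = (1 - cmod z) * (2 * K * S)); last by ring.
  by rewrite ler_wpM2l// ler_wpM2l ?lerDl// mulr_ge0// ltW.
by lra.
Qed.
End BlaschkeProduct.

(** * Poisson integrals and the singular factor *)

Section Singular.
Variable R : realType.
Notation C := (Cplx R).

Definition poisson (z : C) (t : R) : R := (1 - cmod z ^+ 2) / cmod (expi t - z) ^+ 2.

Lemma expi_sub_ge (z : C) t : 1 - cmod z <= cmod (expi t - z).
Proof. by rewrite -[1](cmod_expi t); exact: cmod_triB. Qed.

Lemma herglotz_Re (z : C) t : cmod z < 1 -> complex.Re (herglotz_kernel z t) = poisson z t.
Proof.
move=> z1; have wp : 0 < cmod (expi t - z).
  by apply: lt_le_trans (expi_sub_ge z t); rewrite subr_gt0.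
have w0 : (expi t - z : R[i]) != 0 by rewrite -cmod_gt0.
have wV : (expi t - z : R[i])^-1 = conjc (expi t - z) * Complex (cmod (expi t - z) ^- 2) 0.
  apply: (mulfI w0); rewrite divff// mulrA mul_conjc; apply/eqP; rewrite eq_complex /=.
  by rewrite !mulr0 subr0 mul0r addr0 divff ?eqxx// expf_neq0// gt_eqF.
rewrite /herglotz_kernel wV mulrA /poisson -[1](expr1n _ 2) -[X in _ = (X ^+ 2 - _) / _](cmod_expi t).
rewrite (cmod_sqE (expi t)) (cmod_sqE z); move: (cmod _ ^- 2) => r.
by rewrite !RecM /=; case: z {z1 wp w0 wV} => a b /=; ring.
Qed.

Lemma poisson_ge0 (z : C) t : cmod z < 1 -> 0 <= poisson z t.
Proof.
by move=> z1; apply: divr_ge0; [have := cmod_ge0 z; nra|exact: sqr_ge0].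
Qed.

Lemma cmod_expi_sub_continuous (z : C) : continuous (fun t : R => cmod (expi t - z) ^+ 2).
Proof.
move=> t; have E s : cmod (expi s - z) ^+ 2 =
    (cos s - complex.Re z) * (cos s - complex.Re z) +
    (sin s - complex.Im z) * (sin s - complex.Im z).
  by rewrite cmod_sqE RecB ImcB /= !expr2.
rewrite /continuous_at E; under eq_fun do rewrite E.
have cc : cos s - complex.Re z @[s --> t] --> cos t - complex.Re z.
  by apply: cvgB; [exact: continuous_cos|exact: cvg_cst].
have cs : sin s - complex.Im z @[s --> t] --> sin t - complex.Im z.
  by apply: cvgB; [exact: continuous_sin|exact: cvg_cst].
exact: (cvgD (cvgM cc cc) (cvgM cs cs)).
Qed.

Lemma poisson_continuous (z : C) : cmod z < 1 -> continuous (poisson z).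
Proof.
move=> z1 t; apply: cvgM; first exact: cvg_cst.
apply: cvgV; last exact: cmod_expi_sub_continuous.
by rewrite expf_neq0// gt_eqF// (lt_le_trans _ (expi_sub_ge z t))// subr_gt0.
Qed.

Lemma poisson_measurable (z : C) : cmod z < 1 ->
  measurable_fun setT (fun t : measurableTypeR R => (poisson z t)%:E).
Proof.
move=> z1; apply/measurable_EFinP; apply: continuous_measurable_fun.
exact: poisson_continuous.
Qed.

Section Integral.
Variable mu : {finite_measure set (measurableTypeR R) -> \bar R}.

Definition poisson_int (z : C) : \bar R := \int[mu]_(t in setT) (poisson z t)%:E.

Lemma singular_norm (z : C) : cmod z < 1 ->
  cmod (singular_inner mu z) = expR (- fine (poisson_int z)).
Proof.
move=> z1; rewrite /singular_inner /cexp cmodM cmod_real cmod_expi mulr1 ger0_norm ?expR_ge0//=.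
congr (expR (- fine _)); apply: eq_integral => t _.
by rewrite herglotz_Re.
Qed.

Lemma poisson_int_le (z : C) (k : R) (N : set (measurableTypeR R)) : cmod z < 1 -> 0 <= k ->
  measurable N -> mu N = 0%E -> (forall t, ~ N t -> poisson z t <= k) ->
  (poisson_int z <= k%:E * mu setT)%E.
Proof.
move=> z1 k0 mN N0 Hk; rewrite -integral_cst//; apply: ae_ge0_le_integral => //.
- by move=> t _; rewrite lee_fin poisson_ge0.
- exact: poisson_measurable.
exists N; split=> // t /=; apply: contra_notP => Nt _.
by rewrite lee_fin Hk.
Qed.

Lemma poisson_int_fin (z : C) : cmod z < 1 -> poisson_int z \is a fin_num.
Proof.
move=> z1; have k0 : 0 <= (1 - cmod z ^+ 2) / (1 - cmod z) ^+ 2.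
  by apply: divr_ge0; [have := cmod_ge0 z; nra|exact: sqr_ge0].
rewrite ge0_fin_numE; last by apply: integral_ge0 => t _; rewrite lee_fin poisson_ge0.
have H t : poisson z t <= (1 - cmod z ^+ 2) / (1 - cmod z) ^+ 2.
  apply: ler_wpM2l; first by have := cmod_ge0 z; nra.
  have e1 := expi_sub_ge z t; have z1' : 0 < 1 - cmod z by rewrite subr_gt0.
  have e0 := lt_le_trans z1' e1.
  rewrite lef_pV2 ?posrE ?exprn_gt0//.
  by apply: lerXn2r => //; rewrite nnegrE ltW.
apply: (le_lt_trans (poisson_int_le z1 k0 measurable0 (measure0 mu) (fun t _ => H t))).
by apply: lte_mul_pinfty => //; rewrite -?ge0_fin_numE ?fin_num_measure.
Qed.

Lemma poisson_int_ge (z : C) (k : R) (I : set (measurableTypeR R)) : cmod z < 1 -> 0 <= k ->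
  measurable I -> (forall t, I t -> k <= poisson z t) -> (k%:E * mu I <= poisson_int z)%E.
Proof.
move=> z1 k0 mI Hk; rewrite -integral_cst//.
have p0 t : (0 <= (poisson z t)%:E)%E by rewrite lee_fin poisson_ge0.
have H2 : (\int[mu]_(t in I) (poisson z t)%:E <= poisson_int z)%E.
  by apply: ge0_subset_integral => //; exact: poisson_measurable.
apply: le_trans H2; apply: ge0_le_integral => //.
by apply: measurable_funTS; exact: poisson_measurable.
Qed.

End Integral.
End Singular.

(** * The spectrum read off from the canonical factorization *)

Section FactorSpectrum.
Variable R : realType.
Notation C := (Cplx R).

Lemma expi_dist (s t : R) : `|t - s| <= 1 -> cmod (expi t - expi s) <= 3 * `|t - s|.
Proof.
wlog st : s t / s <= t.
  move=> H; case: (leP s t) => [|/ltW ts]; first exact: H.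
  by rewrite distrC cmodC; exact: H.
rewrite ger0_norm ?subr_ge0// => ts.
have -> : expi t - expi s = expi s * (expi (t - s) - 1) :> R[i].
  by rewrite mulrBr mulr1 -expiD [s + _]addrC subrK.
by rewrite cmodM cmod_expi mul1r; apply: expi_sub1_le; rewrite ?subr_ge0.
Qed.

Lemma arc_measurable (lam : C) (e : R) : 0 < e ->
  measurable ([set t | cmod (expi t - lam) < e] : set (measurableTypeR R)).
Proof.
move=> e0; have -> : [set t | cmod (expi t - lam) < e] =
    (fun t : measurableTypeR R => cmod (expi t - lam) ^+ 2) @^-1` `]-oo, e ^+ 2[%classic.
  apply/seteqP; split=> t /=; rewrite in_itv /= => H.
    by rewrite ltrXn2r ?nnegrE ?cmod_ge0 ?(ltW e0).
  by have := cmod_ge0 (expi t - lam); nra.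
rewrite -[X in measurable X]setTI; apply: continuous_measurable_fun => //.
exact: cmod_expi_sub_continuous.
Qed.

Section SingularLower.
Variable mu : {finite_measure set (measurableTypeR R) -> \bar R}.

(* At z = (1 - d) e^{i t0} the Poisson kernel is at least 1/(16 d) on the arc of
   half-length d around e^{i t0}. *)
Lemma arc_null (lam : C) (c rho : R) : cmod lam = 1 -> 0 < rho ->
  singular_circle_measure mu ->
  (forall z : C, cmod z < 1 -> cmod (z - lam) < rho -> (poisson_int mu z <= c%:E)%E) ->
  mu [set t | cmod (expi t - lam) < rho / 2] = 0%E.
Proof.
move=> lam1 rho0 [_ [A [mA A0 A0']]] H.
have rho2 : 0 < rho / 2 by rewrite divr_gt0.
have mG := arc_measurable lam rho2; set G := [set t | _] in mG *.
(* An interval of length [d < rho / 2] meeting [G] at [t0] puts [z] within [d + rho / 2 < rho] of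
   [lam]; one that misses [G] contributes nothing. *)
apply: (@null_of_interval_bound _ mu G A (16 * `|c|) (Num.min 1 (rho / 2))) => //.
- by rewrite lt_min ltr01.
move=> a b ab; rewrite lt_min => /andP[d1 drho].
have [[t0 [/= + Gt0]]|nE] := pselect (exists t, (`]a, b[%classic `&` G) t); last first.
  rewrite (_ : _ `&` _ = set0) ?measure0; last first.
    by rewrite -subset0 => t Gt; apply: nE; exists t.
  by rewrite lee_fin !mulr_ge0 ?subr_ge0 ?(ltW ab).
rewrite in_itv /= => /andP[at0 t0b].
move: ab d1 drho; set d := b - a => ab d1 drho; have d0 : 0 < d by rewrite subr_gt0.
pose z : C := Complex (1 - d) 0 * expi t0.
have cz : cmod z = 1 - d by rewrite cmodM cmod_expi mulr1 cmod_real ger0_norm// subr_ge0 ltW.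
have z1 : cmod z < 1 by rewrite cz gtrBl.
have zt0 : cmod (z - expi t0) = d.
  rewrite (_ : z - expi t0 = Complex (- d) 0 * expi t0 :> R[i]).
    by rewrite cmodM cmod_expi mulr1 cmod_real normrN ger0_norm// ltW.
  by apply/eqP; rewrite eq_complex /=; apply/andP; split; apply/eqP; ring.
have zl : cmod (z - lam) < rho.
  rewrite (_ : z - lam = (z - expi t0) + (expi t0 - lam) :> R[i]); last by ring.
  by apply: (le_lt_trans (cmodD _ _)); rewrite zt0; have : cmod (expi t0 - lam) < rho / 2 := Gt0; lra.
have k0 : 0 < (16 * d)^-1 by rewrite invr_gt0 mulr_gt0.
have Pk t : (`]a, b[%classic : set (measurableTypeR R)) t -> (16 * d)^-1 <= poisson z t.
  rewrite /= in_itv /= => /andP[ta tb].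
  have tt0 : `|t - t0| < d by rewrite ltr_norml; apply/andP; split; rewrite /d; lra.
  have tz : cmod (expi t - z) <= 4 * d.
    rewrite (_ : expi t - z = (expi t - expi t0) - (z - expi t0) :> R[i]); last by ring.
    apply: (le_trans (cmodB _ _)); rewrite zt0.
    have := expi_dist (ltW (lt_trans tt0 d1)); move: tt0; lra.
  have tz0 : 0 < cmod (expi t - z).
    by apply: lt_le_trans (expi_sub_ge z t); rewrite cz; lra.
  (* The numerator is [1 - (1 - d)^2 >= d] and the denominator at most [(4 d)^2]. *)
  rewrite /poisson cz ler_pdivlMr ?exprn_gt0// ler_pdivrMl ?mulr_gt0//.
  by move: tz tz0; move: (cmod _) => x tz tz0; nra.
apply: (@le_trans _ _ (mu (`]a, b[%classic : set (measurableTypeR R)))).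
  by apply: le_measure; rewrite ?inE;
    [apply: measurableI => //; exact: measurable_itv|exact: measurable_itv|exact: subIsetl].
have := poisson_int_ge mu z1 (ltW k0) (measurable_itv `]a, b[) Pk.
have mfin : mu (`]a, b[%classic : set (measurableTypeR R)) \is a fin_num.
  by apply: fin_num_measure; exact: measurable_itv.
move=> /le_trans/(_ (H z z1 zl)); rewrite -(fineK mfin) -EFinM !lee_fin.
rewrite ler_pdivrMl ?mulr_gt0// => Hm; apply: (le_trans Hm).
by rewrite [leRHS]mulrAC; apply: ler_wpM2l; [rewrite mulr_ge0// ltW|exact: ler_norm].
Qed.

End SingularLower.

Section Factorization.
Variables (theta : taylor R) (y : R) (a : nat -> option C).
Variable mu : {finite_measure set (measurableTypeR R) -> \bar R}.
Hypothesis fact : canonical_factorization theta y a mu.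

Let Ba : blaschke_zeros a. Proof. by case: fact. Qed.
Let evalE z : disc z -> eval theta z = expi y * blaschke a z * singular_inner mu z.
Proof. by case: fact => _ _; apply. Qed.

Let cmod_eval z : cmod z < 1 ->
  cmod (eval theta z) = cmod (blaschke a z) * expR (- fine (poisson_int mu z)).
Proof. by move=> z1; rewrite evalE// [LHS]cmodM singular_norm// cmodM cmod_expi mul1r. Qed.

(** As [|B| <= 1], a bound [|theta| >= ep] near [lam] bounds the Poisson integral by [- ln ep]; the
    arc around [lam] would then be [mu]-null. *)
Lemma supp_liminf (lam : C) (ep rho : R) : circle_supp mu lam -> 0 < ep -> 0 < rho ->
  exists w, [/\ disc w, cmod (w - lam) < rho & cmod (eval theta w) < ep].
Proof.
move=> [lam1 supp] ep0 rho0; apply: contrapT => H.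
have : (0 < mu [set t | (cmod (expi t - lam) < rho / 2)%R])%E by apply: supp; rewrite divr_gt0.
rewrite (@arc_null mu lam (- ln ep) rho) ?ltxx//; first by case: fact.
move=> z z1 zl; have /fineK <- := poisson_int_fin mu z1.
rewrite lee_fin lerNr -ler_expR lnK ?posrE//.
have : ep <= cmod (eval theta z).
  by rewrite leNgt; apply/negP => ze; apply: H; exists z.
move=> /le_trans; apply; rewrite cmod_eval//.
by rewrite ler_piMl ?expR_ge0// blaschke_le1.
Qed.

Lemma zeros_liminf (lam : C) (ep rho : R) :
  closure [set c : C | exists n, a n = Some c] lam -> 0 < ep -> 0 < rho ->
  exists w, [/\ disc w, cmod (w - lam) < rho & cmod (eval theta w) < ep].
Proof.
move=> cl ep0 rho0.
have [c [[n an] cl1]] : [set c : C | exists n, a n = Some c] `&` [set c | cmod (c - lam) < rho] !=set0.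
  by apply: cl; apply/nbhs_cmodP; exists rho.
have c1 : disc c by have [+ _] := Ba; move=> /(_ _ _ an).
exists c; split=> //.
by rewrite cmod_eval// (blaschke_zero Ba an) cmod0 mul0r.
Qed.

Lemma outside_liminf (lam : C) : cmod lam = 1 -> ~ factor_spectrum a mu lam ->
  exists ep rho : R, [/\ 0 < ep, 0 < rho &
    forall w, disc w -> cmod (w - lam) < rho -> ep <= cmod (eval theta w)].
Proof.
move=> lam1 /not_orP[ncl nsupp].
have [r1 r10 Hr1] : exists2 r : R, 0 < r & forall n c, a n = Some c -> r <= cmod (c - lam).
  apply: contrapT => H; apply: ncl => B /nbhs_cmodP[e e0 HB].
  apply: contrapT => nB; apply: H; exists e => // n c an; rewrite leNgt; apply/negP => ce.
  by apply: nB; exists c; split; [exists n|exact: HB].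
have [d d0 Hd] := blaschke_ge Ba lam1 r10 Hr1.
have [e e0 He] : exists2 e : R, 0 < e & mu [set t | cmod (expi t - lam) < e] = 0%E.
  apply: contrapT => H; apply: nsupp; split=> // e e0.
  by rewrite lt_neqAle measure_ge0 andbT eq_sym; apply/eqP => E; apply: H; exists e.
(* [mu] lives at distance at least [e] from [lam], so for [z] within [e / 2] of [lam] the Poisson
   kernel is at most [1 / (e / 2)^2] almost everywhere. *)
pose k : R := 4 / e ^+ 2; have k0 : 0 <= k by rewrite divr_ge0// sqr_ge0.
pose m := expR (- (k * fine (mu setT))).
have m0 : 0 < m by exact: expR_gt0.
have e2 : 0 < e / 2 by rewrite divr_gt0.
exists (m / 2), (Num.min d (e / 2)); split; [by rewrite divr_gt0|by rewrite lt_min d0|].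
move=> z z1; rewrite lt_min => /andP[zd ze]; rewrite cmod_eval//.
(* [|B| <= 1] gives [|B| >= |B|^2 >= 1/2]. *)
have Bz : 1 / 2 <= cmod (blaschke a z).
  by have := Hd z z1 zd; have := cmod_ge0 (blaschke a z); have := blaschke_le1 Ba z1; nra.
have Pz t : ~ [set t | cmod (expi t - lam) < e] t -> poisson z t <= k.
  move=> /= /negP; rewrite -leNgt => et.
  have tz : e / 2 <= cmod (expi t - z).
    have := cmod_triB (expi t - lam) (z - lam).
    by rewrite opprB addrA subrK; move: ze et; lra.
  have tz0 := lt_le_trans e2 tz.
  rewrite /poisson /k ler_pdivrMr ?exprn_gt0// mulrAC ler_pdivlMr ?exprn_gt0//.
  have gen (x w : R) : 0 <= w -> w < 1 -> e / 2 <= x -> (1 - w ^+ 2) * e ^+ 2 <= 4 * x ^+ 2.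
    move=> w0 w1 ex; have : (1 - w ^+ 2) * e ^+ 2 <= e ^+ 2.
      by rewrite ler_piMl ?sqr_ge0// gerBl sqr_ge0.
    by move: e0; nra.
  by apply: gen => //; exact: cmod_ge0.
have S1 : m <= expR (- fine (poisson_int mu z)).
  have mT : mu setT \is a fin_num by exact: fin_num_measure.
  have := poisson_int_le z1 k0 (arc_measurable lam e0) He Pz.
  rewrite -(fineK mT) -(fineK (poisson_int_fin mu z1)) -EFinM lee_fin => H.
  by rewrite ler_expR lerN2.
by rewrite (_ : m / 2 = 1 / 2 * m) ?ler_pM// ?(ltW m0)//; field.
Qed.

Lemma factor_spectrumP (lam : C) : cmod lam = 1 ->
  factor_spectrum a mu lam <-> forall ep rho : R, 0 < ep -> 0 < rho ->
    exists w, [/\ disc w, cmod (w - lam) < rho & cmod (eval theta w) < ep].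
Proof.
move=> lam1; split=> [[cl|supp] ep rho|H]; [exact: zeros_liminf|exact: supp_liminf|].
apply: contrapT => /(outside_liminf lam1)[ep [rho [ep0 rho0 Hw]]].
have [w [w1 wl]] := H _ _ ep0 rho0.
by rewrite ltNge Hw.
Qed.

End Factorization.
End FactorSpectrum.

(* The spectrum of theta is given both by the liminf condition and by any
   factorization theta = e^{iy} B s_mu. *)
Theorem corollary3p2 (R : realType) (M : set (taylor R)) (h theta : taylor R) :
  nearly_bshift_invariant M -> hitt M h theta ->
  ess_spectrum M (compressed_shift M) = liminf_spectrum theta `&` @circle R /\
  (forall (y : R) (a : nat -> option (Cplx R))
      (mu : {finite_measure set (measurableTypeR R) -> \bar R}),
    canonical_factorization theta y a mu ->
    ess_spectrum M (compressed_shift M) = factor_spectrum a mu `&` @circle R).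
Proof.
move=> nearly hittM; split=> [|y a mu fact]; apply/seteqP; split=> lam.
- by move=> /(not_fredholmP lam nearly hittM)[lam1 H]; split=> //; apply/liminf_spectrumP.
- move=> [/liminf_spectrumP H lam1]; apply/(not_fredholmP lam nearly hittM).
  by split=> //; exact: H.
- move=> /(not_fredholmP lam nearly hittM)[lam1 H]; split=> //.
  exact/(factor_spectrumP fact lam1).
- move=> [H lam1]; apply/(not_fredholmP lam nearly hittM).
  by split=> //; exact/(factor_spectrumP fact lam1).
Qed.
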